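(* Let $M$ be a compact manifold, let $\alpha>0$, and let $f:M\to M$ be a $C^{1+\alpha}$ diffeomorphism which is exponentially mixing with respect to a non-atomic $f$-invariant Borel probability measure $\mu$. Then $f$ has at least one positive Lyapunov exponent for the measure $\mu$.
   Context: $f$ is exponentially mixing with respect to an invariant probability measure $\mu$ if there exist $\mathbf r\in\mathbb N$, $C>0$ and $\eta>0$ such that for all $\phi,\psi\in C^{\mathbf r}(M)$ and all $n\in\mathbb N$, $$\left|\int_M\phi(x)\psi(f^nx)\,d\mu-\int_M\phi\,d\mu\int_M\psi\,d\mu\right|\le Ce^{-\eta n}\|\phi\|_{\mathbf r}\|\psi\|_{\mathbf r},$$ where $\|\cdot\|_{\mathbf r}$ is the norm on $C^{\mathbf r}(M)$. The measure $\mu$ is not assumed to be smooth. *)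

(* Defs.v *)
From HB Require Import structures.
From mathcomp Require Import all_boot all_order all_algebra.
From mathcomp Require Import all_classical all_reals all_analysis.

Set Implicit Arguments.
Unset Strict Implicit.
Unset Printing Implicit Defensive.

Import Order.TTheory GRing.Theory Num.Theory.
Import numFieldNormedType.Exports.

Local Open Scope classical_set_scope.
Local Open Scope ring_scope.

Definition iter_partial (R : realType) (d : nat) (W : normedModType R)
    (s : seq 'I_d) (F : 'rV[R]_d -> W) : 'rV[R]_d -> W :=
  foldr (fun (i : 'I_d) (G : 'rV[R]_d -> W) => 'D_(delta_mx 0 i) G) F s.

(* C^k regularity on [U], meant for open [U]: all partial derivatives of order
   at most k exist and are continuous at every point of [U]. *)
Definition Ck_on (R : realType) (d : nat) (W : normedModType R) (k : nat)
    (U : set 'rV[R]_d) (F : 'rV[R]_d -> W) : Prop :=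
  forall s : seq 'I_d,
    ((size s <= k)%N -> forall y, U y -> {for y, continuous (iter_partial s F)})
    /\ ((size s < k)%N -> forall (i : 'I_d) y, U y ->
          derivable (iter_partial s F) y (delta_mx 0 i)).

(* C^{k,b} regularity on [U]: C^k, with locally b-Hoelder derivatives of
   order k.  On a compact manifold local and global Hoelder conditions agree. *)
Definition Ck_holder_on (R : realType) (d : nat) (W : normedModType R)
    (k : nat) (b : R) (U : set 'rV[R]_d) (F : 'rV[R]_d -> W) : Prop :=
  Ck_on k U F /\
  forall s : seq 'I_d, size s = k -> forall y, U y ->
    exists (L : R) (V : set 'rV[R]_d), nbhs y V /\
      forall z w, V z -> V w ->
        `|iter_partial s F z - iter_partial s F w| <= L * `|z - w| `^ b.

(* A C^oo structure, without boundary, of dimension d.  Only the values of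
   [chart_map c] on [chart_dom c] and of [chart_inv c] on the image of the
   chart are meaningful.  [chart_at x] is a preferred chart around x; it is
   used only to represent the tangent space at x by R^d. *)
Record smooth_atlas (R : realType) (d : nat) (M : topologicalType) :=
  SmoothAtlas {
    chart : Type;
    chart_dom : chart -> set M;
    chart_map : chart -> M -> 'rV[R]_d;
    chart_inv : chart -> 'rV[R]_d -> M;
    chart_at : M -> chart;
    open_chart_dom : forall c, open (chart_dom c);
    open_chart_im : forall c, open (chart_map c @` chart_dom c);
    chart_mapK : forall c x, chart_dom c x -> chart_inv c (chart_map c x) = x;
    chart_map_continuous : forall c x, chart_dom c x ->
      {for x, continuous (chart_map c)};
    chart_inv_continuous : forall c x, chart_dom c x ->
      {for chart_map c x, continuous (chart_inv c)};
    chart_at_dom : forall x, chart_dom (chart_at x) x;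
    chart_transition : forall c c' k,
      Ck_on k (chart_map c @` (chart_dom c `&` chart_dom c'))
        (chart_map c' \o chart_inv c)
  }.

Definition Ck_fun (R : realType) (d : nat) (M : topologicalType)
    (A : smooth_atlas R d M) (k : nat) (phi : M -> R) : Prop :=
  forall c : chart A,
    Ck_on k (chart_map c @` chart_dom c) (phi \o chart_inv c : _ -> R^o).

Definition Ck_holder_map (R : realType) (d : nat) (M : topologicalType)
    (A : smooth_atlas R d M) (k : nat) (b : R) (F : M -> M) : Prop :=
  continuous F /\
  forall c c' : chart A,
    Ck_holder_on k b
      (chart_map c @` (chart_dom c `&` F @^-1` chart_dom c'))
      (chart_map c' \o F \o chart_inv c).

(* Regularity C^{1+a}, a > 0, is C^{k,b} for the unique natural number k and
   b in ]0, 1] such that 1 + a = k + b; hence C^{1,a} if a <= 1.  At integer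
   exponents this is a Lipschitz condition, which is weaker than C^{1+a}
   read as one more continuous derivative. *)
Definition C1plus_map (R : realType) (d : nat) (M : topologicalType)
    (A : smooth_atlas R d M) (a : R) (F : M -> M) : Prop :=
  Ck_holder_map A `|Num.ceil a|%N (1 + a - (`|Num.ceil a|%N)%:R) F.

Definition C1plus_diffeo (R : realType) (d : nat) (M : topologicalType)
    (A : smooth_atlas R d M) (a : R) (f : M -> M) : Prop :=
  exists g : M -> M, [/\ cancel f g, cancel g f,
    C1plus_map A a f & C1plus_map A a g].

(* A finite cover by compact sets (closed sets, M being compact) lying in
   charts.  It serves to define the C^r norm; different covers give
   equivalent norms. *)
Record chart_cover (R : realType) (d : nat) (M : topologicalType)
    (A : smooth_atlas R d M) := ChartCover {
  cover_size : nat;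
  cover_chart : 'I_cover_size -> chart A;
  cover_set : 'I_cover_size -> set M;
  closed_cover_set : forall l, closed (cover_set l);
  cover_set_sub : forall l, cover_set l `<=` chart_dom (cover_chart l);
  cover_setT : forall x, exists l, cover_set l x
}.

Definition Cr_norm (R : realType) (d : nat) (M : topologicalType)
    (A : smooth_atlas R d M) (K : chart_cover A) (r : nat) (phi : M -> R) : R :=
  \big[Num.max/0]_(l < cover_size K)
    \big[Num.max/0]_(k < r.+1) \big[Num.max/0]_(s : k.-tuple 'I_d)
      sup [set `|iter_partial s (phi \o chart_inv (cover_chart l) : _ -> R^o) y|
          | y in chart_map (cover_chart l) @` cover_set l].

Notation borel M := (g_sigma_algebraType (@open M)).

Definition invariant_measure (R : realType) (M : ptopologicalType)
    (mu : probability (borel M) R) (f : M -> M) : Prop :=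
  forall B : set (borel M), measurable B -> mu (f @^-1` B) = mu B.

Definition non_atomic (R : realType) (M : ptopologicalType)
    (mu : probability (borel M) R) : Prop :=
  forall B : set (borel M), measurable B -> (0 < mu B)%E ->
    exists B' : set (borel M),
      [/\ measurable B', B' `<=` B, (0 < mu B')%E & (mu B' < mu B)%E].

Definition exponentially_mixing (R : realType) (d : nat)
    (M : ptopologicalType) (A : smooth_atlas R d M) (K : chart_cover A)
    (mu : probability (borel M) R) (f : M -> M) : Prop :=
  exists (r : nat) (C eta : R), [/\ 0 < C, 0 < eta &
    forall phi psi : M -> R, Ck_fun A r phi -> Ck_fun A r psi ->
    forall n : nat,
      `| Rintegral mu setT (fun x => phi x * psi (iter n f x))
         - Rintegral mu setT phi * Rintegral mu setT psi |
      <= C * expR (- eta * n%:R) * Cr_norm K r phi * Cr_norm K r psi].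

Definition metric_form (R : realType) (d : nat) (G : 'M[R]_d)
    (v w : 'rV[R]_d) : R := (v *m G *m w^T) 0 0.

(* [metric_mx c x] is the Gram matrix, at the point x of the domain of c, of
   the coordinate frame of c. *)
Record riemannian_metric (R : realType) (d : nat) (M : topologicalType)
    (A : smooth_atlas R d M) := RiemannianMetric {
  metric_mx : chart A -> M -> 'M[R]_d;
  metric_sym : forall c x, chart_dom c x -> (metric_mx c x)^T = metric_mx c x;
  metric_pos : forall c x v, chart_dom c x -> v != 0 ->
    0 < metric_form (metric_mx c x) v v;
  metric_smooth : forall c k i j,
    Ck_on k (chart_map c @` chart_dom c)
      ((fun y => metric_mx c (chart_inv c y) i j) : _ -> R^o);
  metric_compat : forall c c' x v w, chart_dom c x -> chart_dom c' x ->
    metric_form (metric_mx c' x)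
      ('d (chart_map c' \o chart_inv c) (chart_map c x) v)
      ('d (chart_map c' \o chart_inv c) (chart_map c x) w)
    = metric_form (metric_mx c x) v w
}.

Definition tangent_norm (R : realType) (d : nat) (M : topologicalType)
    (A : smooth_atlas R d M) (g : riemannian_metric A) (x : M)
    (v : 'rV[R]_d) : R :=
  Num.sqrt (metric_form (metric_mx g (chart_at A x) x) v v).

(* The tangent map D_x F : T_x M -> T_(F x) M, each tangent space being
   identified with R^d by the preferred chart at its base point. *)
Definition tangent_map (R : realType) (d : nat) (M : topologicalType)
    (A : smooth_atlas R d M) (F : M -> M) (x : M) (v : 'rV[R]_d) : 'rV[R]_d :=
  'd (chart_map (chart_at A (F x)) \o F \o chart_inv (chart_at A x))
    (chart_map (chart_at A x) x) v.

(* chi(x, v) = limsup_n (1/n) log |D_x f^n v|, for v <> 0 *)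
Definition lyapunov_exponent_at (R : realType) (d : nat) (M : topologicalType)
    (A : smooth_atlas R d M) (g : riemannian_metric A) (f : M -> M) (x : M)
    (v : 'rV[R]_d) : \bar R :=
  limn_esup (fun n : nat =>
    (n%:R^-1 *
     ln (tangent_norm g (iter n f x) (tangent_map A (iter n f) x v)))%:E).

(* lambda is a Lyapunov exponent of f for mu: it is attained in some direction
   at mu-almost every point. *)
Definition is_lyapunov_exponent (R : realType) (d : nat)
    (M : ptopologicalType) (A : smooth_atlas R d M) (g : riemannian_metric A)
    (f : M -> M) (mu : probability (borel M) R) (lambda : R) : Prop :=
  {ae mu, forall x : M, exists2 v : 'rV[R]_d,
    v != 0 & lyapunov_exponent_at g f x v = lambda%:E}.

(* Main.v *)
Require Import Defs.
From HB Require Import structures.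
From mathcomp Require Import all_boot all_order all_algebra.
From mathcomp Require Import all_classical all_reals all_analysis.
From mathcomp Require Import measurable_realfun ring lra.

(* Suppose that all exponents are nonpositive. Then the functions
   ln (1 + |Df^N|) / N are bounded and tend to 0 almost everywhere, so their
   integrals tend to 0, and for a large N the integral of h = ln (1 + |Df^N|) is
   small compared with N times the mixing rate. By the maximal ergodic
   inequality, applied to h minus a constant theta, the Birkhoff sums of h along
   f^N at times k never exceed theta k on a set of measure at least 1/2.
   Around a point of that set the ball of radius e^(-theta n) has, after the
   f^N-time n, a small image, and such a ball can be chosen with mass at least
   c e^(-d theta n). Its image misses one of two fixed bump functions with
   disjoint, separated supports. Mixing, tested on this bump and on a bump of
   the ball (whose C^r norm is uniformly bounded), then contradicts the lower
   bound on the mass.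

   The growth rate of |Df^n| does not decrease along orbits. Mixing and the
   L^1-density of the C^r functions in the indicators of Borel sets give a
   zero-one law for its superlevel sets, so it is almost everywhere constant.
   It is attained by one of the coordinate vectors of a chart. *)

Set Implicit Arguments.
Unset Strict Implicit.
Unset Printing Implicit Defensive.

Import Order.TTheory GRing.Theory Num.Theory.
Import numFieldNormedType.Exports.

Local Open Scope classical_set_scope.
Local Open Scope ring_scope.

(** * Mean value estimates *)

(** A bump of height 1 on a ball of radius rho has C^r norm of order rho^-r, which would spoil the
    mixing bound as rho shrinks. The bumps here, (rho^2 - |y - a|^2)_+^(r+1) in a chart, are not
    normalised: their C^r norm stays bounded as rho tends to 0, and the price is paid in mass. For a
    well chosen centre the mass is at least of order rho^D with D = 2(r+1) + d, where 2(r+1) comes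
    from the height and d from counting grid points. The constants are tuned so that theta D = eta N
    / 2: the mass then decays at half the rate that mixing imposes on it.

    The 1 in ln (1 + |Df^N|) has two uses. It makes the function nonnegative, so that h >= - theta,
    which turns the maximal inequality into a set of mass at least 1/2. It also absorbs the error of
    the linear approximation at a fixed small scale, so that a step of the orbit expands distances
    by at most 1 + |Df^N|.

    Forward invariance suffices for the zero-one law: if B is contained in its preimage, then 1_B
    times 1_B o f^n is 1_B for every n, while mixing makes these correlations tend to mu(B)^2. *)

Section row_norm.
Variables (R : realType) (d : nat).
Implicit Types v : 'rV[R]_d.

Lemma row_norm_leP v (e : R) : 0 <= e ->
  (`|v| <= e) <-> (forall i, `|v 0 i| <= e).
Proof.
move=> e0; rewrite [`|v|]mx_normrE; split => [h i|h].
  by apply: le_trans h; exact: (le_bigmax _ _ (ord0, i)).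
apply/bigmax_leP; split => // -[i j] _ /=.
by rewrite ord1.
Qed.

Lemma row_norm_ltP v (e : R) : 0 < e ->
  (`|v| < e) <-> (forall i, `|v 0 i| < e).
Proof.
move=> e0; rewrite [`|v|]mx_normrE; split => [h i|h].
  by apply: le_lt_trans h; exact: (le_bigmax _ _ (ord0, i)).
apply/bigmax_ltP; split => // -[i j] _ /=.
by rewrite ord1.
Qed.

Lemma coord_le_norm v i : `|v 0 i| <= `|v|.
Proof. by have /row_norm_leP := lexx `|v|; exact. Qed.

Lemma norm_delta_mx (i : 'I_d) : `|delta_mx 0 i : 'rV[R]_d| = 1.
Proof.
apply/eqP; rewrite eq_le; apply/andP; split.
  apply/row_norm_leP => // j; rewrite mxE /=.
  by case: (j == i); rewrite ?normr1 ?normr0.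
by have := coord_le_norm (delta_mx 0 i) i; rewrite mxE !eqxx /= normr1.
Qed.

End row_norm.

Section entry_norm.
Variable R : realType.

(** An entrywise norm in place of the operator norm: it is submultiplicative, controls the action on
    sup-normed row vectors, and its continuity can be read off the entries. *)
Definition entry_norm m n (J : 'M[R]_(m, n)) : R := \sum_i \sum_j `|J i j|.

Lemma entry_norm_ge0 m n (J : 'M[R]_(m, n)) : 0 <= entry_norm J.
Proof. by apply: sumr_ge0 => i _; exact: sumr_ge0. Qed.

Lemma mul_row_norm_le m n (v : 'rV[R]_m) (J : 'M[R]_(m, n)) :
  `|v *m J| <= entry_norm J * `|v|.
Proof.
apply/row_norm_leP => [|j]; first by rewrite mulr_ge0 ?entry_norm_ge0.
rewrite mxE; apply: le_trans (ler_norm_sum _ _ _) _.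
rewrite /entry_norm mulr_suml; apply: ler_sum => i _.
rewrite normrM mulrC; apply: ler_pM => //; last exact: coord_le_norm.
by rewrite (bigD1 j) //= lerDl sumr_ge0.
Qed.

Lemma entry_norm_mul m n p (A : 'M[R]_(m, n)) (B : 'M[R]_(n, p)) :
  entry_norm (A *m B) <= entry_norm A * entry_norm B.
Proof.
rewrite /entry_norm mulr_suml; apply: ler_sum => i _.
apply: (@le_trans _ _ (\sum_k \sum_j `|A i j| * `|B j k|)).
  apply: ler_sum => k _; rewrite mxE; apply: le_trans (ler_norm_sum _ _ _) _.
  by apply: ler_sum => j _; rewrite normrM.
rewrite exchange_big mulr_suml; apply: ler_sum => j _.
rewrite -mulr_sumr ler_wpM2l// (bigD1 j) //= lerDl.
by apply: sumr_ge0 => ? _; exact: sumr_ge0.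
Qed.

Lemma entry_norm_rows m n (J : 'M[R]_(m, n)) :
  entry_norm J <= n%:R * \sum_i `|row i J|.
Proof.
rewrite /entry_norm mulr_sumr; apply: ler_sum => i _.
apply: (@le_trans _ _ (\sum_(j < n) `|row i J|)).
  apply: ler_sum => j _.
  by have := coord_le_norm (row i J) j; rewrite mxE.
by rewrite sumr_const card_ord mulr_natl.
Qed.

End entry_norm.

Section mean_value.
Variables (R : realType) (d : nat).

Lemma is_derive_line (u : 'rV[R]_d -> R) (p e : 'rV[R]_d) (s : R) :
  derivable (u : _ -> R^o) (p + s *: e) e ->
  is_derive s 1 (fun s => u (p + s *: e) : R^o)
    ('D_e (u : _ -> R^o) (p + s *: e)).
Proof.
move=> du.
have E : (fun h : R => h^-1 *: (u (p + (h *: (1 : R) + s) *: e) - u (p + s *: e) : R^o))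
  = (fun h : R => h^-1 *: (u (h *: e + (p + s *: e)) - u (p + s *: e) : R^o)).
  apply/funext => h; congr (_ *: (u _ - _)).
  by rewrite [h *: 1]mulr1 scalerDl addrCA.
split; first by rewrite /derivable E.
by rewrite /derive E.
Qed.

Lemma mean_value_line (u : 'rV[R]_d -> R) (p e : 'rV[R]_d) (t : R) :
  (forall s : R, `|s| <= `|t| -> derivable (u : _ -> R^o) (p + s *: e) e) ->
  exists2 s : R, `|s| <= `|t| &
    u (p + t *: e) - u p = t * 'D_e (u : _ -> R^o) (p + s *: e).
Proof.
move=> du.
pose g (s : R) : R := u (p + s *: e).
have isd (s : R) : `|s| <= `|t| ->
    is_derive s 1 g ('D_e (u : _ -> R^o) (p + s *: e)).
  by move=> st; apply: is_derive_line; exact: du.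
have g0 : g 0 = u p by rewrite /g scale0r addr0.
have [t0|t0] := leP 0 t.
  have bnd (s : R) : s \in `[0, t]%R -> `|s| <= `|t|.
    by rewrite in_itv /= => /andP[s0 st]; rewrite !ger0_norm.
  have [| |s /bnd st] := @MVT_segment R g (fun s => 'D_e (u : _ -> R^o) (p + s *: e)) 0 t t0.
  - move=> s; rewrite in_itv /= => /andP[s0 st]; apply: isd.
    by apply: bnd; rewrite in_itv /= !ltW.
  - apply: derivable_within_continuous => s /bnd /isd ds.
    exact: ex_derive.
  - by rewrite g0 subr0 mulrC => E; exists s.
have bnd (s : R) : s \in `[t, 0]%R -> `|s| <= `|t|.
  by rewrite in_itv /= => /andP[s0 st]; rewrite !ler0_norm ?lerN2// ltW.
have [| |s /bnd st] := @MVT_segment R g (fun s => 'D_e (u : _ -> R^o) (p + s *: e)) t 0 (ltW t0).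
- move=> s; rewrite in_itv /= => /andP[s0 st]; apply: isd.
  by apply: bnd; rewrite in_itv /= !ltW.
- apply: derivable_within_continuous => s /bnd /isd ds.
  exact: ex_derive.
- rewrite g0 sub0r mulrN => E; exists s => //; apply: oppr_inj.
  by rewrite opprB mulrC -E.
Qed.

Implicit Types w z y p : 'rV[R]_d.

(** A path from [w] to [z] that changes one coordinate at a time, so that increments are governed by
    partial derivatives alone. In the sup norm it stays as close to [y] as [w] and [z] are. *)
Definition path_pt (w z : 'rV[R]_d) (k : nat) : 'rV[R]_d :=
  \row_j if (j < k)%N then z 0 j else w 0 j.

Lemma path_pt0 w z : path_pt w z 0 = w.
Proof. by apply/rowP => j; rewrite mxE. Qed.

Lemma path_ptd w z : path_pt w z d = z.
Proof. by apply/rowP => j; rewrite mxE ltn_ord. Qed.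

Lemma path_ptS w z (k : 'I_d) :
  path_pt w z k.+1 = path_pt w z k + (z 0 k - w 0 k) *: delta_mx 0 k.
Proof.
apply/rowP => j; rewrite !mxE ltnS eqxx /= -val_eqE /=.
by case: (ltngtP j k) => [jk|jk|/val_inj ->];
  rewrite ?mulr0 ?addr0 // mulr1 addrC subrK.
Qed.

Lemma path_pt_near w z y r (k : 'I_d) (s : R) :
  0 < r -> `|w - y| < r -> `|z - y| < r -> `|s| <= `|z 0 k - w 0 k| ->
  `|path_pt w z k + s *: delta_mx 0 k - y| < r + r + r.
Proof.
move=> r0 wy zy sk.
have A : `|path_pt w z k - y| < r.
  apply/row_norm_ltP => // j; rewrite !mxE.
  move/row_norm_ltP : wy => /(_ r0 j); rewrite !mxE => wy.
  move/row_norm_ltP : zy => /(_ r0 j); rewrite !mxE => zy.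
  by case: ifP.
have B : `|z 0 k - w 0 k| < r + r.
  have := coord_le_norm (z - w) k; rewrite !mxE => /le_lt_trans; apply.
  rewrite -(subrKA y); apply: le_lt_trans (ler_normD _ _) _.
  by rewrite ltrD // distrC.
rewrite addrAC; apply: le_lt_trans (ler_normD _ _) _.
rewrite normrZ norm_delta_mx mulr1 -addrA; apply: ltrD => //.
exact: le_lt_trans sk B.
Qed.

End mean_value.

Section sdiff.
Variable R : realType.

(** Strict differentiability: both points vary near [y]. This two-point form composes well, gives
    Lipschitz estimates on a neighbourhood, and forces derivatives at nearby points to be close. *)
Definition sdiff d d' (h : 'rV[R]_d -> 'rV[R]_d') (y : 'rV[R]_d)
    (J : 'M[R]_(d, d')) : Prop :=
  forall e : R, 0 < e -> exists2 r : R, 0 < r &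
    forall z w : 'rV[R]_d, `|z - y| < r ->
    `|w - y| < r -> `|h z - h w - (z - w) *m J| <= e * `|z - w|.

Definition Jac d d' (h : 'rV[R]_d -> 'rV[R]_d') (y : 'rV[R]_d) : 'M[R]_(d, d') :=
  \matrix_(i, j) ('D_(delta_mx 0 i) h y) 0 j.

Lemma nbhs_radius d (y : 'rV[R]_d) (P : set 'rV[R]_d) :
  nbhs y P -> exists2 r : R, 0 < r & forall z, `|z - y| < r -> P z.
Proof.
move=> /nbhs_ballP[r /= r0 rP]; exists r => // z zy; apply: rP.
by rewrite -ball_normE /= distrC.
Qed.

Lemma radius_nbhs d (y : 'rV[R]_d) (r : R) : 0 < r ->
  nbhs y [set z | `|z - y| < r].
Proof.
move=> r0; apply/nbhs_ballP; exists r => //= z.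
by rewrite -ball_normE /= distrC.
Qed.

(** Along the path that changes one coordinate at a time, the mean value theorem expresses each
    increment by a partial derivative at a point near [y], where it is close to its value at [y]. *)
Lemma Ck1_sdiff d d' (U : set 'rV[R]_d) (h : 'rV[R]_d -> 'rV[R]_d') y :
  open U -> Ck_on 1 U h -> U y -> sdiff h y (Jac h y).
Proof.
move=> oU hC Uy e e0.
have dh i z : U z -> derivable h z (delta_mx 0 i).
  by move=> Uz; have [_ /(_ isT i z Uz)] := hC [::].
pose D i j z := 'D_(delta_mx 0 i) (fun x => h x 0 j : R^o) z.
have DE i j z : U z -> ('D_(delta_mx 0 i) h z) 0 j = D i j z.
  by move=> Uz; rewrite derive_mx ?mxE//; exact: dh.
(* The path has [d] increments, each with an error of at most [e1] times |z - w|; [d.+1] keeps the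
   divisor nonzero when [d] is 0. *)
pose e1 := e / d.+1%:R.
have e10 : 0 < e1 by rewrite divr_gt0.
have near_y : \forall z \near y, U z /\
    forall ij : 'I_d * 'I_d', `|D ij.1 ij.2 z - D ij.1 ij.2 y| < e1.
  suff nD : \forall z \near y,
      forall ij : 'I_d * 'I_d', `|D ij.1 ij.2 z - D ij.1 ij.2 y| < e1.
    by apply: filterS2 nD (open_nbhs_nbhs (conj oU Uy)) => z; split.
  apply: (@filter_forall _ _
    (fun ij z => `|D ij.1 ij.2 z - D ij.1 ij.2 y| < e1) (nbhs y) _) => -[i j] /=.
  have ci : {for y, continuous ('D_(delta_mx 0 i) h)}.
    by have [/(_ isT y Uy)] := hC [:: i].
  have cij : {for y, continuous (fun z => ('D_(delta_mx 0 i) h z) 0 j : R^o)}.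
    exact: (continuous_comp ci (@coord_continuous _ _ _ 0 j _)).
  have /cvgrPdist_lt /(_ _ e10) := cij.
  apply: filterS2 (open_nbhs_nbhs (conj oU Uy)) => z Uz.
  by rewrite -(DE _ _ _ Uz) -(DE _ _ _ Uy) distrC.
have [r r0 hr] := nbhs_radius near_y.
(* Path points are within r/3 of [y], and the offset along an edge is below 2r/3. *)
exists (r / 3) => [|z w zy wy]; first by rewrite divr_gt0.
have ze0 : 0 <= e * `|z - w| by rewrite mulr_ge0 // ltW.
apply/row_norm_leP => // j.
pose u x := h x 0 j.
have step (k : 'I_d) : exists2 xi, `|xi - y| < r &
    u (path_pt w z k.+1) - u (path_pt w z k) = (z 0 k - w 0 k) * D k j xi.
  have nr (s : R) : `|s| <= `|z 0 k - w 0 k| ->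
      `|path_pt w z k + s *: delta_mx 0 k - y| < r.
    move=> sk; have := @path_pt_near R d w z y (r/3) k s.
    have -> : r / 3 + r / 3 + r / 3 = r by lra.
    by apply => //; rewrite divr_gt0.
  have [s sk E] := @mean_value_line R d u (path_pt w z k) (delta_mx 0 k)
      (z 0 k - w 0 k) (fun s sk => (derivable_mxP h _ _).1 (dh k _ (hr _ (nr s sk)).1) 0 j).
  by exists (path_pt w z k + s *: delta_mx 0 k); [exact: nr|rewrite path_ptS].
have tel : u z - u w = \sum_(k < d) (u (path_pt w z k.+1) - u (path_pt w z k)).
  rewrite -(big_mkord xpredT (fun k => u (path_pt w z k.+1) - u (path_pt w z k))).
  by rewrite telescope_sumr // path_ptd path_pt0.
rewrite !mxE -/(u z) -/(u w) tel -sumrB.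
apply: le_trans (ler_norm_sum _ _ _) _.
apply: (@le_trans _ _ (\sum_(k < d) e1 * `|z - w|)).
  apply: ler_sum => k _; have [xi xiy ->] := step k.
  rewrite !mxE DE // -mulrBr normrM mulrC ler_pM //.
    by apply: ltW; have [_ /(_ (k, j))] := hr _ xiy.
  by have := coord_le_norm (z - w) k; rewrite !mxE.
rewrite sumr_const card_ord -mulrnAl ler_wpM2r //.
by rewrite /e1 -mulr_natr mulrAC ler_pdivrMr ?ltr0n // ler_wpM2l ?ler_nat ?ltW.
Qed.

End sdiff.

(** * Strict differentiability *)

Section sdiff_theory.
Variable R : realType.

Lemma sdiff_diff d d' (h : 'rV[R]_d -> 'rV[R]_d') y (J : 'M[R]_(d, d')) v :
  sdiff h y J -> 'd h y v = v *m J.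
Proof.
move=> hJ.
suff -> : 'd h y = mulmxr J :> ('rV[R]_d -> 'rV[R]_d') by [].
apply: diff_unique.
  apply: bounded_linear_continuous; apply/linear_boundedP.
  near=> r => v'; apply: le_trans (mul_row_norm_le _ _) _.
  by rewrite ler_wpM2r.
apply/eqaddoP => e e0.
have [r r0 hr] := hJ e e0.
have : \forall v' \near (0 : 'rV[R]_d), `|v' - 0| < r by exact: radius_nbhs.
apply: filterS => v'; rewrite subr0 => v'r.
have := hr (v' + y) y; rewrite !addrK subrr normr0 => /(_ v'r r0).
by rewrite -[(_ - _) v']/(h (v' + y) - (h y + v' *m J)) opprD addrA.
Unshelve. all: by end_near. Qed.

Lemma continuous_radius d (W : normedModType R) (h : 'rV[R]_d -> W) y :
  (forall e : R, 0 < e -> exists2 r : R, 0 < r &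
    forall z, `|z - y| < r -> `|h z - h y| < e) -> {for y, continuous h}.
Proof.
move=> H; apply/(cvgrPdistC_lt (F := nbhs y) h (h y)) => e /H[r r0 hr].
exact: (@filterS _ _ (nbhs_filter y) _ _ hr (radius_nbhs y r0)).
Qed.

Lemma sdiff_continuous d d' (h : 'rV[R]_d -> 'rV[R]_d') y J :
  sdiff h y J -> {for y, continuous h}.
Proof.
move=> hJ; have [r r0 hr] := hJ 1 ltr01.
apply: continuous_radius => e e0.
pose C := entry_norm J + 1 + 1.
have C0 : 0 < C by have := entry_norm_ge0 J; rewrite /C; lra.
exists (Num.min r (e / C)); first by rewrite lt_min r0 divr_gt0.
move=> z; rewrite lt_min => /andP[zr ze].
have := hr z y zr; rewrite subrr normr0 => /(_ r0) hz.
apply: le_lt_trans (_ : C * `|z - y| < _).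
  rewrite -(subrK ((z - y) *m J) (h z - h y)).
  apply: le_trans (ler_normD _ _) _.
  have := mul_row_norm_le (z - y) J; have := normr_ge0 (z - y); rewrite /C; lra.
by rewrite mulrC -ltr_pdivlMr.
Qed.

Lemma sdiff_comp d1 d2 d3 (h : 'rV[R]_d1 -> 'rV[R]_d2)
    (k : 'rV[R]_d2 -> 'rV[R]_d3) y J J' :
  sdiff h y J -> sdiff k (h y) J' -> sdiff (k \o h) y (J *m J').
Proof.
move=> hJ kJ e e0.
pose C := entry_norm J + 1 + entry_norm J' + 1.
have C1 : 1 <= C.
  by have := entry_norm_ge0 J; have := entry_norm_ge0 J'; rewrite /C; lra.
have C0 : 0 < C by exact: lt_le_trans ltr01 C1.
have CC0 : 0 < C + C by lra.
(* The bound by 1 makes [C] a Lipschitz constant of [h] near [y]; the two error terms of the chain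
   rule are then at most [e1 * C] times |z - w| each. *)
pose e1 := Num.min 1 (e / (C + C)).
have e10 : 0 < e1 by rewrite lt_min ltr01 /= divr_gt0.
have [r r0 hr] := hJ _ e10.
have [s s0 ks] := kJ _ e10.
have /cvgrPdist_lt /(_ s s0) /nbhs_radius[t t0 ht] := sdiff_continuous hJ.
exists (Num.min r t); first by rewrite lt_min r0.
move=> z w; rewrite !lt_min => /andP[zr zt] /andP[wr wt].
have hz : `|h z - h y| < s by rewrite distrC ht.
have hw : `|h w - h y| < s by rewrite distrC ht.
have A := hr _ _ zr wr; have B := ks _ _ hz hw.
have D : `|h z - h w| <= C * `|z - w|.
  rewrite -(subrK ((z - w) *m J) (h z - h w)).
  apply: le_trans (ler_normD _ _) _.
  apply: (@le_trans _ _ (1 * `|z - w| + entry_norm J * `|z - w|)).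
    apply: lerD; last exact: mul_row_norm_le.
    by apply: le_trans A _; rewrite ler_wpM2r // /e1 ge_min lexx.
  rewrite -mulrDl ler_wpM2r // /C.
  have := entry_norm_ge0 J'; lra.
have E : k (h z) - k (h w) - (z - w) *m (J *m J') =
  (k (h z) - k (h w) - (h z - h w) *m J') +
  (h z - h w - (z - w) *m J) *m J'.
  by rewrite (mulmxBl (h z - h w) ((z - w) *m J) J') addrA subrK mulmxA.
rewrite /= E; apply: le_trans (ler_normD _ _) _.
have eC : e1 * (C + C) <= e.
  by rewrite -ler_pdivlMr // /e1 ge_min lexx orbT.
apply: (@le_trans _ _ (e1 * (C + C) * `|z - w|)); last by rewrite ler_wpM2r.
rewrite mulrDr mulrDl; apply: lerD.
  by apply: le_trans B _; rewrite -mulrA ler_wpM2l // ltW.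
apply: le_trans (mul_row_norm_le _ _) _.
rewrite mulrAC [e1 * _ * _]mulrC; apply: ler_pM => //; first exact: entry_norm_ge0.
have := entry_norm_ge0 J; rewrite /C; lra.
Qed.

Lemma sdiff_near d d' (h h' : 'rV[R]_d -> 'rV[R]_d') y J :
  (\forall z \near y, h z = h' z) -> sdiff h y J -> sdiff h' y J.
Proof.
move=> /nbhs_radius[r r0 hr] hJ e e0; have [s s0 hs] := hJ _ e0.
exists (Num.min r s); first by rewrite lt_min r0.
move=> z w; rewrite !lt_min => /andP[zr zs] /andP[wr ws].
by rewrite -!hr //; exact: hs.
Qed.

(** Both derivatives approximate the same increment of [h] on the segment from [z] to [z + u v],
    with [u] so small that it fits both radii. Homogeneity in [v] then removes [u]. *)
Lemma sdiff_close d d' (h : 'rV[R]_d -> 'rV[R]_d') y J (e : R) :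
  sdiff h y J -> 0 < e -> exists2 r : R, 0 < r & forall z J', `|z - y| < r ->
    sdiff h z J' -> forall v : 'rV[R]_d, `|v *m (J' - J)| <= e * `|v|.
Proof.
move=> hJ e0; have e20 : 0 < e / 2 by rewrite divr_gt0.
have [r r0 hr] := hJ _ e20.
exists r => // z J' zr hJ' v.
have [s s0 hs] := hJ' _ e20.
have [->|v0] := eqVneq v 0; first by rewrite mul0mx !normr0 mulr0.
have nv : 0 < `|v| by rewrite normr_gt0.
pose u := Num.min s (r - `|z - y|) / (2 * `|v|).
have m0 : 0 < Num.min s (r - `|z - y|) by rewrite lt_min s0 subr_gt0.
have u0 : 0 < u by rewrite divr_gt0 // mulr_gt0.
have uv : `|u *: v| < Num.min s (r - `|z - y|).
  rewrite normrZ gtr0_norm //.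
  have -> : u * `|v| = Num.min s (r - `|z - y|) / 2.
    by rewrite /u; field; rewrite gt_eqF.
  lra.
move: uv; rewrite lt_min => /andP[us ur].
have zur : `|z + u *: v - y| < r.
  rewrite addrAC; apply: le_lt_trans (ler_normD _ _) _.
  by move: ur; set q := `|_ *: _|; set q' := `|z - y|; lra.
have A := hr (z + u *: v) z zur zr.
have := hs (z + u *: v) z; rewrite subrr normr0.
have E : z + u *: v - z = u *: v by rewrite addrC addKr.
rewrite E in A *; move=> /(_ us s0) B.
have : `|(u *: v) *m (J' - J)| <= e * `|u *: v|.
  have -> : (u *: v) *m (J' - J) =
    (h (z + u *: v) - h z - (u *: v) *m J) -
    (h (z + u *: v) - h z - (u *: v) *m J').
    by move: (h _ - h z) => X; rewrite mulmxBr opprB [RHS]addrC addrA subrK.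
  apply: le_trans (ler_normB _ _) _.
  by rewrite (splitr e) mulrDl lerD.
by clearbody u; rewrite -scalemxAl !normrZ mulrCA ler_pM2l // gtr0_norm.
Qed.

Lemma sdiff_derivable d d' (h : 'rV[R]_d -> 'rV[R]_d') y J v :
  sdiff h y J -> is_derive y v h (v *m J).
Proof.
move=> hJ.
suff H : (fun t : R => t^-1 *: (h (t *: v + y) - h y)) @ 0^' --> v *m J.
  by split; [apply/cvg_ex; exists (v *m J)|exact/cvg_lim].
apply/cvgrPdist_le => /= e e0.
pose e1 := e / (`|v| + 1).
have v10 : 0 < `|v| + 1 by rewrite ltr_wpDl.
have [r r0 hr] := hJ e1 (divr_gt0 e0 v10).
near=> t.
have t0 : t != 0 by near: t; exact: nbhs_dnbhs_neq.
have tr : `|t| < r / (`|v| + 1).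
  by near: t; apply: dnbhs0_lt; exact: divr_gt0.
have tv : `|t *: v| < r.
  rewrite normrZ; apply: le_lt_trans (_ : `|t| * (`|v| + 1) < _).
    by rewrite ler_wpM2l // lerDl.
  by rewrite -ltr_pdivlMr.
have := hr (t *: v + y) y; rewrite addrK subrr normr0 => /(_ tv r0) A.
have -> : v *m J - t^-1 *: (h (t *: v + y) - h y) =
    - (t^-1 *: (h (t *: v + y) - h y - (t *: v) *m J)).
  by rewrite [in RHS]scalerBr -scalemxAl scalerA mulVf // scale1r opprB.
rewrite normrN normrZ normfV ler_pdivrMl ?normr_gt0 //.
apply: le_trans A _; rewrite normrZ mulrCA ler_wpM2l //.
by rewrite /e1 mulrAC ler_pdivrMr // ler_wpM2l ?lerDl // ltW.
Unshelve. all: by end_near. Qed.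

Lemma sdiff_Jac d d' (h : 'rV[R]_d -> 'rV[R]_d') y J :
  sdiff h y J -> Jac h y = J.
Proof.
move=> hJ; apply/matrixP => i j; rewrite mxE.
have := sdiff_derivable (delta_mx 0 i) hJ.
by move=> [_ ->]; rewrite -rowE mxE.
Qed.

End sdiff_theory.

(** * Functions of class C^k *)

Section Ck_recursion.
Variables (R : realType) (d : nat) (W : normedModType R).
Implicit Types (F G : 'rV[R]_d -> W) (U : set 'rV[R]_d).

Lemma iter_partial_rcons s i F :
  iter_partial (rcons s i) F = iter_partial s ('D_(delta_mx 0 i) F).
Proof. by rewrite /iter_partial foldr_rcons. Qed.

Lemma Ck_on0 U F : Ck_on 0 U F <-> forall y, U y -> {for y, continuous F}.
Proof.
split=> [FC y Uy|FC [|i s]]; last by split.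
  by have [/(_ isT y Uy)] := FC [::].
by split=> // _.
Qed.

(** A recursion on the order. Since [iter_partial] is a right fold, the last entry of the sequence
    is the derivative taken first, hence the use of [rcons]. *)
Lemma Ck_onS k U F : Ck_on k.+1 U F <->
  [/\ forall y, U y -> {for y, continuous F},
      forall i y, U y -> derivable F y (delta_mx 0 i)
    & forall i, Ck_on k U ('D_(delta_mx 0 i) F)].
Proof.
split=> [FC|[F0 F1 FC] s].
  split; [by have [/(_ isT)] := FC [::]|by have [_ /(_ isT)] := FC [::]|].
  move=> i s; have := FC (rcons s i).
  by rewrite size_rcons iter_partial_rcons !ltnS.
case/lastP: s => [|s i]; first by split=> _; [exact: F0|exact: F1].
by rewrite size_rcons iter_partial_rcons !ltnS; exact: FC.
Qed.

Lemma near_ext_on U F G y : open U -> U y ->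
  (forall z, U z -> F z = G z) -> \near y, F y = G y.
Proof.
move=> oU Uy FG.
exact: (@filterS _ _ (nbhs_filter y) U _ FG (open_nbhs_nbhs (conj oU Uy))).
Qed.

Lemma derivable_ext_on U F G y v : open U -> U y ->
  (forall z, U z -> F z = G z) -> derivable F y v -> derivable G y v.
Proof.
move=> oU Uy FG; apply: near_eq_derivable.
exact: near_ext_on oU Uy FG.
Qed.

Lemma derive_ext_on U F G y v : open U -> U y ->
  (forall z, U z -> F z = G z) -> 'D_v F y = 'D_v G y.
Proof.
move=> oU Uy FG; apply: near_eq_derive.
exact: near_ext_on oU Uy FG.
Qed.

Lemma continuous_ext_on U F G y : open U -> U y ->
  (forall z, U z -> F z = G z) -> {for y, continuous F} -> {for y, continuous G}.
Proof.
move=> oU Uy FG Fc; rewrite /prop_for /continuous_at -(FG _ Uy).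
apply: cvg_trans Fc; apply: (@near_eq_cvg _ _ (nbhs y) _).
exact: near_ext_on oU Uy FG.
Qed.

Lemma iter_partial_ext_on U F G s y : open U -> U y ->
  (forall z, U z -> F z = G z) -> iter_partial s F y = iter_partial s G y.
Proof.
move=> oU + FG; elim: s y => [|i s IH] y Uy /=; first exact: FG.
by apply: (derive_ext_on _ oU Uy) => z Uz; exact: IH.
Qed.

End Ck_recursion.

(** * Truncated powers *)

Section positive_power.
Variables (R : realType).

(** For positive [m] this is of class C^(m-1) and supported on the half-line. Such finite smoothness
    is enough for bumps, as mixing is tested at one fixed order r. *)
Definition pospow (m : nat) (t : R) : R := Num.max 0 t ^+ m.

Lemma pospow_ge0 m t : 0 <= pospow m t.
Proof. by rewrite /pospow exprn_ge0 // le_max lexx. Qed.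

Lemma pospow_gt0 m t : (0 < pospow m.+1 t) = (0 < t).
Proof.
have [t0|t0] := ltP 0 t; last first.
  by rewrite /pospow max_l // expr0n ltxx.
by rewrite /pospow max_r ?exprn_gt0 // ltW.
Qed.

Lemma pospowE m t : 0 <= t -> pospow m t = t ^+ m.
Proof. by move=> t0; rewrite /pospow max_r. Qed.

Lemma pospow_le m s t : s <= t -> pospow m s <= pospow m t.
Proof.
move=> st; apply: lerXn2r; [by rewrite nnegrE le_max lexx..|].
by rewrite ge_max le_max lexx /= le_max st orbT.
Qed.

Lemma continuous_pospow m : continuous (pospow m.+1 : R -> R).
Proof.
have c1 : continuous (pospow 1 : R -> R).
  move=> t; apply/cvgrPdist_lt => e e0; near=> s.
  have ts : `|t - s| < e by near: s; apply/nbhs_ballP; exists e.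
  apply: le_lt_trans ts; rewrite /pospow !expr1.
  have := ler_norm (s - t); rewrite distrC; have := ler_norm (t - s).
  move: `|t - s| => X tX sX; rewrite ler_norml /Num.max.
  by apply/andP; split; case: ltP => ?; case: ltP => ?; lra.
elim: m => // m IH t.
have -> : pospow m.+2 = fun s => pospow m.+1 s * pospow 1 s.
  by apply/funext => s; rewrite /pospow expr1 exprSr.
exact: (@continuousM _ _ (pospow m.+1) (pospow 1) t (IH t) (c1 t)).
Unshelve. all: by end_near. Qed.

Lemma pospowS m t : pospow m.+1 t * t = pospow m.+2 t.
Proof.
rewrite /pospow [in RHS]exprSr /Num.max; case: ltP => // t0.
by rewrite exprS !mul0r.
Qed.

(** For the square, the remainder of the linear approximation is at most h^2 whatever the signs of
    [t] and [t + h]. Higher powers follow from the product rule through [pospowS]. *)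
Lemma is_derive_pospow m (t : R) :
  is_derive t 1 (pospow m.+2 : R -> R) (m.+2%:R * pospow m.+1 t).
Proof.
elim: m => [|m IH].
  have H : (fun h : R => h^-1 *: (pospow 2 (h *: (1 : R) + t) - pospow 2 t)) @ 0^'
      --> 2 * pospow 1 t.
    apply/cvgrPdist_le => e e0; near=> h.
    have h0 : h != 0 by near: h; exact: nbhs_dnbhs_neq.
    have he : `|h| < e by near: h; exact: dnbhs0_lt.
    rewrite [h *: 1]mulr1.
    have -> : 2 * pospow 1 t - h^-1 *: (pospow 2 (h + t) - pospow 2 t) =
       - (h^-1 * (pospow 2 (h + t) - pospow 2 t - 2 * h * pospow 1 t)).
      by rewrite /GRing.scale /=; field.
    rewrite normrN normrM normfV ler_pdivrMl ?normr_gt0 //.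
    apply: (@le_trans _ _ (`|h| * `|h|)); last by rewrite ler_wpM2l // ltW.
    rewrite -normrM ler_norml /pospow !expr1 !expr2 ger0_norm -?expr2 ?sqr_ge0 //.
    rewrite /Num.max; case: ltP => a; case: ltP => b; apply/andP; split; nra.
  split; first by apply/cvg_ex; exists (2 * pospow 1 t).
  exact/cvg_lim.
have -> : pospow m.+3 = pospow m.+2 * id :> (R -> R).
  by apply/funext => s; rewrite -pospowS.
apply: is_derive_eq (is_deriveM IH (is_derive_id t 1)) _.
rewrite /GRing.scale /= mulr1 mulrC -mulrA pospowS.
by rewrite -[in RHS]natr1 [RHS]mulrDl mul1r addrC.
Unshelve. all: by end_near. Qed.

End positive_power.

Section pospow_chain.
Variables (R : realType) (d : nat).

Lemma is_derive_lineV (w : 'rV[R]_d -> R^o) (p e : 'rV[R]_d) (D : R) :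
  is_derive (0 : R) 1 (fun s : R => w (p + s *: e)) D -> is_derive p e w D.
Proof.
have E : (fun h : R => h^-1 *: (w (p + (h *: (1 : R) + 0) *: e) - w (p + 0 *: e)))
  = (fun h : R => h^-1 *: (w (h *: e + p) - w p)).
  apply/funext => h; rewrite scale0r !addr0 [h *: 1]mulr1.
  by congr (_ *: (w _ - _)); rewrite addrC.
by rewrite /derivable /derive => -[]; rewrite /derivable /derive E => ? ?; split.
Qed.

(** Only the directional derivative of [u] is available, so the one-variable chain rule is applied
    on the line through [y] and carried back. *)
Lemma is_derive_pospow_comp (u : 'rV[R]_d -> R^o) m y v :
  derivable u y v -> is_derive y v (fun z => pospow m.+2 (u z) : R^o)
    (m.+2%:R * pospow m.+1 (u y) * 'D_v u y).
Proof.
move=> du; apply: is_derive_lineV.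
apply: (@is_derive1_comp R (pospow m.+2) (fun s : R => u (y + s *: v)) 0).
  by rewrite scale0r addr0; exact: is_derive_pospow.
by have := @is_derive_line R d u y v 0; rewrite scale0r addr0; exact.
Qed.

End pospow_chain.

Lemma compact_bounded_on (R : realType) (T : topologicalType) (S : set T)
    (F : T -> R^o) : compact S ->
  (forall y, S y -> {for y, continuous F}) ->
  exists C : R, forall y, S y -> `|F y| <= C.
Proof.
move=> /compact_near_coveringP cS cF.
have [|C [_ hC]] := cS R +oo%R (fun C y => `|F y| <= C) _; last first.
  by exists (C + 1) => y Sy; apply: hC => //; rewrite ltrDl ltr01.
move=> y Sy; have /cvgrPdist_lt /(_ 1 ltr01) nF := cF _ Sy.
near=> z C => /=.
have : `|F y - F z| < 1 by near: z.
have : `|F y| + 1 <= C by near: C; exact: nbhs_pinfty_ge.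
have := ler_normB (F y) (F y - F z); rewrite opprB addrC subrK.
move: (`|F y|) (`|F z|) (`|F y - F z|) => a b c; lra.
Unshelve. all: by end_near. Qed.

(** * Families of functions with uniform C^k bounds *)

Section bounded_Ck.
Variables (R : realType) (d : nat) (T : Type).
Variables (U S : set 'rV[R]_d).
Hypotheses (oU : open U) (SU : S `<=` U).
Implicit Types u v : T -> 'rV[R]_d -> R^o.

(* The bounds on the partial derivatives are uniform in the parameter of the family. *)
Fixpoint bounded_Ck (k : nat) u : Prop :=
  [/\ forall t y, U y -> {for y, continuous (u t)},
      exists C : R, forall t y, S y -> `|u t y| <= C
    & if k is k'.+1 then
        (forall t i y, U y -> derivable (u t) y (delta_mx 0 i)) /\
        (forall i, bounded_Ck k' (fun t => 'D_(delta_mx 0 i) (u t)))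
      else True].

Lemma bounded_Ck_cont k u : bounded_Ck k u ->
  forall t y, U y -> {for y, continuous (u t)}.
Proof. by case: k => [|k] []. Qed.

Lemma bounded_Ck_bnd k u : bounded_Ck k u ->
  exists C : R, forall t y, S y -> `|u t y| <= C.
Proof. by case: k => [|k] []. Qed.

Lemma bounded_CkW k u : bounded_Ck k.+1 u -> bounded_Ck k u.
Proof.
elim: k u => [|k IH] u [? ? [? D]]; first by [].
by split=> //; split=> // i; exact: IH.
Qed.

Lemma bounded_Ck_on k u t : bounded_Ck k u -> Ck_on k U (u t).
Proof.
elim: k u => [|k IH] u [c b D]; first by apply/Ck_on0 => y; exact: c.
apply/Ck_onS; split; [exact: c|exact: D.1|].
by move=> i; exact: (IH _ (D.2 i)).
Qed.

Lemma bounded_Ck_partial k u s : bounded_Ck k u -> (size s <= k)%N ->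
  exists C : R, forall t y, S y -> `|iter_partial s (u t) y| <= C.
Proof.
elim: k u s => [|k IH] u s uk.
  by rewrite leqn0 => /nilP ->; exact: bounded_Ck_bnd uk.
case/lastP: s => [|s i]; first by move=> _; exact: bounded_Ck_bnd uk.
rewrite size_rcons ltnS => sk; have [_ _ [_ /(_ i)/IH/(_ sk)[C hC]]] := uk.
by exists C => t y Sy; rewrite iter_partial_rcons; exact: hC.
Qed.

Lemma bounded_Ck_ext k u v : (forall t y, U y -> u t y = v t y) ->
  bounded_Ck k u -> bounded_Ck k v.
Proof.
elim: k u v => [|k IH] u v uv [c [C b] D]; split=> //.
- by move=> t y Uy; apply: (continuous_ext_on oU Uy (uv t)); exact: c.
- by exists C => t y Sy; rewrite -uv; [exact: b|exact: SU].
- by move=> t y Uy; apply: (continuous_ext_on oU Uy (uv t)); exact: c.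
- by exists C => t y Sy; rewrite -uv; [exact: b|exact: SU].
split=> [t i y Uy|i].
  by apply: (derivable_ext_on oU Uy (uv t)); exact: D.1.
apply: IH (D.2 i) => t y Uy.
exact: derive_ext_on oU Uy (uv t).
Qed.

Lemma bounded_Ck_cst k (c : T -> R) (C : R) : (forall t, `|c t| <= C) ->
  bounded_Ck k (fun t _ => c t).
Proof.
move=> cC; elim: k c C cC => [|k IH] c C cC; split=> //.
- by move=> t y _; exact: (@cst_continuous _ _ (c t : R^o) y).
- by exists C => t y _; exact: cC.
- by move=> t y _; exact: (@cst_continuous _ _ (c t : R^o) y).
- by exists C => t y _; exact: cC.
split=> [t i y Uy|i]; first exact: derivable_cst.
apply: (@bounded_Ck_ext k (fun t _ => 0)) => [t y _|].
  by rewrite derive_cst.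
by apply: (IH _ 0) => t; rewrite normr0.
Qed.

Lemma bounded_CkD k u v : bounded_Ck k u -> bounded_Ck k v ->
  bounded_Ck k (fun t y => u t y + v t y).
Proof.
elim: k u v => [|k IH] u v uk vk; have uc := bounded_Ck_cont uk;
  have vc := bounded_Ck_cont vk; have [C ub] := bounded_Ck_bnd uk;
  have [C' vb] := bounded_Ck_bnd vk.
  split=> // [t y Uy|]; first exact: (continuousD (uc t y Uy) (vc t y Uy)).
  exists (C + C') => t y Sy; apply: le_trans (ler_normD _ _) _.
  by apply: lerD; [exact: ub|exact: vb].
split=> [t y Uy||]; first exact: (continuousD (uc t y Uy) (vc t y Uy)).
  exists (C + C') => t y Sy; apply: le_trans (ler_normD _ _) _.
  by apply: lerD; [exact: ub|exact: vb].
have [_ _ [ud uD]] := uk; have [_ _ [vd vD]] := vk.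
split=> [t i y Uy|i]; first by apply: derivableD; [exact: ud|exact: vd].
apply: bounded_Ck_ext (IH _ _ (uD i) (vD i)) => t y Uy.
by rewrite deriveD; [|exact: ud|exact: vd].
Qed.

Lemma bounded_CkM k u v : bounded_Ck k u -> bounded_Ck k v ->
  bounded_Ck k (fun t y => u t y * v t y).
Proof.
elim: k u v => [|k IH] u v uk vk; have uc := bounded_Ck_cont uk;
  have vc := bounded_Ck_cont vk; have [C ub] := bounded_Ck_bnd uk;
  have [C' vb] := bounded_Ck_bnd vk.
  split=> // [t y Uy|]; first exact: (continuousM (uc t y Uy) (vc t y Uy)).
  by exists (C * C') => t y Sy; rewrite normrM ler_pM ?ub ?vb.
split=> [t y Uy||]; first exact: (continuousM (uc t y Uy) (vc t y Uy)).
  by exists (C * C') => t y Sy; rewrite normrM ler_pM ?ub ?vb.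
have [_ _ [ud uD]] := uk; have [_ _ [vd vD]] := vk.
split=> [t i y Uy|i].
  by apply: (@derivableM _ _ (u t) (v t)); [exact: ud|exact: vd].
apply: bounded_Ck_ext (bounded_CkD (IH _ _ (bounded_CkW uk) (vD i))
  (IH _ _ (bounded_CkW vk) (uD i))) => t y Uy.
by rewrite (@deriveM _ _ (u t) (v t)) //; [exact: ud|exact: vd].
Qed.

Lemma bounded_Ck_sum k n (u : 'I_n -> T -> 'rV[R]_d -> R^o) :
  (forall j, bounded_Ck k (u j)) ->
  bounded_Ck k (fun t y => \sum_(j < n) u j t y).
Proof.
elim: n u => [|n IH] u uk.
  apply: (@bounded_Ck_ext k (fun t _ => 0)) => [t y _|].
    by rewrite big_ord0.
  by apply: (@bounded_Ck_cst k _ 0) => t; rewrite normr0.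
apply: (@bounded_Ck_ext k (fun t y => \sum_(j < n) u (widen_ord (leqnSn n) j) t y
    + u ord_max t y)) => [t y _|]; first by rewrite big_ord_recr.
by apply: bounded_CkD => //; exact: IH.
Qed.

Lemma Ck_bounded_Ck k (F : 'rV[R]_d -> R^o) : compact S -> Ck_on k U F ->
  bounded_Ck k (fun _ => F).
Proof.
move=> cS; elim: k F => [|k IH] F; last first.
  move=> /Ck_onS[c D H]; split=> [t||]; first exact: c.
    have [C hC] := compact_bounded_on cS (fun y Sy => c y (SU Sy)).
    by exists C.
  split; first by move=> t; exact: D.
  by move=> i; exact: IH.
move=> /Ck_on0 c; split=> //.
have [C hC] := compact_bounded_on cS (fun y Sy => c y (SU Sy)).
by exists C.
Qed.

(** Each derivative lowers the exponent by one, and an exponent of at least 1 must remain for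
    continuity; hence [k <= m]. *)
Lemma bounded_Ck_pospow k m u : (k <= m)%N -> bounded_Ck k u ->
  bounded_Ck k (fun t y => pospow m.+1 (u t y)).
Proof.
elim: k m u => [|k IH] m u km uk; have uc := bounded_Ck_cont uk;
  have [C ub] := bounded_Ck_bnd uk.
- split=> // [t y Uy|].
    exact: (continuous_comp (uc t y Uy) (@continuous_pospow R m _)).
  exists (C ^+ m.+1) => t y Sy.
  rewrite ger0_norm ?pospow_ge0 //.
  apply: le_trans (pospow_le _ (ler_norm _)) _; rewrite pospowE //.
  by apply: lerXn2r; rewrite ?nnegrE ?ub //; apply: le_trans (ub t y Sy).
split=> [t y Uy||].
- exact: (continuous_comp (uc t y Uy) (@continuous_pospow R m _)).
- exists (C ^+ m.+1) => t y Sy.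
  rewrite ger0_norm ?pospow_ge0 //.
  apply: le_trans (pospow_le _ (ler_norm _)) _; rewrite pospowE //.
  by apply: lerXn2r; rewrite ?nnegrE ?ub //; apply: le_trans (ub t y Sy).
have [_ _ [ud uD]] := uk.
case: m km => // m; rewrite ltnS => km.
split=> [t i y Uy|i].
  by have [] := is_derive_pospow_comp m (ud t i y Uy).
have H : bounded_Ck k (fun t y => m.+2%:R * pospow m.+1 (u t y) * 'D_(delta_mx 0 i) (u t) y).
  apply: bounded_CkM (uD i); apply: bounded_CkM.
    by apply: (@bounded_Ck_cst k _ m.+2%:R) => t; rewrite ger0_norm.
  by apply: IH => //; exact: bounded_CkW.
apply: bounded_Ck_ext H => t y Uy.
by have [_ ->] := is_derive_pospow_comp m (ud t i y Uy).
Qed.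

End bounded_Ck.

(** * Means of bounded Borel functions *)

Section bounded_measurable.
Variables (dd : measure_display) (T : measurableType dd) (R : realType).
Implicit Types h k : T -> R.

(** One class that is closed under the algebraic operations and under composition with measurable
    maps, and lies in L^1 of every probability: integrability conditions reduce to it. *)
Definition bmeas h : Prop :=
  measurable_fun setT h /\ exists C : R, forall x, `|h x| <= C.

Lemma bmeas_cst (c : R) : bmeas (fun=> c).
Proof. by split; [exact: measurable_cst|exists `|c|]. Qed.

Lemma bmeasD h k : bmeas h -> bmeas k -> bmeas (fun x => h x + k x).
Proof.
move=> [mh [C hC]] [mk [D kD]]; split; first exact: measurable_funD.
by exists (C + D) => x; apply: le_trans (ler_normD _ _) _; exact: lerD.
Qed.

Lemma bmeasM h k : bmeas h -> bmeas k -> bmeas (fun x => h x * k x).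
Proof.
move=> [mh [C hC]] [mk [D kD]]; split; first exact: measurable_funM.
by exists (C * D) => x; rewrite normrM ler_pM.
Qed.

Lemma bmeasN h : bmeas h -> bmeas (fun x => - h x).
Proof.
move=> [mh [C hC]]; split; first exact: (measurableT_comp (@oppr_measurable _ setT)).
by exists C => x; rewrite normrN.
Qed.

Lemma bmeasB h k : bmeas h -> bmeas k -> bmeas (fun x => h x - k x).
Proof. by move=> mh mk; apply: bmeasD mh (bmeasN mk). Qed.

Lemma bmeas_abs h : bmeas h -> bmeas (fun x => `|h x|).
Proof.
move=> [mh [C hC]]; split; first exact: measurableT_comp.
by exists C => x; rewrite normr_id.
Qed.

Lemma bmeas_max0 h : bmeas h -> bmeas (fun x => Num.max 0 (h x)).
Proof.
move=> [mh [C hC]]; split; first exact: measurable_maxr.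
by exists C => x; rewrite /Num.max; case: ifP => // _; rewrite normr0 (le_trans _ (hC x)).
Qed.

Lemma bmeas_indic (A : set T) : measurable A -> bmeas (\1_A).
Proof.
move=> mA; split; first exact: measurable_indic.
by exists 1 => x; rewrite indicE; case: (_ \in _); rewrite ?normr1 ?normr0.
Qed.

Lemma bmeas_sum (I : Type) (r : seq I) (h : I -> T -> R) :
  (forall i, bmeas (h i)) -> bmeas (fun x => \sum_(i <- r) h i x).
Proof.
move=> mh; elim: r => [|i r IH].
  by under eq_fun do rewrite big_nil; exact: bmeas_cst.
by under eq_fun do rewrite big_cons; exact: bmeasD.
Qed.

Lemma bmeas_comp (f : T -> T) h : measurable_fun setT f -> bmeas h ->
  bmeas (fun x => h (f x)).
Proof.
by move=> mf [mh [C hC]]; split; [exact: measurableT_comp|exists C].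
Qed.

Lemma measurable_fun_iter (f : T -> T) n : measurable_fun setT f ->
  measurable_fun setT (iter n f).
Proof.
move=> mf; elim: n => [|n IH]; first exact: measurable_id.
exact: measurableT_comp mf IH.
Qed.

Lemma measurable_gt h (c : R) : measurable_fun setT h ->
  measurable [set x | c < h x].
Proof.
move=> mh; have := mh measurableT _ (@measurable_itv R `]c, +oo[).
rewrite setTI; congr measurable; apply/seteqP.
by split=> x /=; rewrite in_itv /= andbT.
Qed.

End bounded_measurable.

Section expectation.
Variables (dd : measure_display) (T : measurableType dd) (R : realType).
Variable mu : probability T R.
Implicit Types h k : T -> R.

Let E h := Rintegral mu setT h.

Lemma bmeas_integrable h : bmeas h -> mu.-integrable setT (EFin \o h).
Proof.
move=> [mh [C hC]]; apply: measurable_bounded_integrable => //.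
  by apply: le_lt_trans (probability_le1 mu measurableT) (ltry 1).
exists C; split; first by rewrite num_real.
by move=> M CM x _ /=; apply: le_trans (hC x) (ltW CM).
Qed.

Lemma mean_cst (c : R) : E (fun=> c) = c.
Proof.
have e : fine (mu setT) = 1 by rewrite probability_setT.
by rewrite /E Rintegral_cst // [X in _ * X]e mulr1.
Qed.

Lemma meanD h k : bmeas h -> bmeas k -> E (fun x => h x + k x) = E h + E k.
Proof. by move=> bh bk; rewrite /E RintegralD//; exact: bmeas_integrable. Qed.

Lemma meanB h k : bmeas h -> bmeas k -> E (fun x => h x - k x) = E h - E k.
Proof. by move=> bh bk; rewrite /E RintegralB//; exact: bmeas_integrable. Qed.

Lemma meanZ (c : R) h : bmeas h -> E (fun x => c * h x) = c * E h.
Proof. by move=> bh; rewrite /E RintegralZl//; exact: bmeas_integrable. Qed.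

Lemma le_mean h k : bmeas h -> bmeas k -> (forall x, h x <= k x) -> E h <= E k.
Proof.
by move=> bh bk hk; apply: le_Rintegral => //; exact: bmeas_integrable.
Qed.

Lemma mean_ge0 h : (forall x, 0 <= h x) -> 0 <= E h.
Proof. by move=> h0; apply: Rintegral_ge0. Qed.

Lemma le_abs_mean h : bmeas h -> `|E h| <= E (fun x => `|h x|).
Proof.
by move=> bh; apply: le_normr_Rintegral => //; exact: bmeas_integrable.
Qed.

Lemma mean_indic (A : set T) : measurable A -> E (\1_A) = fine (mu A).
Proof. by move=> mA; rewrite /E /Rintegral integral_indic// setIT. Qed.

Lemma mean_sum (I : Type) (r : seq I) (h : I -> T -> R) :
  (forall i, bmeas (h i)) ->
  E (fun x => \sum_(i <- r) h i x) = \sum_(i <- r) E (h i).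
Proof.
move=> mh; elim: r => [|i r IH].
  by under [in LHS]eq_fun do rewrite big_nil; rewrite mean_cst big_nil.
under [in LHS]eq_fun do rewrite big_cons.
by rewrite meanD ?IH ?big_cons//; exact: bmeas_sum.
Qed.

Lemma mean_comp (f : T -> T) h : measurable_fun setT f ->
  (forall B, measurable B -> mu (f @^-1` B) = mu B) -> bmeas h ->
  E (fun x => h (f x)) = E h.
Proof.
move=> mf inv bh; rewrite /E /Rintegral; congr fine.
have := @integral_pushforward _ _ T T R f mf mu setT (EFin \o h).
rewrite preimage_setT => <- //=.
- by apply: eq_measure_integral => A mA _; exact: inv.
- by apply/measurable_EFinP; exact: bh.1.
- exact: (bmeas_integrable (bmeas_comp mf bh)).
Qed.

Lemma mean_gt0 h : bmeas h -> (forall x, 0 <= h x) ->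
  (0 < mu [set x | (0 < h x)%R])%E -> 0 < E h.
Proof.
move=> bh h0; rewrite !ltNge; apply: contra => Eh.
have Eh0 : E h = 0 by apply/eqP; rewrite eq_le Eh mean_ge0.
have ih := bmeas_integrable bh.
have I0 : (\int[mu]_x `|(EFin \o h) x| = 0)%E.
  rewrite (eq_integral (EFin \o h)); last first.
    by move=> x _; rewrite /= ger0_norm.
  by rewrite -[LHS]fineK ?[fine _]Eh0 //; exact: integrable_fin_num.
have mh : measurable_fun setT (EFin \o h) by apply/measurable_EFinP; exact: bh.1.
have /(ae_eq_integral_abs mu measurableT mh)[N [mN N0 sN]] := I0.
rewrite -N0; apply: le_measure; rewrite ?inE //.
  by apply: measurable_gt; exact: bh.1.
move=> x /= hx; apply: sN => /= H; have := H I => -[] e.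
by move: hx; rewrite e ltxx.
Qed.

Lemma mean_cvg0 (h : nat -> T -> R) (C : R) :
  (forall n, bmeas (h n)) -> (forall n x, `|h n x| <= C) ->
  {ae mu, forall x, (h ^~ x) @ \oo --> (0 : R)} ->
  (fun n => E (h n)) @ \oo --> (0 : R).
Proof.
move=> bh hC hcv.
have [|||||_ _ H] := @dominated_convergence _ T R mu setT measurableT
  (fun n => EFin \o h n) (cst 0%E) (cst C%:E).
- by move=> n; apply/measurable_EFinP; exact: (bh n).1.
- exact: measurable_cst.
- apply: filterS hcv => x hx _.
  by apply: cvg_EFin; [exact: nearW|exact: hx].
- exact: (bmeas_integrable (bmeas_cst _ C)).
- by apply: nearW => x n _; rewrite /= lee_fin.
rewrite integral0 in H.
exact: (fine_cvg H).
Qed.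

End expectation.

(** * Maximal ergodic inequality and the zero-one law *)

Section maxsum.
Variables (T : Type) (R : realType) (f : T -> T).
Implicit Types h : T -> R.

(* The maximum over [k <= n] of the Birkhoff sums [h + h \o f + ...] of length k. *)
Fixpoint maxsum h (n : nat) (x : T) : R :=
  if n is m.+1 then Num.max 0 (h x + maxsum h m (f x)) else 0.

Lemma maxsum_ge0 h n x : 0 <= maxsum h n x.
Proof. by case: n => [|n] //=; rewrite le_max lexx. Qed.

Lemma maxsumS_ge h n x : h x + maxsum h n (f x) <= maxsum h n.+1 x.
Proof. by rewrite /= le_max lexx orbT. Qed.

Lemma maxsum_nondecreasing h n x : maxsum h n x <= maxsum h n.+1 x.
Proof.
elim: n x => [|n IH] x; first exact: maxsum_ge0.
rewrite [leLHS]/= ge_max maxsum_ge0 /=.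
by apply: (le_trans _ (maxsumS_ge h n.+1 x)); rewrite lerD2l.
Qed.

End maxsum.

Section maximal_ergodic.
Variables (dd : measure_display) (T : measurableType dd) (R : realType).
Variables (mu : probability T R) (f : T -> T).
Hypothesis mf : measurable_fun setT f.
Hypothesis inv : forall B, measurable B -> mu (f @^-1` B) = mu B.
Implicit Types h k : T -> R.

Local Notation E h := (Rintegral mu setT h).

Lemma bmeas_maxsum h n : bmeas h -> bmeas (maxsum f h n).
Proof.
move=> bh; elim: n => [|n IH] /=; first exact: bmeas_cst.
by apply: bmeas_max0; apply: bmeasD => //; exact: bmeas_comp.
Qed.

(** Garsia's argument. Where [maxsum] is positive it equals [h] plus an earlier [maxsum] at [f x],
    so it is at most [h x + maxsum f h n (f x)]. Elsewhere it is 0, hence at most its value at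
    [f x]. Thus [h] times the indicator dominates a difference that has mean 0 by invariance. *)
Lemma maximal_ergodic h n : bmeas h ->
  0 <= E (fun x => h x * \1_[set x | 0 < maxsum f h n x] x).
Proof.
move=> bh; have bm := bmeas_maxsum n bh.
have bmf := bmeas_comp mf bm.
have mP : measurable [set x | 0 < maxsum f h n x] by apply: measurable_gt; exact: bm.1.
apply: (@le_trans _ _ (E (fun x => maxsum f h n x - maxsum f h n (f x)))).
  by rewrite meanB // (mean_comp mf inv bm) subrr.
apply: le_mean; first exact: bmeasB.
  exact: (bmeasM bh (bmeas_indic R mP)).
move=> x; rewrite indicE; have [/set_mem /= m0|] := boolP (x \in _).
  rewrite mulr1 lerBlDr; case: n m0 {bm bmf mP} => [|n] m0; first by rewrite ltxx in m0.
  have -> : maxsum f h n.+1 x = h x + maxsum f h n (f x).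
    by move: m0; rewrite /= {1 2}/Num.max; case: ifP => // _; rewrite ltxx.
  by rewrite lerD2l maxsum_nondecreasing.
rewrite notin_setE /= => /negP; rewrite -leNgt => m0.
rewrite mulr0 subr_le0; apply: le_trans m0 _; exact: maxsum_ge0.
Qed.

(** Let P be the set where [maxsum] is positive. Since [h >= - theta] off P and the mean of [h] over
    P is nonnegative, E h is at least - theta mu(~P); comparison with - theta / 2 gives the
    bound. *)
Lemma maxsum_null_set h n (theta : R) : bmeas h -> 0 < theta ->
  (forall x, - theta <= h x) -> E h <= - (theta / 2) ->
  1 / 2 <= E (\1_(~` [set x | 0 < maxsum f h n x])).
Proof.
move=> bh th0 hth Eh; have bm := bmeas_maxsum n bh.
have mP : measurable [set x | 0 < maxsum f h n x] by apply: measurable_gt; exact: bm.1.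
set P := [set x | _] in mP *.
have bP := bmeas_indic R mP; have bQ := bmeas_indic R (measurableC mP).
have := maximal_ergodic n bh; rewrite -/P => H.
have H2 : E (fun x => h x * \1_P x) - theta * E (\1_(~` P)) <= E h.
  rewrite -meanZ // -meanB //; [|exact: bmeasM|by apply: bmeasM => //; exact: bmeas_cst].
  apply: le_mean => //.
    by apply: bmeasB; apply: bmeasM => //; exact: bmeas_cst.
  move=> x; rewrite !indicE in_setC; case: (x \in P) => /=.
    by rewrite mulr1 mulr0 subr0.
  by rewrite mulr0 mulr1 sub0r.
have : theta * (1 / 2) <= theta * E (\1_(~` P)) by lra.
by rewrite ler_pM2l.
Qed.

Lemma invariant_iter n B : measurable B -> mu (iter n f @^-1` B) = mu B.
Proof.
elim: n B => [|n IH] B mB; first by [].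
have -> : iter n.+1 f @^-1` B = iter n f @^-1` (f @^-1` B) by [].
rewrite IH ?inv // -[X in measurable X]setTI; exact: mf.
Qed.

(** By forward invariance the indicator of [B] times its composition with f^n is the indicator
    again, so its correlations all equal mu(B). Those of an L^1-close [phi] tend to nearly
    mu(B)^2. *)
Lemma forward_invariant_01 (B : set T) : measurable B -> B `<=` f @^-1` B ->
  (forall e : R, 0 < e -> exists phi : T -> R,
    [/\ bmeas phi, forall x, 0 <= phi x <= 1,
        E (fun x => `|phi x - \1_B x|) <= e
      & (fun n => E (fun x => phi x * phi (iter n f x))) @ \oo --> E phi ^+ 2]) ->
  fine (mu B) = fine (mu B) ^+ 2.
Proof.
move=> mB BfB app; apply/eqP; rewrite -subr_eq0 -normr_le0.
apply/ler_addgt0Pl => e e0; rewrite addr0.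
(* Five errors: two from replacing both indicators in the correlation, one from its convergence, and
   two from comparing the squares of E phi and mu(B), which lie in [0, 1]. *)
have e5 : 0 < e / 5 by rewrite divr_gt0.
have [phi [bphi phi01 app_phi cv]] := app _ e5.
have bB := bmeas_indic R mB.
have /cvgrPdist_le /(_ _ e5) [N _ /(_ N (leqnn N))] := cv.
have mfN := measurable_fun_iter N mf.
have bphiN := bmeas_comp mfN bphi; have bBN := bmeas_comp mfN bB.
have bd : bmeas (fun x => `|phi x - \1_B x|) by apply/bmeas_abs/bmeasB.
set A := E (fun x => phi x * _) => cN.
have EB : E (\1_B) = fine (mu B) by apply: mean_indic.
have h1 : `|A - E (\1_B)| <= 2 * (e / 5).
  rewrite -meanB //; last exact: bmeasM.
  apply: le_trans (le_abs_mean _ _) _; first by apply: bmeasB => //; exact: bmeasM.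
  apply: (@le_trans _ _ (E (fun x => `|phi x - \1_B x| + `|phi (iter N f x) - \1_B (iter N f x)|))).
    apply: le_mean; [by apply/bmeas_abs/bmeasB => //; exact: bmeasM| |].
      by apply: bmeasD => //; exact/bmeas_abs/bmeasB.
    move=> x; have BN : x \in B -> iter N f x \in B.
      elim: N x {mfN bphiN bBN A cN} => [|N IH] x //= xB.
      by apply/mem_set/BfB/set_mem/IH.
    have -> : phi x * phi (iter N f x) - \1_B x =
      phi (iter N f x) * (phi x - \1_B x) + \1_B x * (phi (iter N f x) - \1_B (iter N f x)).
      rewrite !indicE; have [xB|_] := boolP (x \in B).
        by rewrite BN //=; ring.
      by rewrite /=; ring.
    apply: le_trans (ler_normD _ _) _; rewrite !normrM; apply: lerD.
      apply: ler_piMl => //; have /andP[p0 p1] := phi01 (iter N f x).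
      by rewrite ger0_norm.
    by apply: ler_piMl => //; rewrite indicE; case: (_ \in _); rewrite ?normr1 ?normr0.
  rewrite meanD //; last exact/bmeas_abs/bmeasB.
  rewrite (mean_comp mfN (@invariant_iter N) bd).
  by rewrite mulr2n mulrDl mul1r lerD.
have h2 : `|E phi - E (\1_B)| <= e / 5.
  rewrite -meanB //; apply: le_trans (le_abs_mean _ _) _ => //; exact: bmeasB.
have p0 : 0 <= E phi by apply: mean_ge0 => x; have /andP[] := phi01 x.
have p1 : E phi <= 1.
  apply: (@le_trans _ _ (E (fun=> 1))); last by rewrite mean_cst.
  apply: le_mean => [||x]; [exact: bphi|exact: bmeas_cst|].
  by have /andP[] := phi01 x.
have b0 : 0 <= E (\1_B) by apply: mean_ge0 => x; rewrite indicE.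
have b1 : E (\1_B) <= 1.
  apply: (@le_trans _ _ (E (fun=> 1))); last by rewrite mean_cst.
  apply: le_mean => [||x]; [exact: bB|exact: bmeas_cst|].
  by rewrite indicE; case: (x \in B).
rewrite -EB; move: cN h1 h2 p0 p1 b0 b1.
move: A (E phi) (E (\1_B)) => A p b; rewrite !ler_norml.
move=> /andP[? ?] /andP[? ?] /andP[? ?] *; apply/andP; split; nra.
Qed.

End maximal_ergodic.

(** * Sets approximable in L^1 by test functions *)

Section approximable.
Variables (dd : measure_display) (T : measurableType dd) (R : realType).
Variables (mu : probability T R) (P : (T -> R) -> Prop).
Hypothesis P_bmeas : forall phi, P phi -> bmeas phi.
Hypothesis P01 : forall phi, P phi -> forall x, 0 <= phi x <= 1.
Hypothesis P1 : P (fun=> 1).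
Hypothesis PC : forall phi, P phi -> P (fun x => 1 - phi x).
Hypothesis PM : forall phi psi, P phi -> P psi -> P (fun x => phi x * psi x).

Local Notation E h := (Rintegral mu setT h).

Definition approximable (B : set T) : Prop := measurable B /\
  forall e : R, 0 < e -> exists2 phi, P phi & E (fun x => `|phi x - \1_B x|) <= e.

Lemma approximable_setC B : approximable B -> approximable (~` B).
Proof.
move=> [mB aB]; split=> [|e e0]; first exact: measurableC.
have [phi Pphi le] := aB e e0; exists (fun x => 1 - phi x); first exact: PC.
apply: le_trans le; rewrite le_eqVlt; apply/orP; left; apply/eqP.
congr Rintegral; apply/funext => x; rewrite !indicE in_setC -normrN.
by case: (x \in B) => /=; congr (`|_|); ring.
Qed.

Lemma approximable_setI A B : approximable A -> approximable B ->
  approximable (A `&` B).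
Proof.
move=> [mA aA] [mB aB]; split=> [|e e0]; first exact: measurableI.
have e20 : 0 < e / 2 by rewrite divr_gt0.
have [phi Pphi le1] := aA _ e20; have [psi Ppsi le2] := aB _ e20.
exists (fun x => phi x * psi x); first exact: PM.
have bA := bmeas_indic R mA; have bB := bmeas_indic R mB.
have bAB := bmeas_indic R (measurableI _ _ mA mB).
have b1 : bmeas (fun x => `|phi x - \1_A x|) by apply/bmeas_abs/bmeasB => //; exact: P_bmeas.
have b2 : bmeas (fun x => `|psi x - \1_B x|) by apply/bmeas_abs/bmeasB => //; exact: P_bmeas.
apply: (@le_trans _ _ (E (fun x => `|phi x - \1_A x| + `|psi x - \1_B x|))).
  apply: le_mean; [|exact: bmeasD|].
    by apply/bmeas_abs/bmeasB => //; apply/P_bmeas/PM.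
  move=> x; have -> : phi x * psi x - \1_(A `&` B) x =
     psi x * (phi x - \1_A x) + \1_A x * (psi x - \1_B x).
    by rewrite !indicE in_setI; case: (x \in A); case: (x \in B) => /=; ring.
  apply: le_trans (ler_normD _ _) _; rewrite !normrM; apply: lerD.
    apply: ler_piMl => //; have /andP[p0 p1] := P01 Ppsi x.
    by rewrite ger0_norm.
  by apply: ler_piMl => //; rewrite indicE; case: (_ \in _); rewrite ?normr1 ?normr0.
by rewrite meanD //; apply: le_trans (lerD le1 le2) _; lra.
Qed.

(** Finite unions are obtained from complements and intersections. The indicators of the partial
    unions converge to that of a countable union in L^1, by dominated convergence. *)
Lemma approximable_sigma_algebra : sigma_algebra setT approximable.
Proof.
have aT : approximable setT.
  split=> // e e0; exists (fun=> 1) => //.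
  under eq_fun do rewrite indicT subrr normr0.
  by rewrite mean_cst ltW.
have a0 : approximable set0 by rewrite -setCT; exact: approximable_setC.
split=> [//|A aA|A aA]; first by rewrite setTD; exact: approximable_setC.
have aU n : approximable (\bigcup_(k in `I_n) A k).
  elim: n => [|n IH]; first by rewrite II0 bigcup_set0.
  rewrite IIS bigcup_setU bigcup_set1 -[X in approximable X]setCK setCU.
  apply: approximable_setC; apply: approximable_setI; apply: approximable_setC => //.
have mU : measurable (\bigcup_k A k) by apply: bigcup_measurable => k _; exact: (aA k).1.
split=> // e e0; have e20 : 0 < e / 2 by rewrite divr_gt0.
pose h n x : R := `|\1_(\bigcup_(k in `I_n) A k) x - \1_(\bigcup_k A k) x|.
have bh n : bmeas (h n).
  by apply/bmeas_abs/bmeasB; apply: bmeas_indic => //; exact: (aU n).1.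
have : (fun n => E (h n)) @ \oo --> (0 : R).
  apply: (@mean_cvg0 _ _ _ mu h 1) => //.
    move=> n x; rewrite /h normr_id !indicE.
    by do 2 case: (_ \in _); rewrite ?subrr ?subr0 ?sub0r ?normrN ?normr1 ?normr0.
  apply: aeW => x.
  have [[k _ Akx]|nA] := pselect ((\bigcup_k A k) x).
    apply/cvgrPdist_le => e' e'0; near=> n.
    rewrite /h !indicE !mem_set; [by rewrite subrr normr0 subrr normr0 ltW| |].
    - by exists k.
    - by exists k => //=; near: n; exact: nbhs_infty_gt.
  apply/cvgrPdist_le => e' e'0; near=> n.
  rewrite /h !indicE !memNset //; first by rewrite subrr normr0 subrr normr0 ltW.
  by move=> [k _ Akx]; apply: nA; exists k.
move=> /cvgrPdist_le /(_ _ e20)[N _ /(_ N (leqnn N))].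
rewrite sub0r normrN ger0_norm; last by apply: mean_ge0 => x; rewrite normr_ge0.
move=> hN; have [phi Pphi le] := (aU N).2 _ e20.
exists phi => //; have bphi := P_bmeas Pphi.
have bd : bmeas (fun x => `|phi x - \1_(\bigcup_(k in `I_N) A k) x|).
  by apply/bmeas_abs/bmeasB => //; apply: bmeas_indic; exact: (aU N).1.
apply: (@le_trans _ _ (E (fun x => `|phi x - \1_(\bigcup_(k in `I_N) A k) x| + h N x))).
  apply: le_mean; [|exact: bmeasD|].
    by apply/bmeas_abs/bmeasB => //; exact: bmeas_indic.
  by move=> x; rewrite /h -[X in `|X| <= _](subrKA (\1_(\bigcup_(k in `I_N) A k) x)) ler_normD.
by rewrite meanD //; apply: le_trans (lerD le hN) _; lra.
Unshelve. all: by end_near. Qed.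

End approximable.

(** * Charts and maps of class C^1 *)

Lemma compact_closed_box (R : realType) d (a : 'rV[R]_d) (r : R) :
  compact [set y | `|y - a| <= r].
Proof.
have [r0|r0] := leP 0 r; last first.
  rewrite (_ : [set y | _] = set0); first exact: compact0.
  by apply/seteqP; split => // y /= /(le_trans (normr_ge0 _)); rewrite leNgt r0.
have := @rV_compact R d (fun i => `[a 0 i - r, a 0 i + r]%classic)
  (fun i => @segment_compact R _ _).
congr compact; apply/seteqP; split => y /=.
  move=> H; apply/row_norm_leP => // i; have := H i; rewrite /= in_itv /= !mxE.
  by rewrite -ler_distl.
move=> /row_norm_leP H i; have := H r0 i; rewrite /= in_itv /= !mxE.
by rewrite -ler_distl.
Qed.

Section charts.
Variables (R : realType) (d : nat) (M : ptopologicalType) (A : smooth_atlas R d M).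
Implicit Types (c : chart A) (F G : M -> M).

Lemma chart_inv_dom c y : (chart_map c @` chart_dom c) y ->
  chart_dom c (chart_inv c y) /\ chart_map c (chart_inv c y) = y.
Proof. by move=> [x xc <-]; rewrite chart_mapK. Qed.

Lemma nbhs_chart_im c x : chart_dom c x ->
  nbhs (chart_map c x) (chart_map c @` chart_dom c).
Proof.
by move=> xc; apply: open_nbhs_nbhs; split; [exact: open_chart_im|exists x].
Qed.

Lemma nbhs_chart_dom c x : chart_dom c x -> nbhs x (chart_dom c).
Proof. by move=> xc; apply: open_nbhs_nbhs; split; [exact: open_chart_dom|]. Qed.

Lemma chart_inv_cont c y : (chart_map c @` chart_dom c) y ->
  {for y, continuous (chart_inv c)}.
Proof. by move=> [x xc <-]; exact: chart_inv_continuous. Qed.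

Lemma open_chart_image c (O : set M) : open O ->
  open (chart_map c @` (chart_dom c `&` O)).
Proof.
move=> oO; rewrite openE => y [x [xc Ox] <-] /=.
have im : (chart_map c @` chart_dom c) (chart_map c x) by exists x.
have n1 : nbhs (chart_map c x) (chart_map c @` chart_dom c).
  exact: nbhs_chart_im.
have n2 : nbhs (chart_map c x) (chart_inv c @^-1` O).
  apply: (chart_inv_cont im); rewrite chart_mapK //.
  exact: (open_nbhs_nbhs (conj oO Ox)).
apply: (@filterS _ _ (nbhs_filter _) _ _ _
  (@filterI _ _ (nbhs_filter _) _ _ n1 n2)) => z [zc zO].
by exists (chart_inv c z); have [? ?] := chart_inv_dom zc.
Qed.

Definition in_charts F c c' : 'rV[R]_d -> 'rV[R]_d :=
  chart_map c' \o F \o chart_inv c.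

Lemma in_chartsE F c c' x : chart_dom c x ->
  in_charts F c c' (chart_map c x) = chart_map c' (F x).
Proof. by move=> xc; rewrite /in_charts /= chart_mapK. Qed.

Definition Jchart F c c' x := Jac (in_charts F c c') (chart_map c x).

(** Strict differentiability is required in all pairs of charts, so that closure under composition
    is the chain rule and no continuity of partial derivatives has to be carried along. *)
Definition C1_map F : Prop := continuous F /\
  forall c c' x, chart_dom c x -> chart_dom c' (F x) ->
    sdiff (in_charts F c c') (chart_map c x) (Jchart F c c' x).

Lemma open_preimage F c c' : continuous F ->
  open (chart_map c @` (chart_dom c `&` F @^-1` chart_dom c')).
Proof.
move=> cF; apply: open_chart_image.
by move: cF => /continuousP; apply; exact: open_chart_dom.
Qed.

Lemma in_charts_comp F G c c' c'' x : C1_map F -> C1_map G ->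
  chart_dom c x -> chart_dom c' (F x) -> chart_dom c'' (G (F x)) ->
  sdiff (in_charts (G \o F) c c'') (chart_map c x)
    (Jchart F c c' x *m Jchart G c' c'' (F x)).
Proof.
move=> [cF sF] [cG sG] xc Fxc GFxc.
(* The intermediate chart [c'] cancels only where [F] lands in its domain, so the two expressions
   agree only near the point. *)
apply: (@sdiff_near _ _ _ (in_charts G c' c'' \o in_charts F c c')); last first.
  apply: sdiff_comp; first exact: sF.
  by rewrite in_chartsE //; exact: sG.
have o := @open_preimage F c c' cF.
have im : (chart_map c @` (chart_dom c `&` F @^-1` chart_dom c')) (chart_map c x).
  by exists x.
apply: (@filterS _ _ (nbhs_filter _) _ _ _ (open_nbhs_nbhs (conj o im))).
by move=> y [z [zc Fzc] <-]; rewrite /in_charts /= chart_mapK // chart_mapK.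
Qed.

Lemma C1_map_comp F G : C1_map F -> C1_map G -> C1_map (G \o F).
Proof.
move=> CF CG; split=> [x|c c' x xc GFxc].
  exact: (continuous_comp (CF.1 x) (CG.1 (F x))).
have s := in_charts_comp CF CG xc (chart_at_dom A (F x)) GFxc.
by rewrite /Jchart (sdiff_Jac s).
Qed.

Lemma Jchart_comp F G c c' c'' x : C1_map F -> C1_map G ->
  chart_dom c x -> chart_dom c' (F x) -> chart_dom c'' (G (F x)) ->
  Jchart (G \o F) c c'' x = Jchart F c c' x *m Jchart G c' c'' (F x).
Proof.
by move=> CF CG xc Fxc GFxc; exact: (sdiff_Jac (in_charts_comp CF CG xc Fxc GFxc)).
Qed.

Lemma C1_map_Ck1 F : continuous F -> (forall c c', Ck_on 1
  (chart_map c @` (chart_dom c `&` F @^-1` chart_dom c')) (in_charts F c c')) ->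
  C1_map F.
Proof.
move=> cF CF; split=> // c c' x xc Fxc.
apply: (Ck1_sdiff (@open_preimage F c c' cF) (CF c c')).
by exists x.
Qed.

Lemma C1_map_id : C1_map id.
Proof.
apply: C1_map_Ck1 => [x|c c']; first exact: cvg_id.
exact: chart_transition.
Qed.

Lemma C1_map_iter F n : C1_map F -> C1_map (iter n F).
Proof.
move=> CF; elim: n => [|n IH]; first exact: C1_map_id.
exact: (C1_map_comp IH CF).
Qed.

Lemma Ck_onW (W : normedModType R) k m U (h : 'rV[R]_d -> W) :
  (m <= k)%N -> Ck_on k U h -> Ck_on m U h.
Proof.
move=> mk Ch s; have [h1 h2] := Ch s; split=> sm.
  by apply: h1; exact: leq_trans mk.
by apply: h2; exact: leq_trans mk.
Qed.

Lemma C1plus_C1_map (a : R) F : 0 < a -> C1plus_map A a F -> C1_map F.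
Proof.
move=> a0 [cF CF]; apply: C1_map_Ck1 => // c c'.
have [Ck _] := CF c c'; apply: Ck_onW Ck.
rewrite absz_gt0 gt_eqF // -(ltr_int R); apply: lt_le_trans a0 _.
exact: ceil_ge.
Qed.

Hypotheses (hausM : hausdorff_space M) (compM : compact [set: M]).

(** The set is the image of a compact box under [chart_inv], and compact sets are closed in a
    Hausdorff space. *)
Lemma closed_chart_box c (a : 'rV[R]_d) (r : R) :
  [set y | `|y - a| <= r] `<=` chart_map c @` chart_dom c ->
  closed [set x | chart_dom c x /\ `|chart_map c x - a| <= r].
Proof.
move=> sub; rewrite (_ : [set x | _] = chart_inv c @` [set y | `|y - a| <= r]).
  apply: compact_closed => //; apply: continuous_compact; last exact: compact_closed_box.
  by apply: continuous_in_subspaceT => y /set_mem /sub; exact: chart_inv_cont.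
apply/seteqP; split=> [x [xc xr]|_ [y yr <-]] /=.
  by exists (chart_map c x) => //; exact: chart_mapK.
by have [? ->] := chart_inv_dom (sub _ yr).
Qed.

Lemma open_chart_box c (a : 'rV[R]_d) (r : R) :
  open [set x | chart_dom c x /\ `|chart_map c x - a| < r].
Proof.
rewrite openE => x [xc xr] /=.
have n1 := nbhs_chart_dom xc.
have r0 : 0 < r - `|chart_map c x - a| by rewrite subr_gt0.
have n2 : nbhs x (chart_map c @^-1` [set y | `|y - chart_map c x| < r - `|chart_map c x - a|]).
  apply: (chart_map_continuous xc); exact: radius_nbhs.
apply: filterS2 n1 n2 => y yc /= yr; split=> //.
rewrite -(subrKA (chart_map c x)); apply: le_lt_trans (ler_normD _ _) _.
by rewrite -ltrBrDr.
Qed.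

(* The factor 2 leaves room for bumps of radius [box_radius l] centred at any
   point of the [l]-th box. *)
Record box_cover := BoxCover {
  box_num : nat;
  box_chart : 'I_box_num -> chart A;
  box_center : 'I_box_num -> 'rV[R]_d;
  box_radius : 'I_box_num -> R;
  box_radius_gt0 : forall l, 0 < box_radius l;
  box_in_chart : forall l, [set y | `|y - box_center l| <= 2 * box_radius l]
    `<=` chart_map (box_chart l) @` chart_dom (box_chart l);
  box_coverT : forall x, exists2 l, chart_dom (box_chart l) x &
    `|chart_map (box_chart l) x - box_center l| < box_radius l
}.

Lemma ex_box_cover : inhabited box_cover.
Proof.
have ex_r (x : M) : exists r : R, 0 < r /\ [set y | `|y - chart_map (chart_at A x) x| <= 2 * r]
    `<=` chart_map (chart_at A x) @` chart_dom (chart_at A x).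
  have [r r0 hr] := nbhs_radius (nbhs_chart_im (chart_at_dom A x)).
  exists (r / 3); split; first by rewrite divr_gt0.
  by move=> y /= yr; apply: hr; apply: le_lt_trans yr _; lra.
have [r hr] := choice ex_r.
have := compM; rewrite compact_cover => /(_ M setT (fun x =>
  [set y | chart_dom (chart_at A x) y /\
    `|chart_map (chart_at A x) y - chart_map (chart_at A x) x| < r x])).
move=> [x _|x _|D' _ cov].
- exact: open_chart_box.
- exists x => //=; split; first exact: chart_at_dom.
  by rewrite subrr normr0; exact: (hr x).1.
pose s := finmap.enum_fset D'.
pose p (l : 'I_(size s)) := tnth (in_tuple s) l.
split; apply: (@BoxCover (size s) (fun l => chart_at A (p l))
  (fun l => chart_map (chart_at A (p l)) (p l)) (fun l => r (p l))).
- by move=> l; exact: (hr (p l)).1.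
- by move=> l; exact: (hr (p l)).2.
- move=> x; have [y /= yD [xc xr]] := cov x I.
  have ys : y \in s by [].
  have ltys : (index y s < size s)%N by rewrite index_mem.
  exists (Ordinal ltys); rewrite /p (tnth_nth y) /= nth_index //.
Qed.

End charts.

(** * Bump functions *)

Section Ck_more.
Variables (R : realType) (d : nat).

Lemma Ck_on_ext (W : normedModType R) k (U : set 'rV[R]_d) (F G : 'rV[R]_d -> W) :
  open U -> (forall z, U z -> F z = G z) -> Ck_on k U F -> Ck_on k U G.
Proof.
move=> oU FG FC s; have [h1 h2] := FC s.
have E z : U z -> iter_partial s F z = iter_partial s G z.
  by move=> Uz; exact: iter_partial_ext_on oU Uz FG.
split=> [sk y Uy|sk i y Uy].
  by apply: (continuous_ext_on oU Uy E); exact: h1.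
by apply: (derivable_ext_on oU Uy E); exact: h2.
Qed.

Lemma Ck_on_coord k n (U : set 'rV[R]_d) (h : 'rV[R]_d -> 'rV[R]_n) j :
  open U -> Ck_on k U h -> Ck_on k U (fun y => h y 0 j : R^o).
Proof.
move=> oU; elim: k h => [|k IH] h.
  move=> /Ck_on0 c; apply/Ck_on0 => y Uy.
  exact: (continuous_comp (c y Uy) (@coord_continuous _ _ _ 0 j _)).
move=> /Ck_onS[c D DC]; apply/Ck_onS; split=> [y Uy|i y Uy|i].
- exact: (continuous_comp (c y Uy) (@coord_continuous _ _ _ 0 j _)).
- exact: ((derivable_mxP h _ _).1 (D i y Uy) 0 j).
apply: (Ck_on_ext oU _ (IH _ (DC i))) => z Uz.
by rewrite derive_mx ?mxE //; exact: D.
Qed.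

Lemma iter_partial0 s : iter_partial s (fun _ : 'rV[R]_d => 0 : R^o) = fun=> 0.
Proof.
elim: s => [//|i s IH]; rewrite /= -/(iter_partial s _) IH.
by apply/funext => y; exact: derive_cst.
Qed.

Lemma uniform_finite (I : finType) (P : I -> R -> Prop) :
  (forall i C C', C <= C' -> P i C -> P i C') ->
  (forall i, exists C, P i C) -> exists C, forall i, P i C.
Proof.
move=> mP /choice[C hC]; exists (\sum_i `|C i|) => i.
apply: mP (hC i); rewrite (bigD1 i) //=; apply: (le_trans (ler_norm _)).
by rewrite lerDl sumr_ge0.
Qed.

Lemma uniform_bigmax (T : Type) (I : finType) (F : T -> I -> R) :
  (forall i, exists C, forall t, F t i <= C) ->
  exists C, forall t, \big[Num.max/0]_i F t i <= C.
Proof.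
move=> H; have [|C hC] := uniform_finite (P := fun i C => forall t, F t i <= C) _ H.
  by move=> i C C' CC' FC t; exact: le_trans CC'.
exists (Num.max 0 C) => t; apply/bigmax_leP; split=> [|i _].
  by rewrite le_max lexx.
by rewrite le_max hC orbT.
Qed.

End Ck_more.

Section bumps.
Variables (R : realType) (d : nat) (M : ptopologicalType) (A : smooth_atlas R d M).
Hypotheses (hausM : hausdorff_space M) (compM : compact [set: M]).
Implicit Types (c : chart A) (a : 'rV[R]_d) (r : R).

(** A truncated power of r^2 minus the squared Euclidean distance to [a]. Its height r^(2m) is
    deliberately not scaled to 1: this keeps the derivatives of order below [m] bounded as [r] tends
    to 0. *)
Definition chart_bump (m : nat) c a r (x : M) : R :=
  if `[< chart_dom c x >] then
    pospow m (r ^+ 2 - \sum_i (chart_map c x 0 i - a 0 i) ^+ 2) else 0.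

Lemma bumpE m c a r x : chart_dom c x -> chart_bump m c a r x =
  pospow m (r ^+ 2 - \sum_i (chart_map c x 0 i - a 0 i) ^+ 2).
Proof. by move=> xc; rewrite /chart_bump; case: asboolP. Qed.

Lemma bump_ge0 m c a r x : 0 <= chart_bump m c a r x.
Proof. by rewrite /chart_bump; case: ifP => // _; exact: pospow_ge0. Qed.

Lemma bump_le1 m c a r x : 0 <= r <= 1 -> chart_bump m c a r x <= 1.
Proof.
move=> /andP[r0 r1]; rewrite /chart_bump; case: ifP => // _.
apply: (@le_trans _ _ (pospow m 1)); last by rewrite pospowE // expr1n.
apply: pospow_le; apply: (@le_trans _ _ (r ^+ 2)); last by rewrite expr_le1.
by rewrite lerBlDr lerDl sumr_ge0 // => i _; rewrite sqr_ge0.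
Qed.

Lemma bump_gt0 m c a r x : 0 < r -> 0 < chart_bump m.+1 c a r x ->
  chart_dom c x /\ `|chart_map c x - a| < r.
Proof.
move=> r0; rewrite /chart_bump; case: asboolP => xc; last by rewrite ltxx.
rewrite pospow_gt0 subr_gt0 => lt; split=> //.
apply/row_norm_ltP => // i; rewrite !mxE -ltr_sqr ?nnegrE ?(ltW r0) //.
rewrite real_normK ?num_real //; apply: le_lt_trans lt.
by rewrite (bigD1 i) //= lerDl sumr_ge0 // => j _; rewrite sqr_ge0.
Qed.

(** Sup-norm distance at most [s] bounds the sum of squares by d s^2, while r^2 is at least (d+1)
    s^2; a margin of s^2 is left inside the power. *)
Lemma bump_ge m c a r s x : chart_dom c x -> `|chart_map c x - a| <= s ->
  0 <= s -> d.+1%:R * s <= r -> s ^+ (2 * m) <= chart_bump m c a r x.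
Proof.
move=> xc xs s0 sr; rewrite bumpE // exprM -pospowE ?sqr_ge0 //.
apply: pospow_le; rewrite lerBrDr.
have H : \sum_(i < d) (chart_map c x 0 i - a 0 i) ^+ 2 <= d%:R * s ^+ 2.
  rewrite -[d in leRHS]card_ord -sum1_card natr_sum mulr_suml.
  apply: ler_sum => i _; rewrite mul1r -real_normK ?num_real //.
  apply: lerXn2r; rewrite ?nnegrE //; apply: le_trans xs.
  by have := coord_le_norm (chart_map c x - a) i; rewrite !mxE.
apply: (@le_trans _ _ (d.+1%:R * s ^+ 2)).
  by rewrite -natr1 mulrDl mul1r addrC lerD2r.
apply: (@le_trans _ _ ((d.+1%:R * s) ^+ 2)); last first.
  by apply: lerXn2r => //; rewrite ?nnegrE ?mulr_ge0 //; apply: le_trans sr; rewrite mulr_ge0.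
rewrite exprMn ler_wpM2r ?sqr_ge0 // expr2 ler_peMl // ler1n //.
Qed.

Variable B : box_cover A.
Let bc := @box_chart _ _ _ _ B.
Let bo := @box_center _ _ _ _ B.
Let br := @box_radius _ _ _ _ B.

Definition box_set l : set M :=
  [set x | chart_dom (bc l) x /\ `|chart_map (bc l) x - bo l| <= 2 * br l].

Lemma closed_box_set l : closed (box_set l).
Proof. by apply: closed_chart_box => //; exact: box_in_chart. Qed.

(** The centre stays in the box and the radius is at most that of the box, so the support lies in
    the doubled box, where the chart is still defined. *)
Definition bump_param l a r : Prop := `|a - bo l| <= br l /\ 0 < r <= br l.

Lemma bump_param_box l a r x : bump_param l a r -> chart_dom (bc l) x ->
  `|chart_map (bc l) x - a| <= r -> box_set l x.
Proof.
move=> [ao /andP[_ rb]] xc xa; split=> //.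
rewrite -(subrKA a); apply: le_trans (ler_normD _ _) _.
by rewrite mulr_natl mulr2n lerD // (le_trans xa).
Qed.

Lemma closed_bump_supp l a r : bump_param l a r ->
  closed [set x | chart_dom (bc l) x /\ `|chart_map (bc l) x - a| <= r].
Proof.
move=> [ao /andP[_ rb]]; apply: closed_chart_box => // y /= ya.
apply: box_in_chart; rewrite /= -(subrKA a).
by apply: le_trans (ler_normD _ _) _; rewrite mulr_natl mulr2n lerD // (le_trans ya).
Qed.

Section bump_regularity.
Variables (k : nat) (l : 'I_(box_num B)) (c : chart A) (E : set M).
Hypotheses (cE : closed E) (Ec : E `<=` chart_dom c).

Let T := {p : 'rV[R]_d * R | bump_param l p.1 p.2}.
Let U := chart_map c @` (chart_dom c `&` chart_dom (bc l)).
Let S := chart_map c @` (E `&` box_set l).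
Let V := chart_map c @` (chart_dom c `&` ~` box_set l).
Let phi (t : T) := chart_bump k.+1 (bc l) (sval t).1 (sval t).2.
(** The bump seen from another chart [c], on the overlap [U]. It is written with sums and products
    only, to match the closure rules of [bounded_Ck]. On [V] the bump vanishes, and [U] and [V]
    together cover the image of the chart, so regularity can be checked on each. *)
Let rep (t : T) (y : 'rV[R]_d) : R^o :=
  pospow k.+1 ((sval t).2 ^+ 2 +
    \sum_i (-1) * ((in_charts id c (bc l) y 0 i - (sval t).1 0 i) *
       (in_charts id c (bc l) y 0 i - (sval t).1 0 i))).

Let oU : open U.
Proof. by apply: open_chart_image; exact: open_chart_dom. Qed.

Let oV : open V.
Proof. by apply: open_chart_image; apply: closed_openC; exact: closed_box_set. Qed.

Let SU : S `<=` U.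
Proof. by move=> _ [x [xE [xl _]] <-]; exists x => //; split=> //; exact: Ec. Qed.

Let compS : compact S.
Proof.
apply: continuous_compact.
  apply: continuous_in_subspaceT => x /set_mem [xE _].
  exact: chart_map_continuous (Ec xE).
apply: subclosed_compact compM _ => //.
by apply: closedI => //; exact: closed_box_set.
Qed.

Let rep_bounded : bounded_Ck U S k rep.
Proof.
apply: (bounded_Ck_pospow oU SU) => //.
have b0 : bounded_Ck U S k (fun (t : T) _ => (sval t).2 ^+ 2).
  apply: (bounded_Ck_cst oU SU k (C := br l ^+ 2)) => -[[a r] [/= _ /andP[r0 rb]]].
  rewrite ger0_norm ?sqr_ge0 //; apply: lerXn2r => //; rewrite nnegrE ltW //.
  exact: box_radius_gt0.
have bt i : bounded_Ck U S k (fun (_ : T) y => in_charts id c (bc l) y 0 i).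
  apply: (Ck_bounded_Ck T SU compS); apply: Ck_on_coord => //.
  exact: chart_transition.
have ba i : bounded_Ck U S k (fun (t : T) _ => - (sval t).1 0 i).
  apply: (bounded_Ck_cst oU SU k (C := br l + `|bo l|)) => -[[a r] [/= ab _]].
  rewrite normrN -[a in leLHS](subrK (bo l)) mxE; apply: le_trans (ler_normD _ _) _.
  by apply: lerD; [exact: le_trans (coord_le_norm _ _) ab|exact: coord_le_norm].
apply: (bounded_CkD oU SU b0); apply: (bounded_Ck_sum oU SU) => i.
apply: (bounded_CkM oU SU).
  by apply: (bounded_Ck_cst oU SU k (C := 1)) => t; rewrite normrN1.
by apply: (bounded_CkM oU SU); exact: (bounded_CkD oU SU (bt i) (ba i)).
Qed.

Let phi_U t y : U y -> rep t y = phi t (chart_inv c y).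
Proof.
move=> [x [xc xl] <-]; rewrite chart_mapK // /phi bumpE // /rep in_chartsE //.
congr (pospow _ (_ + _)); rewrite -sumrN; apply: eq_bigr => i _.
by rewrite mulN1r expr2.
Qed.

Let phi_V t y : V y -> 0 = phi t (chart_inv c y).
Proof.
move=> [x [xc xl] <-]; rewrite chart_mapK //; apply/esym/eqP.
rewrite eq_le bump_ge0 andbT leNgt; apply/negP.
have r0 : 0 < (sval t).2 by have /andP[] := (svalP t).2.
move=> /(bump_gt0 r0)[xl' lt]; apply: xl.
exact: bump_param_box (svalP t) xl' (ltW lt).
Qed.

Lemma bump_Ck_chart (t : T) :
  Ck_on k (chart_map c @` chart_dom c) (phi t \o chart_inv c : _ -> R^o).
Proof.
have CU : Ck_on k U (phi t \o chart_inv c : _ -> R^o).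
  apply: (Ck_on_ext oU _ (bounded_Ck_on t rep_bounded)) => z Uz.
  exact: phi_U.
have CV : Ck_on k V (phi t \o chart_inv c : _ -> R^o).
  apply: (@Ck_on_ext _ _ R^o k V (fun=> 0) _ oV).
    by move=> z Vz; exact: phi_V.
  move=> s; rewrite iter_partial0; split=> [_ y _|_ i y _].
    exact: cst_continuous.
  exact: derivable_cst.
move=> s; have [u1 u2] := CU s; have [v1 v2] := CV s.
split=> [sk y [x xc <-]|sk i y [x xc <-]].
  have [xl|xl] := pselect (box_set l x).
    by apply: u1 => //; exists x => //; split=> //; case: xl.
  by apply: v1 => //; exists x.
have [xl|xl] := pselect (box_set l x).
  by apply: u2 => //; exists x => //; split=> //; case: xl.
by apply: v2 => //; exists x.
Qed.

Lemma bump_partial_bounded (s : seq 'I_d) : (size s <= k)%N ->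
  exists C : R, forall t : T,
    sup [set `|iter_partial s (phi t \o chart_inv c : _ -> R^o) y| |
          y in chart_map c @` E] <= C.
Proof.
move=> sk; have [C hC] := bounded_Ck_partial rep_bounded sk.
(* The bound must also cover the value 0, taken by the partial derivatives on [V] and by the
   supremum of an empty set. *)
exists (Num.max 0 C) => t.
set X := [set `|_| | _ in _].
have [->|/set0P X0] := eqVneq X set0; first by rewrite sup0 le_max lexx.
apply: sup_le_ub => // _ [_ [x xE <-] <-]; rewrite le_max; apply/orP.
have [xl|xl] := pselect (box_set l x).
  right; have Sx : S (chart_map c x) by exists x.
  rewrite -(iter_partial_ext_on s oU (SU Sx) (phi_U t)); exact: hC.
left; have Vx : V (chart_map c x) by exists x => //; split=> //; exact: Ec.
rewrite -(iter_partial_ext_on (W := R^o) s oV Vx (phi_V t)).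
by rewrite iter_partial0 normr0.
Qed.

End bump_regularity.

Lemma bump_Ck k l a r : bump_param l a r -> Ck_fun A k (chart_bump k.+1 (bc l) a r).
Proof.
move=> p c.
have E0 : (set0 : set M) `<=` chart_dom c by [].
exact: (bump_Ck_chart k (@closed0 M) E0 (exist _ (a, r) p)).
Qed.

(** The constant is uniform in centre and radius: the radius may shrink exponentially in time
    without affecting the mixing bound. *)
Lemma bump_Cr_norm (K : chart_cover A) k : exists C : R, forall l a r,
  bump_param l a r -> Cr_norm K k (chart_bump k.+1 (bc l) a r) <= C.
Proof.
apply: (uniform_finite (P := fun l C => forall a r, bump_param l a r ->
  Cr_norm K k (chart_bump k.+1 (bc l) a r) <= C)) => [l C C' CC' H a r p|l].
  exact: le_trans (H a r p) CC'.
suff [C hC] : exists C, forall t : {p : 'rV[R]_d * R | bump_param l p.1 p.2},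
    Cr_norm K k (chart_bump k.+1 (bc l) (sval t).1 (sval t).2) <= C.
  by exists C => a r p; exact: (hC (exist _ (a, r) p)).
apply: uniform_bigmax => l'; apply: uniform_bigmax => k'.
apply: uniform_bigmax => s.
apply: (@bump_partial_bounded k l (cover_chart l') (cover_set l')).
- exact: closed_cover_set.
- exact: cover_set_sub.
by rewrite size_tuple -ltnS.
Qed.

End bumps.

(** * Approximation of Borel sets *)

Section borel.
Variables (R : realType) (M : ptopologicalType).

Lemma measurable_fun_gt dd (T : measurableType dd) (h : T -> R) :
  (forall c : R, measurable [set x | c < h x]) -> measurable_fun setT h.
Proof.
move=> H; apply: (measurability _ (RGenOInfty.measurableE R)).
move=> _ [_ [c ->] <-]; rewrite setTI.
rewrite (_ : h @^-1` _ = [set x | c < h x]); first exact: H.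
by apply/seteqP; split=> x /=; rewrite in_itv /= andbT.
Qed.

Lemma open_borel (O : set (borel M)) : open (O : set M) -> measurable O.
Proof. by move=> oO; exact: sub_sigma_algebra. Qed.

Lemma closed_borel (O : set (borel M)) : closed (O : set M) -> measurable O.
Proof.
move=> cO; rewrite -(setCK O); apply: measurableC; apply: open_borel.
exact: closed_openC.
Qed.

Lemma open_gt (O : set M) (h : M -> R) (c : R) : open O ->
  (forall x, O x -> {for x, continuous (h : M -> R^o)}) ->
  open [set x | O x /\ c < h x].
Proof.
move=> oO hc; rewrite openE => x [Ox cx] /=.
have n1 : nbhs x O by exact: open_nbhs_nbhs.
have n2 : \forall y \near x, c < h y by exact: (cvgr_gt _ (hc x Ox)).
by apply: filterS2 n1 n2 => y; split.
Qed.

(** Chart expressions are continuous only on chart domains; the cut-off makes them globally Borel.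
    For [c < 0] the superlevel set also contains the complement of [D], where the product is 0. *)
Lemma borel_patch (O : set M) (D : set (borel M)) (h : M -> R) : open O ->
  D `<=` O -> measurable D ->
  (forall x, O x -> {for x, continuous (h : M -> R^o)}) ->
  measurable_fun setT (fun x : borel M => h x * \1_D x).
Proof.
move=> oO DO mD hc; apply: measurable_fun_gt => c.
have mA := open_borel (open_gt c oO hc).
have m1 := measurableI _ _ mD mA.
have [c0|c0] := ltP c 0.
  rewrite (_ : [set x | _] = (D `&` [set x | O x /\ c < h x]) `|` ~` D).
    by apply: measurableU => //; exact: measurableC.
  apply/seteqP; split=> x /=; rewrite indicE.
    have [/set_mem Dx|nDx] := boolP (x \in D); last first.
      by move=> _; right=> Dx; rewrite mem_set in nDx.
    by rewrite mulr1 => hx; left; split=> //; split=> //; exact: DO.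
  by move=> [[Dx [_ hx]]|nDx]; [rewrite mem_set // mulr1|rewrite memNset // mulr0].
rewrite (_ : [set x | _] = (D `&` [set x | O x /\ c < h x])) //.
apply/seteqP; split=> x /=; rewrite indicE.
  have [/set_mem Dx|nDx] := boolP (x \in D); last first.
    by rewrite mulr0 ltNge c0.
  by rewrite mulr1 => hx; split=> //; split=> //; exact: DO.
by move=> [Dx [_ hx]]; rewrite mem_set // mulr1.
Qed.

Lemma continuous_borel_fun (h : M -> R) : continuous (h : M -> R^o) ->
  measurable_fun setT (h : borel M -> R).
Proof.
move=> hc; apply: measurable_fun_gt => c; apply: open_borel.
have := @open_gt setT h c openT (fun x _ => hc x).
by congr open; apply/seteqP; split=> x /=; [case|].
Qed.

Lemma continuous_borel_map (F : M -> M) : continuous F ->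
  measurable_fun setT (F : borel M -> borel M).
Proof.
move=> cF; apply: (@measurability _ _ (borel M) (borel M) setT F (@open M)) => // _ [V oV <-].
rewrite setTI; apply: open_borel.
by move: cF => /continuousP; apply.
Qed.

End borel.

Section test_functions.
Variables (R : realType) (d : nat) (M : ptopologicalType) (A : smooth_atlas R d M).
Hypotheses (hausM : hausdorff_space M) (compM : compact [set: M]).

Lemma Ck_fun_continuous k (phi : M -> R) : Ck_fun A k phi ->
  continuous (phi : M -> R^o).
Proof.
move=> Cphi x; pose c := chart_at A x; have xc := chart_at_dom A x.
have [/(_ isT (chart_map c x)) + _] := Cphi c [::].
have im : (chart_map c @` chart_dom c) (chart_map c x) by exists x.
move=> /(_ im) /= H.
have H2 : {for x, continuous ((phi \o chart_inv c) \o chart_map c : M -> R^o)}.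
  exact: (continuous_comp (chart_map_continuous xc) H).
rewrite /prop_for /continuous_at /= in H2 *; rewrite chart_mapK // in H2.
apply: cvg_trans H2; apply: near_eq_cvg.
by apply: filterS (nbhs_chart_dom xc) => y yc /=; rewrite chart_mapK.
Qed.

Definition test_fun (k : nat) (phi : M -> R) : Prop :=
  Ck_fun A k phi /\ forall x, 0 <= phi x <= 1.

Lemma test_bmeas k phi : test_fun k phi -> bmeas (phi : borel M -> R).
Proof.
move=> [Cphi p01]; split.
  by apply: continuous_borel_fun; exact: Ck_fun_continuous Cphi.
by exists 1 => x; have /andP[p0 p1] := p01 x; rewrite ger0_norm.
Qed.

(** With [S] empty the uniform bounds are void, so the closure rules of [bounded_Ck] become
    available for plain C^k functions. *)
Lemma Ck_on_bounded (U : set 'rV[R]_d) k (F : 'rV[R]_d -> R^o) :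
  open U -> Ck_on k U F <-> bounded_Ck U set0 k (fun _ : unit => F).
Proof.
move=> oU; split=> [CF|CF]; last exact: (bounded_Ck_on tt CF).
by apply: Ck_bounded_Ck => //; exact: compact0.
Qed.

Lemma test_fun1 k : test_fun k (fun=> 1).
Proof.
split=> [c|x]; last by rewrite ler01 lexx.
have oU := @open_chart_im _ _ _ _ c.
apply/(Ck_on_bounded _ _ oU).
by apply: (bounded_Ck_cst oU (@sub0set _ _) k (C := 1)) => t; rewrite normr1.
Qed.

Lemma test_funC k phi : test_fun k phi -> test_fun k (fun x => 1 - phi x).
Proof.
move=> [Cphi p01]; split=> [c|x]; last first.
  by have /andP[p0 p1] := p01 x; rewrite subr_ge0 p1 lerBlDr lerDl p0.
have oU := @open_chart_im _ _ _ _ c.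
have bphi := (Ck_on_bounded _ _ oU).1 (Cphi c).
apply/(Ck_on_bounded _ _ oU).
have s0 := @sub0set _ (chart_map c @` chart_dom c).
have n1 : `|1 : R| <= 1 by rewrite normr1.
have nN1 : `|- 1 : R| <= 1 by rewrite normrN1.
have b1 := bounded_Ck_cst oU s0 k (fun _ : unit => n1).
have bN := bounded_Ck_cst oU s0 k (fun _ : unit => nN1).
apply: (bounded_Ck_ext oU s0 _ (bounded_CkD oU s0 b1 (bounded_CkM oU s0 bN bphi))).
by move=> t y _ /=; rewrite mulN1r.
Qed.

Lemma test_funM k phi psi : test_fun k phi -> test_fun k psi ->
  test_fun k (fun x => phi x * psi x).
Proof.
move=> [Cphi p01] [Cpsi q01]; split=> [c|x]; last first.
  have /andP[p0 p1] := p01 x; have /andP[q0 q1] := q01 x.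
  by rewrite mulr_ge0 //= -(mulr1 1) ler_pM.
have oU := @open_chart_im _ _ _ _ c.
have bphi := (Ck_on_bounded _ _ oU).1 (Cphi c).
have bpsi := (Ck_on_bounded _ _ oU).1 (Cpsi c).
apply/(Ck_on_bounded _ _ oU).
exact: (bounded_CkM oU (@sub0set _ _) bphi bpsi).
Qed.

Variable mu : probability (borel M) R.

(** The test functions 1 - (1 - phi)^n converge pointwise to the indicator of the set where [phi] is
    positive. *)
Lemma approximable_pos k phi : test_fun k phi ->
  approximable mu (test_fun k) [set x | 0 < phi x].
Proof.
move=> Tphi; have bphi := test_bmeas Tphi; have p01 := Tphi.2.
have mP : measurable ([set x | 0 < phi x] : set (borel M)).
  by apply: measurable_gt; exact: bphi.1.
split=> // e e0.
pose q n x : R := (1 - phi x) ^+ n.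
have Tq n : test_fun k (q n).
  elim: n => [|n IH]; first exact: test_fun1.
  rewrite (_ : q n.+1 = fun x => q n x * (1 - phi x)).
    by apply: test_funM => //; exact: test_funC.
  by apply/funext => x; rewrite /q exprSr.
pose h n x : R := `|1 - q n x - \1_[set x | 0 < phi x] x|.
have bh n : bmeas (h n : borel M -> R).
  apply/bmeas_abs/bmeasB; last exact: bmeas_indic.
  exact: test_bmeas (test_funC (Tq n)).
have : (fun n => Rintegral mu setT (h n)) @ \oo --> (0 : R).
  apply: (@mean_cvg0 _ _ _ mu h 1) => //.
    move=> n x; rewrite /h normr_id indicE.
    have /andP[q0 q1] := (Tq n).2 x.
    by rewrite ler_norml; case: (_ \in _) => /=; lra.
  apply: aeW => x; have /andP[p0 p1] := p01 x.
  have [phi0|phi0] := ltP 0 (phi x).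
    have qc : q ^~ x @ \oo --> (0 : R) by apply: cvg_expr; rewrite ger0_norm; lra.
    apply/cvgrPdist_le => e' e'0; have /cvgrPdist_le /(_ e' e'0) := qc.
    apply: filterS => n; rewrite /h indicE mem_set //= !sub0r !normrN => qe.
    by rewrite normr_id addrAC subrr sub0r normrN.
  have E n : h n x = 0.
    have px0 : phi x = 0 by apply/eqP; rewrite eq_le phi0 p0.
    rewrite /h indicE memNset /=; last by rewrite px0 ltxx.
    by rewrite /q px0 !subr0 expr1n subrr normr0.
  by under eq_fun do rewrite E; exact: cvg_cst.
move=> /cvgrPdist_le /(_ _ e0)[N _ /(_ N (leqnn N))].
rewrite sub0r normrN ger0_norm; last by apply: mean_ge0 => x; rewrite normr_ge0.
by move=> hN; exists (fun x => 1 - q N x) => //; exact: test_funC.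
Qed.

End test_functions.

(** * A countable family of bumps *)

Section grid.
Variables (R : realType) (d : nat) (M : ptopologicalType) (A : smooth_atlas R d M).
Hypotheses (hausM : hausdorff_space M) (compM : compact [set: M]).
Variable B : box_cover A.
Let bc := @box_chart _ _ _ _ B.
Let bo := @box_center _ _ _ _ B.
Let br := @box_radius _ _ _ _ B.

Definition grid_pt l (s : R) (k : 'I_d -> nat) : 'rV[R]_d :=
  \row_i (bo l 0 i - br l + s * (k i)%:R).

Lemma grid_approx l (y : 'rV[R]_d) (s : R) : 0 < s -> `|y - bo l| < br l ->
  exists k : {ffun 'I_d -> nat}, [/\ `|y - grid_pt l s k| <= s,
    `|grid_pt l s k - bo l| <= br l & forall i, (k i)%:R * s <= 2 * br l].
Proof.
move=> s0 yr; have r0 : 0 < br l by exact: box_radius_gt0.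
pose k := [ffun i : 'I_d => Num.truncn ((y 0 i - bo l 0 i + br l) / s)].
have yi i : `|y 0 i - bo l 0 i| < br l.
  by move/(row_norm_ltP _ r0) : yr => /(_ i); rewrite !mxE.
have ki i : (k i)%:R * s <= y 0 i - bo l 0 i + br l < (k i)%:R * s + s.
  have t0 : 0 <= (y 0 i - bo l 0 i + br l) / s.
    by rewrite divr_ge0 ?(ltW s0) //; have := yi i; rewrite ltr_norml => /andP[]; lra.
  have := truncn_itv t0;
    rewrite -[Num.truncn _](ffunE (fun i => Num.truncn ((y 0 i - bo l 0 i + br l) / s))) -/k.
  by rewrite ler_pdivlMr // ltr_pdivrMr // -natr1 mulrDl mul1r.
exists k; split=> [||i].
- apply/row_norm_leP => [|i]; first exact: ltW.
  by rewrite !mxE ler_norml; have /andP[] := ki i; lra.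
- apply/row_norm_leP => [|i]; first exact: ltW.
  rewrite !mxE ler_norml; have /andP[] := ki i; have := yi i; rewrite ltr_norml => /andP[].
  have : 0 <= s * (k i)%:R by rewrite mulr_ge0 // ltW.
  by lra.
by have /andP[] := ki i; have := yi i; rewrite ltr_norml => /andP[]; lra.
Qed.

(** An index is a box, an integer n giving the mesh 1/(n+1), and grid coordinates. Countability
    makes every open set a countable union of positivity sets of bumps, and a union of null ones
    null. The bump radius is [d.+1] times the mesh, as [bump_ge] requires. *)
Let T : Type := ('I_(box_num B) * nat * {ffun 'I_d -> nat})%type.

Let gs (t : T) : R := t.1.2.+1%:R^-1.
Let ga (t : T) := grid_pt t.1.1 (gs t) t.2.
Let gr (t : T) := d.+1%:R * gs t.

Let gs_gt0 t : 0 < gs t. Proof. by rewrite invr_gt0. Qed.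
Let gr_gt0 t : 0 < gr t. Proof. by rewrite mulr_gt0. Qed.

Definition grid_bump m (t : T) : M -> R := chart_bump m (bc t.1.1) (ga t) (gr t).

Definition grid_valid (t : T) : Prop := bump_param t.1.1 (ga t) (gr t) /\ gr t <= 1.

Definition grid_supp (t : T) : set M :=
  [set x | chart_dom (bc t.1.1) x /\ `|chart_map (bc t.1.1) x - ga t| <= gr t].

Lemma grid_supp_bump m t x : ~ grid_supp t x -> grid_bump m.+1 t x = 0.
Proof.
move=> nS; apply/eqP; rewrite eq_le bump_ge0 andbT leNgt; apply/negP.
by move=> /(bump_gt0 (gr_gt0 t))[xc lt]; apply: nS; split=> //; exact: ltW.
Qed.

Lemma closed_grid_supp t : grid_valid t -> closed (grid_supp t).
Proof. by move=> [p _]; exact: closed_bump_supp p. Qed.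

Lemma grid_bump_test k t : grid_valid t -> test_fun A k (grid_bump k.+1 t).
Proof.
move=> [p r1]; split=> [|x]; first exact: bump_Ck.
by rewrite bump_ge0 bump_le1 // r1 ltW.
Qed.

Lemma grid_basis (V : set M) x : open V -> V x -> exists t,
  [/\ grid_valid t, forall m, 0 < grid_bump m t x & grid_supp t `<=` V].
Proof.
move=> oV Vx; have [l xc xr] := box_coverT B x.
have r0 : 0 < br l by exact: box_radius_gt0.
have im : (chart_map (bc l) @` chart_dom (bc l)) (chart_map (bc l) x) by exists x.
have : nbhs (chart_map (bc l) x) (chart_inv (bc l) @^-1` V).
  apply: (chart_inv_cont im); rewrite chart_mapK //.
  exact: open_nbhs_nbhs.
move=> /nbhs_radius[rho rho0 hrho].
pose e := Num.min rho (Num.min (br l) 1).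
have e0 : 0 < e by rewrite !lt_min rho0 r0 ltr01.
(* A support point is within (d+1)s of the grid point, which is within s of the chart image of [x];
   so the mesh s must satisfy (d+2)s < e. *)
pose n := Num.truncn (d.+2%:R / e).
have ne : d.+2%:R * n.+1%:R^-1 < e.
  rewrite ltr_pdivrMr // mulrC -ltr_pdivrMr //.
  by have /andP[] := truncn_itv (divr_ge0 (ler0n R d.+2) (ltW e0)).
have s0 : 0 < n.+1%:R^-1 :> R by rewrite invr_gt0.
have [k [k1 k2 k3]] := grid_approx s0 xr.
pose t : T := (l, n, k); exists t.
move: ne; rewrite !lt_min => /and3P[n1 n2 n3].
have gle : gr t + gs t = d.+2%:R * n.+1%:R^-1.
  by rewrite /gr -[in RHS]natr1 mulrDl mul1r.
have gs0 := gs_gt0 t.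
split=> [|m|z [zc zr]].
- have gr_lt c : gr t + gs t < c -> gr t <= c.
    by move=> /ltW; apply: le_trans; rewrite lerDl ltW.
  rewrite -gle in n2 n3; split; last exact: gr_lt.
  by split=> //; rewrite gr_gt0 gr_lt.
- apply: lt_le_trans (bump_ge m xc k1 (ltW s0) (lexx _)).
  exact: exprn_gt0.
- have zc' : chart_dom (bc l) z by [].
  rewrite -(chart_mapK zc'); apply: hrho.
  rewrite -(subrKA (ga t)); apply: le_lt_trans (ler_normD _ _) _.
  apply: le_lt_trans n1; rewrite -gle; apply: lerD => //.
  by rewrite distrC.
Qed.

Variable mu : probability (borel M) R.

Let Fam (Q : T -> Prop) k (n : nat) : set M :=
  if @unpickle T n is Some t then
    [set x | Q t /\ 0 < grid_bump k.+1 t x] else set0.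

Let FamU (Q : T -> Prop) k x : (\bigcup_n Fam Q k n) x <->
  exists t, Q t /\ 0 < grid_bump k.+1 t x.
Proof.
split=> [[n _]|[t [Qt bt]]].
  by rewrite /Fam; case: unpickle => // t [Qt bt]; exists t.
by exists (pickle t) => //; rewrite /Fam pickleK.
Qed.

Lemma approximable_open k (V : set (borel M)) : open (V : set M) ->
  approximable mu (test_fun A k) V.
Proof.
move=> oV; pose Q t := grid_valid t /\ grid_supp t `<=` V.
have -> : V = \bigcup_n Fam Q k n.
  apply/seteqP; split=> x.
    by move=> Vx; apply/FamU; have [t [v b s]] := grid_basis oV Vx; exists t.
  move=> /FamU[t [[v s] b]]; apply: s; apply: contrapT => /(grid_supp_bump k) b0.
  by rewrite b0 ltxx in b.
have [a0 _ aU] := approximable_sigma_algebra mu (@test_bmeas _ _ _ A k)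
  (fun phi p => p.2) (@test_fun1 _ _ _ A k) (@test_funC _ _ _ A k) (@test_funM _ _ _ A k).
apply: aU => n; rewrite /Fam; case: unpickle => // t.
have [[v s]|nQ] := pselect (Q t).
  rewrite (_ : [set x | _] = [set x | 0 < grid_bump k.+1 t x]).
    by apply: approximable_pos; exact: grid_bump_test.
  by apply/seteqP; split=> x /=; [case|split].
rewrite (_ : [set x | _] = set0) //.
by apply/seteqP; split=> x //= [].
Qed.

Lemma approximable_borel k (V : set (borel M)) : measurable V ->
  approximable mu (test_fun A k) V.
Proof.
apply: smallest_sub; last by move=> W; exact: approximable_open.
exact: (approximable_sigma_algebra mu (@test_bmeas _ _ _ A k)
  (fun phi p => p.2) (@test_fun1 _ _ _ A k) (@test_funC _ _ _ A k) (@test_funM _ _ _ A k)).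
Qed.

(** [Z] is the union of the null bumps' positivity sets: it is null, and bumps positive off it have
    positive mean. Two points off [Z] are separated by the Hausdorff property. If there were no two
    such points, the complement of [Z] would be an atom of full mass. *)
Lemma separated_bumps k : non_atomic mu -> exists t1 t2,
  [/\ grid_valid t1, grid_valid t2, grid_supp t1 `&` grid_supp t2 = set0,
    0 < Rintegral mu setT (grid_bump k.+1 t1) &
    0 < Rintegral mu setT (grid_bump k.+1 t2)].
Proof.
move=> na.
pose Q t := grid_valid t /\ mu [set x | 0 < grid_bump k.+1 t x] = 0%E.
pose Z : set (borel M) := \bigcup_n Fam Q k n.
have mpos t : grid_valid t -> measurable ([set x | 0 < grid_bump k.+1 t x] : set (borel M)).
  by move=> v; apply: measurable_gt; exact: (test_bmeas (grid_bump_test k v)).1.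
have mF n : measurable (Fam Q k n : set (borel M)) /\ mu (Fam Q k n) = 0%E.
  rewrite /Fam; case: unpickle => [t|]; last by split.
  have [Qt|nQ] := pselect (Q t); last first.
    by rewrite (_ : [set x | _] = set0) //; apply/seteqP; split=> x //= [].
  rewrite (_ : [set x | _] = [set x | 0 < grid_bump k.+1 t x]).
    by split; [exact: mpos Qt.1|exact: Qt.2].
  by apply/seteqP; split=> x /=; [case|split].
have mZ : measurable Z by apply: bigcup_measurable => n _; exact: (mF n).1.
have Z0 : mu Z = 0%E.
  apply: measure_negligible => //; apply: negligible_bigcup => n.
  by exists (Fam Q k n); split; [exact: (mF n).1|exact: (mF n).2|].
have pos t x : grid_valid t -> 0 < grid_bump k.+1 t x -> ~ Z x ->
    0 < Rintegral mu setT (grid_bump k.+1 t).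
  move=> v b nZ; apply: mean_gt0.
  - exact: test_bmeas (grid_bump_test k v).
  - by move=> y; exact: bump_ge0.
  rewrite lt0e measure_ge0 andbT; apply/eqP => e; apply: nZ; apply/FamU.
  by exists t; split.
have [[p [q [nZp nZq pq]]]|nopair] := pselect (exists p q, [/\ ~ Z p, ~ Z q & p != q]).
  have := hausM; rewrite open_hausdorff => /(_ p q pq)[[V1 V2] /= [Vp Vq] [w1 w2 /eqP V12]].
  have [t1 [v1 b1 s1]] := grid_basis w1 (set_mem Vp).
  have [t2 [v2 b2 s2]] := grid_basis w2 (set_mem Vq).
  exists t1, t2; split=> //; [|exact: pos v1 (b1 _) nZp|exact: pos v2 (b2 _) nZq].
  apply/seteqP; split=> // x [/s1 x1 /s2 x2].
  by rewrite -V12.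
have mZC : (0 < mu (~` Z))%E.
  by rewrite probability_setC // Z0 sube0 lte01.
have [B' [mB' sB' B'0 ltB']] := na _ (measurableC mZ) mZC.
exfalso; move: ltB'; apply/negP; rewrite -leNgt; apply: le_measure; rewrite ?inE //.
  exact: measurableC.
have [p B'p] : B' !=set0.
  apply/set0P/negP => /eqP e; by rewrite e measure0 ltxx in B'0.
move=> q nZq; apply: contrapT => nB'q; apply: nopair; exists p, q; split=> //.
  exact: sB'.
by apply/eqP => e; rewrite -e in nB'q.
Qed.

End grid.

(** * Norm of the derivative *)

Lemma indic_in (T : Type) (R : pzRingType) (D : set T) x : D x -> \1_D x = 1 :> R.
Proof. by move=> Dx; rewrite indicE mem_set. Qed.

Lemma indic_out (T : Type) (R : pzRingType) (D : set T) x : ~ D x -> \1_D x = 0 :> R.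
Proof. by move=> Dx; rewrite indicE memNset. Qed.

Section derivative_norm.
Variables (R : realType) (d : nat) (M : ptopologicalType) (A : smooth_atlas R d M).
Hypotheses (hausM : hausdorff_space M) (compM : compact [set: M]).
Variable B : box_cover A.
Let bc := @box_chart _ _ _ _ B.
Let H := @box_set _ _ _ _ B.
Implicit Types F G : M -> M.

(** The cut-off to a compact subset of the chart domains makes the term bounded and Borel. *)
Definition deriv_term F l l' (x : M) : R :=
  entry_norm (Jchart F (bc l) (bc l') x) * \1_(H l `&` F @^-1` H l') x.

(* Summing over all pairs of boxes containing [x] and [F x], instead of choosing
   one, makes [deriv_norm] Borel and submultiplicative. *)
Definition deriv_norm F (x : M) : R := \sum_l \sum_l' deriv_term F l l' x.

Lemma deriv_term_ge0 F l l' x : 0 <= deriv_term F l l' x.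
Proof. by rewrite mulr_ge0 ?entry_norm_ge0 // indicE. Qed.

Lemma deriv_term_in F l l' x : H l x -> H l' (F x) ->
  deriv_term F l l' x = entry_norm (Jchart F (bc l) (bc l') x).
Proof. by move=> Hx HFx; rewrite /deriv_term indic_in // mulr1. Qed.

Lemma deriv_term_out F l l' x : ~ (H l x /\ H l' (F x)) -> deriv_term F l l' x = 0.
Proof. by move=> nH; rewrite /deriv_term indic_out // mulr0. Qed.

Lemma deriv_norm_ge0 F x : 0 <= deriv_norm F x.
Proof. by do 2 apply: sumr_ge0 => ? _; exact: deriv_term_ge0. Qed.

Lemma le_deriv_norm F x l l' : H l x -> H l' (F x) ->
  entry_norm (Jchart F (bc l) (bc l') x) <= deriv_norm F x.
Proof.
move=> Hx HFx; rewrite -deriv_term_in // /deriv_norm (bigD1 l) //= (bigD1 l') //=.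
rewrite -addrA lerDl addr_ge0 //; first by apply: sumr_ge0 => ? _; exact: deriv_term_ge0.
by do 2 apply: sumr_ge0 => ? _; exact: deriv_term_ge0.
Qed.

Lemma box_set_cover x : exists l, H l x.
Proof.
have [l xc xr] := box_coverT B x; exists l; split=> //.
by apply: le_trans (ltW xr) _; rewrite ler_peMl ?ler1n // ltW // box_radius_gt0.
Qed.

(** All chart expressions of the composition factor through one fixed box [m] containing [F x]; the
    terms with other intermediate boxes are nonnegative and may be added. *)
Lemma deriv_norm_comp F G x : C1_map A F -> C1_map A G ->
  deriv_norm (G \o F) x <= deriv_norm F x * deriv_norm G (F x).
Proof.
move=> CF CG; have [m Hm] := box_set_cover (F x).
apply: (@le_trans _ _ (\sum_l \sum_l' deriv_term F l m x * deriv_term G m l' (F x))).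
  apply: ler_sum => l _; apply: ler_sum => l' _.
  have [[Hl Hl']|nH] := pselect (H l x /\ H l' (G (F x))); last first.
    by rewrite deriv_term_out // mulr_ge0 // deriv_term_ge0.
  rewrite !deriv_term_in // (Jchart_comp CF CG Hl.1 Hm.1 Hl'.1).
  exact: entry_norm_mul.
rewrite {1}/deriv_norm mulr_suml; apply: ler_sum => l _.
rewrite -mulr_sumr; apply: ler_pM.
- exact: deriv_term_ge0.
- by apply: sumr_ge0 => ? _; exact: deriv_term_ge0.
- by rewrite (bigD1 m) //= lerDl; apply: sumr_ge0 => ? _; exact: deriv_term_ge0.
- rewrite /deriv_norm [leRHS](bigD1 m) //= lerDl.
  by do 2 apply: sumr_ge0 => ? _; exact: deriv_term_ge0.
Qed.

(** By [sdiff_close] the derivatives at nearby points are close to that at [x]; applying them to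
    coordinate vectors compares the rows. *)
Lemma continuous_Jchart F (c c' : chart A) x : C1_map A F -> chart_dom c x ->
  chart_dom c' (F x) ->
  {for x, continuous (fun z => entry_norm (Jchart F c c' z) : R^o)}.
Proof.
move=> [cF sF] xc Fxc; apply/cvgrPdist_le => e e0.
have e1 : 0 < e / (d.+1%:R * d.+1%:R) by rewrite divr_gt0 ?mulr_gt0.
have [r r0 hr] := sdiff_close (sF c c' x xc Fxc) e1.
have n1 := nbhs_chart_dom xc.
have n2 : \forall z \near x, chart_dom c' (F z).
  exact: (cF x _ (nbhs_chart_dom Fxc)).
have n3 : \forall z \near x, `|chart_map c z - chart_map c x| < r.
  exact: (chart_map_continuous xc (radius_nbhs _ r0)).
near=> z.
have zc : chart_dom c z by near: z.
have Fzc : chart_dom c' (F z) by near: z.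
have zr : `|chart_map c z - chart_map c x| < r by near: z.
have H1 := hr _ _ zr (sF c c' z zc Fzc).
rewrite /entry_norm -sumrB; apply: le_trans (ler_norm_sum _ _ _) _.
apply: (@le_trans _ _ (\sum_(i < d) \sum_(j < d) e / (d.+1%:R * d.+1%:R))).
  apply: ler_sum => i _; rewrite -sumrB; apply: le_trans (ler_norm_sum _ _ _) _.
  apply: ler_sum => j _; apply: le_trans (ler_dist_dist _ _) _.
  have := H1 (delta_mx 0 i); rewrite norm_delta_mx mulr1 -rowE.
  apply: le_trans; rewrite distrC; apply: le_trans (coord_le_norm _ j).
  by rewrite !mxE.
rewrite !sumr_const !card_ord -mulrnA -[leLHS]mulr_natr natrM mulrAC.
rewrite ler_pdivrMr ?mulr_gt0 //; apply: ler_wpM2l; first exact: ltW.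
by apply: ler_pM; rewrite ?ler_nat.
Unshelve. all: by end_near. Qed.

Lemma deriv_norm_bmeas F : C1_map A F -> bmeas (deriv_norm F : borel M -> R).
Proof.
move=> CF; have cF := CF.1.
apply: bmeas_sum => l; apply: bmeas_sum => l'.
have cH l0 : closed (H l0) by exact: closed_box_set.
have cFH : closed (F @^-1` H l') by move: cF => /continuous_closedP; apply.
have cHH : closed (H l `&` F @^-1` H l') by exact: closedI.
have cJ x : (chart_dom (bc l) `&` F @^-1` chart_dom (bc l')) x ->
    {for x, continuous (fun z => entry_norm (Jchart F (bc l) (bc l') z) : R^o)}.
  by move=> [xl xl']; exact: continuous_Jchart.
have sub : H l `&` F @^-1` H l' `<=` chart_dom (bc l) `&` F @^-1` chart_dom (bc l').
  by move=> x [[xl _] [xl' _]].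
split.
  apply: (borel_patch (O := chart_dom (bc l) `&` F @^-1` chart_dom (bc l'))) => //.
  - apply: openI; first exact: open_chart_dom.
    by move: cF => /continuousP; apply; exact: open_chart_dom.
  - exact: closed_borel.
have [|C hC] := @compact_bounded_on R M (H l `&` F @^-1` H l')
    (fun z => entry_norm (Jchart F (bc l) (bc l') z)) _ (fun x Hx => cJ x (sub x Hx)).
  exact: subclosed_compact compM _.
exists (Num.max 0 C) => x.
have [[Hx HFx]|nH] := pselect (H l x /\ H l' (F x)); last first.
  by rewrite deriv_term_out // normr0 le_max lexx.
by rewrite deriv_term_in // le_max hC // orbT.
Qed.

(** A replacement for a distance on [M], not symmetric: closeness is read in one of the finitely
    many charts whose box contains the first point. *)
Definition box_close (r : R) (x y : M) : Prop := exists l,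
  [/\ H l x, chart_dom (bc l) y & `|chart_map (bc l) y - chart_map (bc l) x| < r].

Lemma box_close_le r r' x y : r <= r' -> box_close r x y -> box_close r' x y.
Proof. by move=> rr' [l [? ? lt]]; exists l; split=> //; exact: lt_le_trans rr'. Qed.

Lemma near_forall2 (I : finType) (P : I -> M -> R -> Prop) (x0 : M) :
  (forall i, \forall x \near x0 & r \near 0^'+, P i x r) ->
  \forall x \near x0 & r \near 0^'+, forall i, P i x r.
Proof.
exact: (@filter_forall _ I (fun i z => P i z.1 z.2) (filter_prod (nbhs x0) (0^'+)) _).
Qed.

Let small_pair F (ll : 'I_(box_num B) * 'I_(box_num B)) (r : R) (x : M) : Prop :=
  forall y, H ll.1 x -> H ll.2 (F x) -> chart_dom (bc ll.1) y ->
  `|chart_map (bc ll.1) y - chart_map (bc ll.1) x| < r ->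
  chart_dom (bc ll.2) (F y) /\
  `|chart_map (bc ll.2) (F y) - chart_map (bc ll.2) (F x)| <=
    (1 + deriv_norm F x) * `|chart_map (bc ll.1) y - chart_map (bc ll.1) x|.

Let small_step F (r : R) (x : M) : Prop := forall ll, small_pair F ll r x.

(** The error of strict differentiability at [x0] is at most |v|/2, and the derivatives at [x] and
    [x0] differ on [v] by at most |v|/2. Together they account for the 1 added to [deriv_norm]. *)
Let near_small_step F (x0 : M) : C1_map A F ->
  \forall x \near x0 & r \near 0^'+, small_step F r x.
Proof.
move=> CF; have [cF sF] := CF.
suff loc (ll : 'I_(box_num B) * 'I_(box_num B)) :
    \forall x \near x0 & r \near 0^'+, small_pair F ll r x.
  exact: near_forall2 loc.
case: ll => l l'; rewrite /small_pair /=.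
have cH l0 : closed (H l0) by exact: closed_box_set.
have [[xl Fxl]|nH] := pselect (H l x0 /\ H l' (F x0)); last first.
  have : \forall x \near x0, ~ (H l `&` F @^-1` H l') x.
    apply: open_nbhs_nbhs; split=> //; apply: closed_openC; apply: closedI => //.
    by move: cF => /continuous_closedP; apply.
  move=> nn; near=> x r.
  have nx : ~ (H l `&` F @^-1` H l') x by near: x.
  by move=> y Hx HFx; case: nx.
set c := bc l; set c' := bc l'; set h := in_charts F c c'; set y0 := chart_map c x0.
have xc : chart_dom c x0 := xl.1; have Fxc : chart_dom c' (F x0) := Fxl.1.
have h0 : 0 < 1 / 2 :> R by lra.
have sJ := sF c c' x0 xc Fxc.
have [r1 r10 hr1] := sJ _ h0.
have [r2 r20 hr2] := sdiff_close sJ h0.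
have : nbhs y0 (chart_map c @` (chart_dom c `&` F @^-1` chart_dom c')).
  by apply: open_nbhs_nbhs; split; [exact: open_preimage|exists x0].
move=> /nbhs_radius[r3 r30 hr3].
pose rr := Num.min r1 (Num.min r2 r3) / 2.
have rr0 : 0 < rr by rewrite divr_gt0 // !lt_min r10 r20.
have nx : \forall x \near x0, `|chart_map c x - y0| < rr.
  exact: (chart_map_continuous xc (radius_nbhs _ rr0)).
near=> x r.
have xrr : `|chart_map c x - y0| < rr by near: x.
have rrr : r < rr by near: r; exact: nbhs_right_lt.
move=> y Hx HFx yc yr.
have yrr : `|chart_map c y - y0| < rr + rr.
  rewrite -(subrKA (chart_map c x)); apply: le_lt_trans (ler_normD _ _) _.
  by rewrite ltrD // (lt_trans yr).
have x2 : `|chart_map c x - y0| < rr + rr by rewrite (lt_trans xrr) // ltrDl.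
have {yrr x2} [[y1 y2 y3] [x1 x2 x3]] :
  [/\ `|chart_map c y - y0| < r1, `|chart_map c y - y0| < r2 & `|chart_map c y - y0| < r3] /\
  [/\ `|chart_map c x - y0| < r1, `|chart_map c x - y0| < r2 & `|chart_map c x - y0| < r3].
  move: yrr x2; rewrite /rr -splitr !lt_min => /and3P[? ? ?] /and3P[? ? ?].
  by split.
have [z [zc Fzc] zy] := hr3 _ y3.
have Fyc : chart_dom c' (F y).
  by rewrite -(chart_mapK yc) -zy chart_mapK.
split=> //.
have H1 := hr1 _ _ y1 x1.
have H2 := hr2 _ _ x2 (sF c c' x Hx.1 HFx.1) (chart_map c y - chart_map c x).
have H3 := mul_row_norm_le (chart_map c y - chart_map c x) (Jchart F c c' x).
have H4 := le_deriv_norm Hx HFx.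
rewrite /h !in_chartsE // in H1; last exact: Hx.1.
move: H1 H2 H3 H4; rewrite mulmxBr.
set v := chart_map c y - chart_map c x; set w := _ - chart_map c' (F x).
set J0 := v *m _; set J1 := v *m _; rewrite -/c -/c' -/J1 => H1 H2 H3 H4.
have E : w = (w - J0) - (J1 - J0) + J1 by rewrite opprB addrA subrK subrK.
rewrite E; apply: le_trans (ler_normD _ _) _.
have H5 := ler_normB (w - J0) (J1 - J0).
have H6 : entry_norm (Jchart F c c' x) * `|v| <= deriv_norm F x * `|v| by rewrite ler_wpM2r.
by rewrite mulrDl mul1r; lra.
Unshelve. all: by end_near. Qed.

(** Compactness turns the local radii into one. Any box around [F x] may serve, because [deriv_norm]
    dominates the derivative in every pair of boxes. *)
Lemma box_close_step F : C1_map A F -> exists2 r0 : R, 0 < r0 & forall r x y,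
  r <= r0 -> box_close r x y -> box_close (r * (1 + deriv_norm F x)) (F x) (F y).
Proof.
move=> CF.
have := (compact_near_coveringP _).1 compM R (0^'+) (small_step F) _.
move=> /(_ _ (fun x _ => near_small_step x CF)).
case/nbhs_ballP => /= e e0 he.
have e20 : 0 < e / 2 by rewrite divr_gt0.
exists (e / 2) => // r x y re [l [Hx yc yr]].
have [l' Hl'] := box_set_cover (F x).
have e2 : ball 0 e (e / 2).
  by rewrite -ball_normE /= sub0r normrN gtr0_norm //; lra.
have [Fyc lt] := he (e / 2) e2 e20 x I (l, l') y Hx Hl' yc (lt_le_trans yr re).
exists l'; split=> //; apply: le_lt_trans lt _.
by rewrite mulrC ltr_pM2r // ltr_pwDl // deriv_norm_ge0.
Qed.

(** Each point lies outside one of the two closed sets and has a neighbourhood that avoids it with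
    some margin; compactness makes the margin uniform. *)
Lemma box_close_separated (S1 S2 : set M) : closed S1 -> closed S2 ->
  S1 `&` S2 = set0 -> exists2 r : R, 0 < r & forall z,
    (forall y, box_close r z y -> ~ S1 y) \/ (forall y, box_close r z y -> ~ S2 y).
Proof.
move=> c1 c2 S12.
have loc (S : set M) z0 : closed S -> ~ S z0 ->
    \forall z \near z0 & r \near 0^'+, forall l y, H l z -> chart_dom (bc l) y ->
      `|chart_map (bc l) y - chart_map (bc l) z| < r -> ~ S y.
  move=> cS nS.
  apply: near_forall2 => l.
  have cH : closed (H l) by exact: closed_box_set.
  have [Hz|nH] := pselect (H l z0); last first.
    have : \forall z \near z0, ~ H l z.
      by apply: open_nbhs_nbhs; split=> //; exact: closed_openC.
    move=> nn; near=> z r.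
    have nz : ~ H l z by near: z.
    by move=> y /nz.
  have im : (chart_map (bc l) @` chart_dom (bc l)) (chart_map (bc l) z0).
    by exists z0 => //; exact: Hz.1.
  have : nbhs (chart_map (bc l) z0) (chart_inv (bc l) @^-1` (~` S)).
    apply: (chart_inv_cont im); rewrite chart_mapK; last exact: Hz.1.
    by apply: open_nbhs_nbhs; split=> //; exact: closed_openC.
  move=> /nbhs_radius[rho rho0 hrho].
  have rho20 : 0 < rho / 2 by rewrite divr_gt0.
  have nz : \forall z \near z0, `|chart_map (bc l) z - chart_map (bc l) z0| < rho / 2.
    exact: (chart_map_continuous Hz.1 (radius_nbhs _ rho20)).
  near=> z r.
  have zr : `|chart_map (bc l) z - chart_map (bc l) z0| < rho / 2 by near: z.
  have rr : r < rho / 2 by near: r; exact: nbhs_right_lt.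
  move=> y Hlz yc yr.
  rewrite -(chart_mapK yc); apply: hrho.
  rewrite -(subrKA (chart_map (bc l) z)); apply: le_lt_trans (ler_normD _ _) _.
  by rewrite (splitr rho) ltrD // (lt_trans yr).
have := (compact_near_coveringP _).1 compM R (0^'+) (fun r z =>
   (forall l y, H l z -> chart_dom (bc l) y ->
      `|chart_map (bc l) y - chart_map (bc l) z| < r -> ~ S1 y) \/
   (forall l y, H l z -> chart_dom (bc l) y ->
      `|chart_map (bc l) y - chart_map (bc l) z| < r -> ~ S2 y)) _.
case=> [z0 _|/= e e0 he].
  have [S1z|nS1z] := pselect (S1 z0).
    have nS2z : ~ S2 z0.
      by move=> S2z; have : (S1 `&` S2) z0 by []; rewrite S12.
    by apply: filterS (loc S2 z0 c2 nS2z) => zr; right.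
  by apply: filterS (loc S1 z0 c1 nS1z) => zr; left.
have e20 : 0 < e / 2 by rewrite divr_gt0.
have e2 : ball 0 e (e / 2).
  by rewrite -ball_normE /= sub0r normrN gtr0_norm //; lra.
exists (e / 2) => // z; have [h|h] := he (e / 2) e2 e20 z I.
  by left=> y [l [? ? ?]]; exact: (h l y).
by right=> y [l [? ? ?]]; exact: (h l y).
Unshelve. all: by end_near. Qed.

(** A step multiplies the radius by exp(h x + theta), and [maxsum] at time n+1 is at least [h x]
    plus [maxsum] at time n from [F x]: the exponents match the induction. The exponent is
    nonpositive, which keeps the radius below [r0], where the step is valid. *)
Lemma box_close_orbit F (theta r0 : R) : 0 <= theta -> 0 < r0 ->
  (forall r x y, r <= r0 -> box_close r x y ->
     box_close (r * (1 + deriv_norm F x)) (F x) (F y)) ->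
  forall n x y, box_close (r0 * expR (- maxsum F (fun x => ln (1 + deriv_norm F x) - theta) n x
      - theta * n%:R)) x y -> box_close r0 (iter n F x) (iter n F y).
Proof.
move=> th0 r00 step; elim=> [|n IH] x y.
  by rewrite /= oppr0 mulr0 subr0 expR0 mulr1.
rewrite !iterSr => cl; apply: IH.
set h := fun x => _ in cl *.
have le0 : - maxsum F h n.+1 x - theta * n.+1%:R <= 0.
  by have := maxsum_ge0 F h n.+1 x; have := mulr_ge0 th0 (ler0n R n.+1); lra.
apply: box_close_le (step _ _ _ _ cl); last first.
  by rewrite ler_piMr ?(ltW r00) // -[leRHS]expR0 ler_expR.
have d0 : 0 < 1 + deriv_norm F x by rewrite ltr_pwDl // deriv_norm_ge0.
rewrite -mulrA ler_pM2l // -[X in _ * X]lnK ?posrE // -expRD ler_expR.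
have := maxsumS_ge F h n x; rewrite {1}/h -natr1 mulrDr mulr1; lra.
Qed.

End derivative_norm.

(** * Mass of small bumps *)

Lemma pigeonhole_sum (R : realType) (I : finType) (F : I -> R) (S : R) :
  0 < S -> S <= \sum_i F i -> exists i, S / (2 * (#|I|%:R + 1)) <= F i.
Proof.
move=> S0 le; apply: contrapT => /forallNP H.
set q := S / _ in H; have q0 : 0 < #|I|%:R + 1 :> R by rewrite ltr_wpDl.
have : \sum_i F i <= \sum_(i in I) q.
  by apply: ler_sum => i _; apply: ltW; rewrite ltNge; apply/negP.
rewrite sumr_const -mulr_natr => le2; have := le_trans le le2.
rewrite /q mulrAC ler_pdivlMr ?mulr_gt0 //.
have : 0 <= S * #|I|%:R by rewrite mulr_ge0 // ltW.
rewrite mulrA mulrDr mulr1; lra.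
Qed.

Section grid_mass.
Variables (R : realType) (d : nat) (M : ptopologicalType) (A : smooth_atlas R d M).
Hypotheses (hausM : hausdorff_space M) (compM : compact [set: M]).
Variables (B : box_cover A) (mu : probability (borel M) R).
Let bc := @box_chart _ _ _ _ B.
Let bo := @box_center _ _ _ _ B.
Let br := @box_radius _ _ _ _ B.

Lemma box_radius_lower : exists2 b : R, 0 < b <= 1 & forall l, b <= br l.
Proof.
have [i C C' CC' h|l|C hC] := @uniform_finite R 'I_(box_num B) (fun l C => (br l)^-1 <= C).
- exact: le_trans h CC'.
- by exists (br l)^-1.
exists (Num.max 1 C)^-1.
  by rewrite invr_gt0 lt_max ltr01 /= invf_le1 ?lt_max ?ltr01 // le_max lexx.
move=> l; rewrite -[br l]invrK lef_pV2 ?posrE ?invr_gt0 ?box_radius_gt0 ?lt_max ?ltr01 //.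
by rewrite le_max hC orbT.
Qed.

(** At mesh [s] the bumps of all admissible grid points sum to at least s^(2(k+1)) everywhere, and
    there are at most of order s^-d of them; one of them carries its share of the mass over [G]. *)
Lemma bump_mass k : exists c b : R, [/\ 0 < c, 0 < b &
  forall (s : R) (G : set (borel M)), 0 < s <= b -> measurable G ->
  1 / 2 <= Rintegral mu setT (\1_G) ->
  exists l a, bump_param l a (d.+1%:R * s) /\
    c * s ^+ (2 * k.+1 + d) <=
      Rintegral mu setT (fun x => chart_bump k.+1 (bc l) a (d.+1%:R * s) x * \1_G x)].
Proof.
have [b0 /andP[b00 b01] hb0] := box_radius_lower.
have [i C C' CC' h|l|Cm hCm] := @uniform_finite R 'I_(box_num B) (fun l C => br l <= C).
- exact: le_trans h CC'.
- by exists (br l).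
pose Cx := Num.max 0 Cm.
have Cx0 : 0 <= Cx by rewrite le_max lexx.
have hCx l : br l <= Cx by rewrite le_max hCm orbT.
(* There are [box_num B * n ^ d] indices with n <= (2 Cx + 1)/s; the final 1 is for the one added in
   the denominator of [pigeonhole_sum]. The 4 in the constant below combines the mass 1/2 of [G]
   with the 2 of that denominator. *)
pose W : R := (box_num B)%:R * (2 * Cx + 1) ^+ d + 1.
have W0 : 0 < W by rewrite ltr_wpDl // mulr_ge0 // exprn_ge0 // addr_ge0 // mulr_ge0.
exists (1 / (4 * W)), (b0 / d.+1%:R); split.
- by rewrite divr_gt0 // mulr_gt0.
- by rewrite divr_gt0.
move=> s G /andP[s0 sb] mG hG.
have rb : d.+1%:R * s <= b0 by rewrite mulrC -ler_pdivlMr.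
have s1 : s <= 1.
  apply: le_trans (le_trans rb b01); rewrite ler_peMl ?(ltW s0) //.
  by rewrite ler1n.
pose n := (Num.truncn (2 * Cx / s)).+1.
pose I : Type := ('I_(box_num B) * {ffun 'I_d -> 'I_n})%type.
pose pt (i : I) := grid_pt i.1 s (fun j => i.2 j).
pose ok (i : I) := `[< bump_param i.1 (pt i) (d.+1%:R * s) >].
pose F (i : I) (x : M) : R :=
  if ok i then chart_bump k.+1 (bc i.1) (pt i) (d.+1%:R * s) x * \1_G x else 0.
have r0 : 0 < d.+1%:R * s by rewrite mulr_gt0.
have test (i : I) : bump_param i.1 (pt i) (d.+1%:R * s) ->
    bmeas (chart_bump k.+1 (bc i.1) (pt i) (d.+1%:R * s) : borel M -> R).
  move=> p; apply: (@test_bmeas _ _ _ A k); split=> [|x]; first exact: bump_Ck.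
  by rewrite bump_ge0 bump_le1 // (ltW r0) (le_trans rb).
have bG := bmeas_indic R mG.
have bF i : bmeas (F i : borel M -> R).
  rewrite /F; have [/asboolP p|_] := boolP (ok i); last exact: bmeas_cst.
  by apply: bmeasM => //; exact: test.
have F0 i x : 0 <= F i x.
  by rewrite /F; case: ifP => // _; rewrite mulr_ge0 ?bump_ge0 // indicE.
have sumF x : s ^+ (2 * k.+1) * \1_G x <= \sum_i F i x.
  have [Gx|nGx] := pselect (G x); last first.
    by rewrite indicE memNset // mulr0 sumr_ge0.
  have [l xc xr] := box_coverT B x.
  have [kk [h1 h2 h3]] := grid_approx s0 xr.
  have kn j : (kk j < n)%N.
    rewrite ltnS truncn_ge_nat ?divr_ge0 ?mulr_ge0 ?(ltW s0) //.
    by rewrite ler_pdivlMr // (le_trans (h3 j)) // ler_wpM2l.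
  pose i : I := (l, [ffun j => Ordinal (kn j)]).
  have ipt : pt i = grid_pt l s kk.
    by apply/rowP => j; rewrite !mxE ffunE.
  have p : bump_param l (pt i) (d.+1%:R * s).
    by rewrite ipt; split=> //; rewrite r0 (le_trans rb).
  rewrite (bigD1 i) //=; apply: (@le_trans _ _ (F i x)); last first.
    by rewrite lerDl sumr_ge0.
  rewrite /F (_ : ok i = true); last by apply/asboolP.
  rewrite ler_wpM2r ?indicE //.
  by apply: bump_ge => //; [rewrite ipt|exact: ltW].
have S0 : 0 < s ^+ (2 * k.+1) / 2 by rewrite divr_gt0 // exprn_gt0.
have [|i hi] := @pigeonhole_sum R I (fun i => Rintegral mu setT (F i)) _ S0.
  rewrite -mean_sum //.
  apply: (@le_trans _ _ (Rintegral mu setT (fun x => s ^+ (2 * k.+1) * \1_G x))).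
    by rewrite meanZ // ler_wpM2l ?exprn_ge0 ?(ltW s0) //; lra.
  apply: le_mean => //; last exact: bmeas_sum.
  by apply: bmeasM => //; exact: bmeas_cst.
have q0 : 0 < s ^+ (2 * k.+1) / 2 / (2 * (#|{: I}|%:R + 1)).
  by rewrite divr_gt0 // mulr_gt0 // ltr_wpDl.
have oki : ok i.
  apply: contraPT hi => nok; apply/negP; rewrite -ltNge /F (negbTE nok).
  by rewrite mean_cst.
exists i.1, (pt i); split; first exact/asboolP.
apply: le_trans (_ : _ <= Rintegral mu setT (F i)) _; last by rewrite /F oki.
apply: le_trans hi.
have cardI : #|{: I}|%:R + 1 <= W * (s^-1) ^+ d.
  have sV1 : 1 <= s^-1 by rewrite invf_ge1.
  rewrite /W card_prod card_ord card_ffun !card_ord natrM natrX mulrDl mul1r.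
  apply: lerD; last by rewrite exprn_ege1.
  rewrite -mulrA ler_wpM2l // -exprMn; apply: lerXn2r; rewrite ?nnegrE //.
    by rewrite mulr_ge0 ?invr_ge0 ?(ltW s0) // addr_ge0 // mulr_ge0.
  rewrite /n -[leLHS]natr1 [leRHS]mulrDl mul1r; apply: lerD => //.
  by rewrite truncn_le divr_ge0 ?mulr_ge0 // ltW.
have -> : 1 / (4 * W) * s ^+ (2 * k.+1 + d) =
    s ^+ (2 * k.+1) / 2 / (2 * (W * s^-1 ^+ d)).
  by rewrite exprD exprVn; field; rewrite ?expf_neq0 ?gt_eqF.
have W1 : 0 < 2 * (W * s^-1 ^+ d) by rewrite !mulr_gt0 // exprn_gt0 // invr_gt0.
have I1 : 0 < 2 * (#|{: I}|%:R + 1) :> R by rewrite mulr_gt0 // ltr_wpDl.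
by rewrite (ler_pM2l S0) lef_pV2 ?posrE // ler_wpM2l.
Qed.

End grid_mass.

(** * Growth of the derivative *)

Lemma expR_decay_lower_bound (R : realType) (q kappa C : R) : 0 < q -> 0 < kappa ->
  ~ (forall n : nat, q <= C * expR (- (kappa * n%:R))).
Proof.
move=> q0 k0 H.
have C0 : 0 < C.
  by have := H 0%N; rewrite mulr0 oppr0 expR0 mulr1; exact: lt_le_trans.
pose n := (Num.truncn (C / (q * kappa))).+1.
have qk0 : 0 < q * kappa by rewrite mulr_gt0.
have nC : C < q * kappa * n%:R.
  have /andP[_] := truncn_itv (divr_ge0 (ltW C0) (ltW qk0)).
  by rewrite ltr_pdivrMr // mulrC.
have := H n; rewrite expRN ler_pdivlMr ?expR_gt0 // => qC.
have := expR_ge1Dx (kappa * n%:R) => e1.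
have : q * (1 + kappa * n%:R) <= C by apply: le_trans qC; rewrite ler_pM2l.
by rewrite mulrDr mulr1 mulrA; lra.
Qed.

Lemma iter_mul (T : Type) (f : T -> T) (m n : nat) x :
  iter n (iter m f) x = iter (n * m) f x.
Proof. by elim: n => [|n IH] //; rewrite iterS IH mulSn iterD. Qed.

Section mixing_expansion.
Variables (R : realType) (d : nat) (M : ptopologicalType) (A : smooth_atlas R d M).
Hypotheses (hausM : hausdorff_space M) (compM : compact [set: M]).
Variables (B : box_cover A) (K : chart_cover A) (mu : probability (borel M) R).
Variable f : M -> M.
Hypotheses (Cf : C1_map A f) (inv : invariant_measure mu f).
Let bc := @box_chart _ _ _ _ B.

Lemma Cr_norm_ge0 r (phi : M -> R) : 0 <= Cr_norm K r phi.
Proof. exact: bigmax_ge_id. Qed.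

Lemma log_deriv_norm_bmeas n : bmeas (fun x : borel M => ln (1 + deriv_norm B (iter n f) x)).
Proof.
have bd := deriv_norm_bmeas hausM compM B (C1_map_iter n Cf).
have [_ [C hC]] := bd.
split.
  apply: (measurableT_comp (@measurable_ln R)).
  by apply: measurable_funD => //; exact: bd.1.
exists (ln (1 + C)) => x.
have d0 : 0 <= deriv_norm B (iter n f) x by exact: deriv_norm_ge0.
have := hC x; rewrite ger0_norm // => dC.
rewrite ger0_norm ?ln_ge0 ?lerDl // ler_ln ?posrE ?lerD2l //.
  by rewrite ltr_pwDl.
by rewrite ltr_pwDl // (le_trans d0).
Qed.

Hypothesis na : non_atomic mu.
Hypothesis mix : exponentially_mixing K mu f.

(* If [iter N f] expanded typical balls at a rate slower than the mixing rate,
   the image of a ball of radius [exp (- theta n)] around a typical point would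
   remain small after [n] steps, so it would miss one of two separated bumps. *)
Lemma mean_log_deriv_norm_not_cvg0 :
  ~ ((fun n : nat => Rintegral mu setT (fun x =>
      n%:R^-1 * ln (1 + deriv_norm B (iter n f) x))) @ \oo --> (0 : R)).
Proof.
have [r [C [eta [C0 eta0 hmix]]]] := mix => cv.
have [t1 [t2 [v1 v2 S12 p1 p2]]] := separated_bumps hausM compM B r na.
have [Cb0 hCb0] := bump_Cr_norm hausM compM B K r.
pose Cb := Num.max 0 Cb0.
have Cb_ge0 : 0 <= Cb by rewrite le_max lexx.
have hCb l a s : bump_param (B := B) l a s ->
    Cr_norm K r (chart_bump r.+1 (bc l) a s) <= Cb.
  by move=> p; rewrite le_max hCb0 // orbT.
have [c [b [c0 b0 mass]]] := bump_mass hausM compM B mu r.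
pose D := (2 * r.+1 + d)%N.
have D0 : 0 < D%:R :> R by rewrite ltr0n /D addn_gt0.
(* With theta = 2 ep N, the bump mass decays like exp(- theta D n) = exp(- eta N n / 2), against
   exp(- eta N n) from mixing. The mean of ln (1 + |Df^N|) is at most theta / 2, as
   [maxsum_null_set] requires after subtracting theta. *)
pose ep := eta / (4 * D%:R).
have ep0 : 0 < ep by rewrite divr_gt0 // mulr_gt0.
have [N [N0 hN]] : exists N : nat, (0 < N)%N /\
    Rintegral mu setT (fun x => ln (1 + deriv_norm B (iter N f) x)) <= ep * N%:R.
  have /cvgrPdist_le /(_ _ ep0) [m _ hm] := cv.
  exists m.+1; split=> //.
  have := hm m.+1 (leqnSn m); rewrite meanZ; last exact: log_deriv_norm_bmeas.
  rewrite sub0r normrN => /(le_trans (ler_norm _)).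
  by rewrite mulrC ler_pdivrMr ?ltr0n.
have N0' : 0 < N%:R :> R by rewrite ltr0n.
pose F := iter N f; pose theta := 2 * ep * N%:R.
have theta0 : 0 < theta by apply: mulr_gt0 => //; exact: mulr_gt0.
have CF : C1_map A F := C1_map_iter N Cf.
have mF : measurable_fun setT (F : borel M -> borel M).
  by apply: continuous_borel_map; exact: CF.1.
have mf : measurable_fun setT (f : borel M -> borel M).
  by apply: continuous_borel_map; exact: Cf.1.
have invF (V : set (borel M)) : measurable V -> mu (F @^-1` V) = mu V.
  exact: (invariant_iter mf inv N).
have [r1 r10 step1] := box_close_step hausM compM B CF.
have [r2 r20 sep2] := box_close_separated hausM compM B
  (closed_grid_supp hausM v1) (closed_grid_supp hausM v2) S12.
pose r0 := Num.min r1 r2.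
have r00 : 0 < r0 by rewrite lt_min r10.
pose h x := ln (1 + deriv_norm B F x) - theta.
have bh : bmeas (h : borel M -> R).
  by apply: bmeasB; [exact: log_deriv_norm_bmeas|exact: bmeas_cst].
pose q : R := d.+1%:R.
have q0 : 0 < q by [].
(* Two points of a bump of radius q s are less than 2 q s apart, which must not exceed r0 exp(-
   theta n); [b] is the largest mesh allowed by [bump_mass]. *)
pose c0' := Num.min (r0 / (2 * q)) b.
have c0'0 : 0 < c0' by rewrite lt_min b0 divr_gt0 // mulr_gt0.
pose p := Num.min (Rintegral mu setT (grid_bump r.+1 t1)) (Rintegral mu setT (grid_bump r.+1 t2)).
have p0 : 0 < p by rewrite lt_min p1.
apply: (@expR_decay_lower_bound R (c * c0' ^+ D * p) (eta * N%:R / 2) (C * Cb * Cb)).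
- by rewrite !mulr_gt0 // exprn_gt0.
- by rewrite divr_gt0 // mulr_gt0.
move=> n.
pose s := c0' * expR (- theta * n%:R).
have s0 : 0 < s by rewrite mulr_gt0 // expR_gt0.
have e1 : expR (- theta * n%:R) <= 1.
  by rewrite -[leRHS]expR0 ler_expR mulNr oppr_le0 mulr_ge0 // ltW.
have sb : s <= b.
  apply: (@le_trans _ _ c0'); first by rewrite ler_piMr // ltW.
  by rewrite ge_min lexx orbT.
have sr : q * s + q * s <= r0 * expR (- theta * n%:R).
  have : c0' <= r0 / (2 * q) by rewrite ge_min lexx.
  rewrite ler_pdivlMr ?mulr_gt0 // => cr.
  rewrite (_ : q * s + q * s = c0' * (2 * q) * expR (- theta * n%:R)); last by rewrite /s; ring.
  by rewrite ler_wpM2r // expR_ge0.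
pose P := [set x : borel M | 0 < maxsum F h n x].
have bm := bmeas_maxsum mF n bh.
have mP : measurable P by apply: measurable_gt; exact: bm.1.
have half : 1 / 2 <= Rintegral mu setT (\1_(~` P)).
  apply: (maxsum_null_set mF invF n bh theta0).
    by move=> x; rewrite /h lerDr; apply: ln_ge0; rewrite lerDl; exact: deriv_norm_ge0.
  rewrite /h meanB; [|exact: log_deriv_norm_bmeas|exact: bmeas_cst].
  by rewrite mean_cst; apply: le_trans (lerB hN (lexx theta)) _; rewrite /theta; lra.
have s0b : 0 < s <= b by rewrite s0.
have [l [a [pa ha]]] := mass s (~` P) s0b (measurableC mP) half.
have qs0 : 0 < q * s by rewrite mulr_gt0.
set bp := chart_bump r.+1 (bc l) a (q * s) in ha.
have Cbp : Ck_fun A r bp by exact: bump_Ck.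
have bbp : bmeas (bp : borel M -> R).
  split; first by apply: continuous_borel_fun; exact: Ck_fun_continuous Cbp.
  exists (pospow r.+1 ((q * s) ^+ 2)) => x; rewrite ger0_norm ?bump_ge0 //.
  rewrite /bp /chart_bump; case: ifP => _; last exact: pospow_ge0.
  by apply: pospow_le; rewrite lerBlDr lerDl sumr_ge0 // => i _; rewrite sqr_ge0.
have bnP := bmeas_indic R (measurableC mP).
have Ebp : c * s ^+ D <= Rintegral mu setT bp.
  apply: le_trans ha _; apply: le_mean => [||x]; [exact: bmeasM|exact: bbp|].
  by rewrite ler_piMr ?bump_ge0 // indicE; case: (x \in _).
(* The bump has positive integral off [P], so it is positive at some point whose Birkhoff sums are
   controlled up to time [n]; the whole bump follows the orbit of that point. *)
have [x [xP xb]] : exists x, ~ P x /\ 0 < bp x.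
  apply: contrapT => nx; move: ha; apply/negP; rewrite -ltNge.
  rewrite (_ : (fun x => _) = fun=> 0); last first.
    apply/funext => x; have [Px|nPx] := pselect (P x).
      by rewrite indic_out ?mulr0 // => /(_ Px).
    rewrite [bp x](_ : _ = 0) ?mul0r //; apply/eqP; rewrite eq_le bump_ge0 andbT leNgt.
    by apply/negP => bx; apply: nx; exists x.
  by rewrite mean_cst mulr_gt0 // exprn_gt0.
have mx0 : maxsum F h n x = 0.
  by apply/eqP; rewrite eq_le maxsum_ge0 andbT leNgt; apply/negP.
have [xc xa] := bump_gt0 qs0 xb.
have orbit y : 0 < bp y -> box_close B r0 (iter n F x) (iter n F y).
  move=> yb; have [yc ya] := bump_gt0 qs0 yb.
  apply: (box_close_orbit (theta := theta)) => //.
  - exact: ltW.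
  - move=> r' x' y' r'r0; apply: step1; apply: le_trans r'r0 _.
    by rewrite ge_min lexx.
  rewrite -/h mx0 oppr0 sub0r -mulNr; exists l; split=> //.
    exact: (bump_param_box pa xc (ltW xa)).
  apply: lt_le_trans sr; rewrite -(subrKA a); apply: le_lt_trans (ler_normD _ _) _.
  by rewrite ltrD // distrC.
have main (t : 'I_(box_num B) * nat * {ffun 'I_d -> nat}) : grid_valid t ->
    p <= Rintegral mu setT (grid_bump r.+1 t) ->
    (forall y, box_close B r0 (iter n F x) y -> ~ grid_supp t y) ->
    c * s ^+ D * p <= C * expR (- eta * (n * N)%:R) * Cb * Cb.
  move=> v pE miss.
  have [Ct _] : test_fun A r (grid_bump r.+1 t) by exact: grid_bump_test.
  have := hmix bp (grid_bump r.+1 t) Cbp Ct (n * N)%N.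
  (* The image of the bump misses the support of the test bump, so the correlation is 0 and mixing
     bounds the product of the two means. *)
  rewrite (_ : (fun x => bp x * _) = fun=> 0); last first.
    apply/funext => y; have [yb|nyb] := ltP 0 (bp y).
      rewrite grid_supp_bump ?mulr0 // -iter_mul; apply: miss; exact: orbit.
    by rewrite [bp y](_ : _ = 0) ?mul0r //; apply/eqP; rewrite eq_le nyb bump_ge0.
  rewrite mean_cst sub0r normrN => hm.
  apply: (@le_trans _ _ (Rintegral mu setT bp * Rintegral mu setT (grid_bump r.+1 t))).
    by apply: ler_pM => //; [rewrite mulr_ge0 ?exprn_ge0 ?ltW|exact: ltW].
  apply: le_trans (ler_norm _) _; apply: le_trans hm _.
  have Ce0 : 0 <= C * expR (- eta * (n * N)%:R) by rewrite mulr_ge0 ?expR_ge0 // ltW.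
  apply: ler_pM => //.
  - by rewrite mulr_ge0 // Cr_norm_ge0.
  - exact: Cr_norm_ge0.
  - by apply: ler_wpM2l => //; exact: hCb.
  - by apply: hCb; exact: v.1.
have fin : c * s ^+ D * p <= C * expR (- eta * (n * N)%:R) * Cb * Cb.
  have r02 : r0 <= r2 by rewrite ge_min lexx orbT.
  have [m1|m2] := sep2 (iter n F x).
    by apply: (main t1 v1) => [|y cl]; [rewrite ge_min lexx|apply: m1; exact: box_close_le cl].
  by apply: (main t2 v2) => [|y cl]; [rewrite ge_min lexx orbT|apply: m2; exact: box_close_le cl].
have eD : expR (- theta * n%:R) ^+ D = expR (- (eta * N%:R / 2 * n%:R)).
  rewrite -expRM_natl; congr expR; rewrite /theta /ep; field.
  by rewrite gt_eqF.
have eE : expR (- eta * (n * N)%:R) =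
    expR (- (eta * N%:R / 2 * n%:R)) * expR (- (eta * N%:R / 2 * n%:R)).
  by rewrite -expRD; congr expR; rewrite natrM; field.
move: fin; rewrite exprMn eD eE.
set e := expR _; have e0 : 0 < e by exact: expR_gt0.
rewrite (_ : c * (c0' ^+ D * e) * p = c * c0' ^+ D * p * e); last by ring.
rewrite (_ : C * (e * e) * Cb * Cb = C * Cb * Cb * e * e); last by ring.
by rewrite ler_pM2r.
Qed.

End mixing_expansion.

(** * Lyapunov exponents *)

Section limsup.
Variable R : realType.
Implicit Type u : nat -> \bar R.
Local Open Scope ereal_scope.

Lemma limn_esup_le u l : (\forall n \near \oo, u n <= l) -> limn_esup u <= l.
Proof.
move=> ul; rewrite /limn_esup limf_esupE; apply: ge_ereal_inf.
exists (ereal_sup (u @` [set n | u n <= l])); first by exists [set n | u n <= l].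
by apply: ge_ereal_sup => _ [n /= nl <-].
Qed.

Lemma limn_esup_lt u l : limn_esup u < l -> \forall n \near \oo, u n < l.
Proof.
rewrite /limn_esup limf_esupE => /ereal_inf_lt[_ [V /= nV <-] lt].
apply: filterS nV => n Vn; apply: le_lt_trans lt.
by apply: ereal_sup_ubound; exists n.
Qed.

End limsup.

(** * Comparison of the Riemannian norm with chart norms *)

Section metric_bounds.
Variables (R : realType) (d : nat) (M : ptopologicalType) (A : smooth_atlas R d M).
Hypotheses (hausM : hausdorff_space M) (compM : compact [set: M]).
Variables (B : box_cover A) (g : riemannian_metric A).
Let bc := @box_chart _ _ _ _ B.
Let H := @box_set _ _ _ _ B.

Lemma continuous_sum_at (T : topologicalType) (I : Type) (r : seq I)
    (F : I -> T -> R^o) x : (forall i, {for x, continuous (F i)}) ->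
  {for x, continuous (fun z => \sum_(i <- r) F i z : R^o)}.
Proof.
move=> Fc; elim: r => [|i r IH].
  rewrite (_ : (fun z => _) = cst 0); first exact: cst_continuous.
  by apply/funext => z; rewrite big_nil.
rewrite (_ : (fun z => _) = fun z => F i z + \sum_(j <- r) F j z); last first.
  by apply/funext => z; rewrite big_cons.
exact: (continuousD (Fc i) IH).
Qed.

Lemma metric_formE (G : 'M[R]_d) (v w : 'rV[R]_d) :
  metric_form G v w = \sum_j (\sum_i v 0 i * G i j) * w 0 j.
Proof. by rewrite /metric_form mxE; apply: eq_bigr => j _; rewrite !mxE. Qed.

Lemma continuous_metric_mx c i j x : chart_dom c x ->
  {for x, continuous (fun z => metric_mx g c z i j : R^o)}.
Proof.
move=> xc; have im : (chart_map c @` chart_dom c) (chart_map c x) by exists x.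
have [/(_ isT _ im) /= Hc _] := @metric_smooth _ _ _ _ g c 0 i j [::].
have H2 := continuous_comp (chart_map_continuous xc) Hc.
rewrite /prop_for /continuous_at /= in H2 *; rewrite chart_mapK // in H2.
apply: cvg_trans H2; apply: near_eq_cvg.
by apply: filterS (nbhs_chart_dom xc) => y yc /=; rewrite chart_mapK.
Qed.

Let Q l (z : M * 'rV[R]_d) : R^o := metric_form (metric_mx g (bc l) z.1) z.2 z.2.

Let continuous_Q l z : chart_dom (bc l) z.1 -> {for z, continuous (Q l)}.
Proof.
move=> zc; rewrite (_ : Q l = fun z => \sum_j
  (\sum_i z.2 0 i * metric_mx g (bc l) z.1 i j) * z.2 0 j); last first.
  by apply/funext => y; rewrite /Q metric_formE.
have c2 j : {for z, continuous (fun y : M * 'rV[R]_d => y.2 0 j : R^o)}.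
  apply: (@continuous_comp _ _ _ snd (fun v : 'rV[R]_d => v 0 j : R^o)).
    exact: cvg_snd.
  exact: coord_continuous.
have c1 i j : {for z, continuous (fun y : M * 'rV[R]_d => metric_mx g (bc l) y.1 i j : R^o)}.
  apply: (@continuous_comp _ _ _ fst (fun x => metric_mx g (bc l) x i j : R^o)).
    exact: cvg_fst.
  exact: continuous_metric_mx.
apply: continuous_sum_at => j; apply: continuousM; last exact: c2.
apply: continuous_sum_at => i; apply: continuousM; [exact: c2|exact: c1].
Qed.

Lemma metric_formZ (G : 'M[R]_d) (a : R) v :
  metric_form G (a *: v) (a *: v) = a ^+ 2 * metric_form G v v.
Proof.
by rewrite /metric_form linearZ /= -!scalemxAl -scalemxAr scalerA mxE expr2.
Qed.

(** The metric is continuous and positive on the compact set of unit vectors over a box, so it and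
    its inverse are bounded there; homogeneity extends the bounds to all vectors. *)
Lemma metric_bounds : exists2 C : R, 1 <= C & forall l x v, H l x ->
  C^-1 * `|v| <= Num.sqrt (metric_form (metric_mx g (bc l) x) v v) <= C * `|v|.
Proof.
(* Asking for the bounds with every larger constant [C1] makes the condition monotone in [C], as
   [uniform_finite] requires. *)
have [i C C' CC' h|l|C hC] := @uniform_finite R 'I_(box_num B)
  (fun l C => forall C1, Num.max 1 C <= C1 -> forall x v, H l x ->
   C1^-1 * `|v| <= Num.sqrt (metric_form (metric_mx g (bc l) x) v v) <= C1 * `|v|); last first.
- exists (Num.max 1 C); first by rewrite le_max lexx.
  by move=> l; exact: hC.
- pose S := H l `*` [set v : 'rV[R]_d | `|v| = 1].
  have cS : compact S.
    apply: compact_setX.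
      apply: subclosed_compact compM _ => //; exact: closed_box_set.
    apply: (subclosed_compact _ (@compact_closed_box R d 0 1)); last first.
      by move=> v /= v1; rewrite subr0 v1.
    rewrite (_ : [set v | _] = (fun v : 'rV[R]_d => `|v|) @^-1` [set 1]) //.
    apply: (continuous_closedP _).1; first exact: norm_continuous.
    exact: closed_eq.
  have Qpos z : S z -> 0 < Q l z.
    move=> [[zc _] z1]; apply: metric_pos => //.
    by rewrite -normr_eq0 z1 oner_eq0.
  have Qc z : S z -> {for z, continuous (Q l)} by move=> [[zc _] _]; exact: continuous_Q.
  have [C1 h1] := compact_bounded_on cS Qc.
  have [|C2 h2] := @compact_bounded_on R _ S (fun z => (Q l z)^-1) cS.
    by move=> z Sz; apply: (@continuousV _ _ _ z); [rewrite gt_eqF ?Qpos|exact: Qc].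
  exists (Num.max C1 C2) => D; rewrite ge_max => /andP[D1].
  rewrite ge_max => /andP[C1D C2D] x v Hx.
  have D0 : 0 < D by exact: lt_le_trans D1.
  have [->|v0] := eqVneq v 0.
    by rewrite /metric_form !mul0mx mxE sqrtr0 normr0 !mulr0 lexx.
  have nv : 0 < `|v| by rewrite normr_gt0.
  pose w := `|v|^-1 *: v.
  have w1 : `|w| = 1 by rewrite normrZ normfV normr_id mulVf // gt_eqF.
  have Sw : S (x, w) by [].
  have vw : v = `|v| *: w by rewrite scalerA divff ?scale1r // gt_eqF.
  rewrite [in metric_form _ _ _]vw metric_formZ sqrtrM ?sqr_ge0 // sqrtr_sqr normr_id.
  have q0 := Qpos _ Sw; have qC1 := h1 _ Sw; have qC2 := h2 _ Sw.
  rewrite /Q /= in q0 qC1 qC2; move: q0 qC1 qC2; set q := metric_form _ _ _.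
  move=> q0; rewrite !gtr0_norm ?invr_gt0 // => qC1 qC2.
  have DD : D <= D ^+ 2 by rewrite expr2 ler_peMl // ltW.
  have sD : Num.sqrt (D ^+ 2) = D by rewrite sqrtr_sqr gtr0_norm.
  have up : Num.sqrt q <= D.
    by rewrite -sD ler_wsqrtr // (le_trans qC1) // (le_trans C1D).
  have lo : D^-1 <= Num.sqrt q.
    rewrite -sD -sqrtrV ?sqr_ge0 // ler_wsqrtr // -[leRHS]invrK.
    rewrite lef_pV2 ?posrE ?invr_gt0 ?exprn_gt0 //.
    by rewrite (le_trans qC2) // (le_trans C2D).
  by rewrite mulrC [D * _]mulrC !ler_wpM2l.
- move=> C1 mC1; apply: h; apply: le_trans mC1.
  by rewrite ge_max le_max lexx /= le_max CC' orbT.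
Qed.

(** The preferred chart at [F x] may vary irregularly with the point; [metric_compat] exchanges it
    for one of the finitely many box charts. *)
Lemma tangent_norm_chart (F : M -> M) l x (v : 'rV[R]_d) :
  C1_map A F -> H l (F x) ->
  tangent_norm g (F x) (tangent_map A F x v) =
  Num.sqrt (metric_form (metric_mx g (bc l) (F x))
    (v *m Jchart F (chart_at A x) (bc l) x) (v *m Jchart F (chart_at A x) (bc l) x)).
Proof.
move=> CF Hl; rewrite /tangent_norm /tangent_map; congr Num.sqrt.
have x0 := chart_at_dom A x; have y0 := chart_at_dom A (F x); have yl := Hl.1.
have s1 := CF.2 _ _ x x0 y0.
have e1 := sdiff_diff v s1.
rewrite -/(in_charts F (chart_at A x) (chart_at A (F x))) e1.
have -> : Jchart F (chart_at A x) (chart_at A (F x)) x =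
    Jchart F (chart_at A x) (bc l) x *m Jchart id (bc l) (chart_at A (F x)) (F x).
  exact: (Jchart_comp CF (C1_map_id A) x0 yl y0).
have s2 := (C1_map_id A).2 _ _ (F x) yl y0.
rewrite mulmxA -(sdiff_diff _ s2).
exact: metric_compat.
Qed.

(** The constant depends on [x] but not on [F], so for iterates it disappears in (1/n) log. *)
Lemma tangent_norm_le x : exists2 C : R, 0 <= C & forall F, C1_map A F ->
  forall i, tangent_norm g (F x) (tangent_map A F x (delta_mx 0 i)) <=
    C * deriv_norm B F x.
Proof.
have [C C1 hC] := metric_bounds; have [l Hl] := box_set_cover B x.
exists (C * entry_norm (Jchart id (chart_at A x) (bc l) x)).
  by rewrite mulr_ge0 ?entry_norm_ge0 // (le_trans _ C1).
move=> F CF i; have [l' Hl'] := box_set_cover B (F x).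
rewrite (tangent_norm_chart _ CF Hl').
have /andP[_] := hC l' (F x) (delta_mx 0 i *m Jchart F (chart_at A x) (bc l') x) Hl'.
move=> /le_trans; apply; rewrite -mulrA ler_wpM2l //; first by rewrite (le_trans _ C1).
apply: le_trans (mul_row_norm_le _ _) _; rewrite norm_delta_mx mulr1.
have -> : Jchart F (chart_at A x) (bc l') x =
    Jchart id (chart_at A x) (bc l) x *m Jchart F (bc l) (bc l') x.
  exact: (Jchart_comp (C1_map_id A) CF (chart_at_dom A x) Hl.1 Hl'.1).
apply: le_trans (entry_norm_mul _ _) _; rewrite ler_wpM2l ?entry_norm_ge0 //.
exact: le_deriv_norm.
Qed.

Lemma deriv_norm_le x : exists2 C : R, 0 <= C & forall F, C1_map A F ->
  deriv_norm B F x <=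
    C * \sum_i tangent_norm g (F x) (tangent_map A F x (delta_mx 0 i)).
Proof.
have [C C1 hC] := metric_bounds.
have C0 : 0 <= C by rewrite (le_trans _ C1).
pose T l := entry_norm (Jchart id (bc l) (chart_at A x) x).
exists (\sum_(l < box_num B) \sum_(l' < box_num B) T l * (d%:R * C)).
  by do 2 apply: sumr_ge0 => ? _; rewrite !mulr_ge0 ?entry_norm_ge0.
move=> F CF; set S := (X in _ <= _ * X).
have S0 : 0 <= S by apply: sumr_ge0 => i _; exact: sqrtr_ge0.
rewrite mulr_suml; apply: ler_sum => l _; rewrite mulr_suml; apply: ler_sum => l' _.
have [[Hl Hl']|nH] := pselect (H l x /\ H l' (F x)); last first.
  by rewrite deriv_term_out // !mulr_ge0 // entry_norm_ge0.
rewrite deriv_term_in //.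
have -> : Jchart F (bc l) (bc l') x =
    Jchart id (bc l) (chart_at A x) x *m Jchart F (chart_at A x) (bc l') x.
  exact: (Jchart_comp (C1_map_id A) CF Hl.1 (chart_at_dom A x) Hl'.1).
apply: le_trans (entry_norm_mul _ _) _; rewrite -/(T l) -!mulrA.
rewrite ler_wpM2l ?entry_norm_ge0 //; apply: le_trans (entry_norm_rows _) _.
rewrite ler_wpM2l // mulr_sumr; apply: ler_sum => i _.
rewrite (tangent_norm_chart _ CF Hl') rowE.
have /andP[lo _] := hC l' (F x) (delta_mx 0 i *m Jchart F (chart_at A x) (bc l') x) Hl'.
by rewrite -ler_pdivrMl // (lt_le_trans _ C1).
Qed.

End metric_bounds.

(** * The exponential growth rate of the derivative *)

Section top_exponent.
Variables (R : realType) (d : nat) (M : ptopologicalType) (A : smooth_atlas R d M).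
Hypotheses (hausM : hausdorff_space M) (compM : compact [set: M]).
Variables (B : box_cover A) (f : M -> M).
Hypothesis Cf : C1_map A f.

Definition growth (n : nat) (x : M) : R :=
  n%:R^-1 * ln (1 + deriv_norm B (iter n f) x).

Let dn n x := deriv_norm B (iter n f) x.

Let dn_ge0 n x : 0 <= dn n x. Proof. exact: deriv_norm_ge0. Qed.

Let log_dn_ge0 n x : 0 <= ln (1 + dn n x).
Proof. by rewrite ln_ge0 // lerDl. Qed.

Let log_dnS n x : ln (1 + dn n.+1 x) <= ln (1 + dn 1 x) + ln (1 + dn n (f x)).
Proof.
have a0 := dn_ge0 1 x; have b0 := dn_ge0 n (f x); have c0 := dn_ge0 n.+1 x.
rewrite -lnM ?posrE ?ltr_pwDl // ler_ln ?posrE ?mulr_gt0 ?ltr_pwDl //.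
have : dn n.+1 x <= dn 1 x * dn n (f x).
  have := deriv_norm_comp B x Cf (C1_map_iter n Cf).
  rewrite (_ : iter n f \o f = iter n.+1 f) //.
  by apply/funext => y; rewrite iterSr.
rewrite mulrDl mul1r mulrDr mulr1; lra.
Qed.

Lemma growth_ge0 n x : 0 <= growth n x.
Proof. by rewrite mulr_ge0 ?invr_ge0 ?log_dn_ge0. Qed.

Lemma growth_bounded : exists C : R, forall n x, growth n x <= C.
Proof.
have [_ [C0 h0]] := log_deriv_norm_bmeas hausM compM B Cf 0.
have [_ [C1 h1]] := log_deriv_norm_bmeas hausM compM B Cf 1.
have h0' x : ln (1 + dn 0 x) <= C0 by exact: le_trans (ler_norm _) (h0 x).
have h1' x : ln (1 + dn 1 x) <= C1 by exact: le_trans (ler_norm _) (h1 x).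
have C00 : 0 <= C0 by exact: le_trans (normr_ge0 _) (h0 point).
have C10 : 0 <= C1 by exact: le_trans (normr_ge0 _) (h1 point).
have H n x : ln (1 + dn n x) <= C0 + n%:R * C1.
  elim: n x => [|n IH] x; first by rewrite mul0r addr0.
  apply: le_trans (log_dnS n x) _.
  by rewrite -natr1 mulrDl mul1r; have := IH (f x); have := h1' x; lra.
exists (C0 + C1) => -[|n] x; first by rewrite /growth invr0 mul0r addr_ge0.
rewrite /growth ler_pdivrMl ?ltr0n //; apply: le_trans (H n.+1 x) _.
rewrite mulrDr lerD2r ler_peMl // ler1n //.
Qed.

(* The term 1 in [growth] makes this the positive part of the largest exponent. *)
Definition top_exponent (x : M) : R := fine (limn_esup (fun n => (growth n x)%:E)).

Lemma top_exponentE x : (top_exponent x)%:E = limn_esup (fun n => (growth n x)%:E).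
Proof.
have [C hC] := growth_bounded.
rewrite /top_exponent fineK // fin_numElt; apply/andP; split.
  apply: (@lt_le_trans _ _ (-1)%:E); first exact: ltNyr.
  rewrite leNgt; apply/negP => /limn_esup_lt [N _ /(_ N (leqnn N))] /=.
  by rewrite lte_fin ltNge (le_trans _ (growth_ge0 N x)).
apply: (@le_lt_trans _ _ C%:E); last exact: ltry.
by apply: limn_esup_le; apply: nearW => n; rewrite lee_fin.
Qed.

Lemma top_exponent_le x (t : R) :
  (\forall n \near \oo, growth n x <= t) -> top_exponent x <= t.
Proof.
by move=> H; rewrite -lee_fin top_exponentE; apply: limn_esup_le; apply: filterS H.
Qed.

Lemma top_exponent_lt x (t : R) :
  top_exponent x < t -> \forall n \near \oo, growth n x < t.
Proof.
by rewrite -lte_fin top_exponentE => /limn_esup_lt; apply: filterS.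
Qed.

Lemma top_exponent_bounded : exists2 C : R, 0 <= C & forall x, top_exponent x <= C.
Proof.
have [C hC] := growth_bounded; exists C.
  exact: le_trans (growth_ge0 0 point) (hC 0%N point).
by move=> x; apply: top_exponent_le; apply: nearW => n.
Qed.

Lemma near_inv_lt (e : R) : 0 < e -> \forall n \near \oo, n%:R^-1 < e.
Proof.
move=> e0; exists (Num.truncn e^-1).+1 => //= n nn.
have /andP[_ lt] := truncn_itv (ltW (etrans (invr_gt0 e) e0)).
have n0 : 0 < n%:R :> R by rewrite ltr0n; exact: leq_ltn_trans nn.
rewrite -[e]invrK ltf_pV2 ?posrE ?invr_gt0 //.
by apply: lt_le_trans lt _; rewrite ler_nat.
Qed.

(** The first factor of Df^(n+1) at [x] is Df at [x], whose contribution is bounded in n and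
    vanishes after division by n; the rest is Df^n at [f x]. *)
Lemma top_exponent_forward x : top_exponent x <= top_exponent (f x).
Proof.
apply/ler_addgt0Pr => e e0.
have e20 : 0 < e / 2 by rewrite divr_gt0.
have : top_exponent (f x) < top_exponent (f x) + e / 2 by rewrite ltrDl.
move=> /top_exponent_lt [N _ hN].
pose L := ln (1 + dn 1 x).
have L0 : 0 <= L by exact: log_dn_ge0.
have e3 : 0 < e / 2 / (L + 1) by rewrite divr_gt0 // ltr_wpDl.
have [N2 _ hN2] := near_inv_lt e3.
apply: top_exponent_le; exists (N.+2 + N2)%N => // n /= nn.
have n1 : (N.+2 <= n)%N by apply: leq_trans nn; exact: leq_addr.
have n2 : (N2 <= n)%N by apply: leq_trans nn; exact: leq_addl.
case: n n1 n2 {nn} => // -[//|n] n1 n2.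
have h1 : growth n.+1 (f x) <= top_exponent (f x) + e / 2.
  by apply/ltW/hN; exact: leq_trans (leqnSn _) n1.
have h2 := ltW (hN2 n.+2 n2).
have n0 : 0 < n.+2%:R :> R by [].
rewrite /growth ler_pdivrMl //; apply: le_trans (log_dnS n.+1 x) _.
have a1 : L <= n.+2%:R * (e / 2).
  have : n.+2%:R^-1 * (L + 1) <= e / 2 by rewrite -ler_pdivlMr ?ltr_wpDl.
  rewrite ler_pdivrMl //; lra.
have a2 : ln (1 + dn n.+1 (f x)) <= n.+2%:R * (top_exponent (f x) + e / 2).
  have t0 : 0 <= top_exponent (f x) + e / 2.
    exact: le_trans (growth_ge0 n.+1 (f x)) h1.
  move: h1; rewrite /growth ler_pdivrMl // => /le_trans; apply.
  by rewrite ler_wpM2r // ler_nat.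
have -> : n.+2%:R * (top_exponent (f x) + e) =
  n.+2%:R * (e / 2) + n.+2%:R * (top_exponent (f x) + e / 2) by field.
exact: lerD.
Qed.

Lemma top_exponent_measurable : measurable_fun setT (top_exponent : borel M -> R).
Proof.
apply: (measurableT_comp (@fine_measurable R setT measurableT)).
apply: measurable_fun_limn_esup => n; apply/measurable_EFinP.
apply: measurable_funM; first exact: measurable_cst.
exact: (log_deriv_norm_bmeas hausM compM B Cf n).1.
Qed.

End top_exponent.

Section attained_exponent.
Variables (R : realType) (d : nat) (M : ptopologicalType) (A : smooth_atlas R d M).
Hypotheses (hausM : hausdorff_space M) (compM : compact [set: M]).
Variables (B : box_cover A) (g : riemannian_metric A) (f : M -> M).
Hypothesis Cf : C1_map A f.

Let tau (i : 'I_d) n x := tangent_norm g (iter n f x) (tangent_map A (iter n f) x (delta_mx 0 i)).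

Lemma delta_mx_neq0 (i : 'I_d) : delta_mx 0 i != 0 :> 'rV[R]_d.
Proof. by rewrite -normr_eq0 norm_delta_mx oner_eq0. Qed.

Lemma ln_le_ln1D (t : R) : 0 <= t -> ln t <= ln (1 + t).
Proof.
(* At t = 0 the convention that [ln] is 0 at 0 gives equality. *)
rewrite le_eqVlt => /orP[/eqP <-|t0]; first by rewrite ln0 // addr0 ln1.
by rewrite ler_ln ?posrE ?ltr_pwDl ?(ltW t0) // lerDr.
Qed.

Lemma lyapunov_le_top_exponent x (i : 'I_d) : 0 <= top_exponent B f x ->
  (lyapunov_exponent_at g f x (delta_mx 0%R i) <= (top_exponent B f x)%:E)%E.
Proof.
move=> top0; have [C C0 hC] := tangent_norm_le hausM compM B g x.
apply/lee_addgt0Pr => e e0; rewrite -EFinD.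
have e20 : 0 < e / 2 by rewrite divr_gt0.
have lt : top_exponent B f x < top_exponent B f x + e / 2 by rewrite ltrDl.
have L0 : 0 <= ln (1 + C) by rewrite ln_ge0 // lerDl.
have e3 : 0 < e / 2 / (ln (1 + C) + 1) by rewrite divr_gt0 // ltr_wpDl.
have [N1 _ h1] := top_exponent_lt hausM compM Cf lt.
have [N2 _ h2] := near_inv_lt e3.
apply: limn_esup_le; exists (N1 + N2)%N => // n /= nn; rewrite lee_fin.
have {}h1 : growth B f n x < top_exponent B f x + e / 2.
  by apply: h1; apply: leq_trans nn; exact: leq_addr.
have {}h2 : n%:R^-1 < e / 2 / (ln (1 + C) + 1).
  by apply: h2; apply: leq_trans nn; exact: leq_addl.
have dn0 : 0 <= deriv_norm B (iter n f) x by exact: deriv_norm_ge0.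
have tau0 : 0 <= tau i n x by exact: sqrtr_ge0.
have tauC : tau i n x <= C * deriv_norm B (iter n f) x.
  exact: hC (C1_map_iter n Cf) i.
apply: (@le_trans _ _ (n%:R^-1 * (ln (1 + C) + ln (1 + deriv_norm B (iter n f) x)))).
  rewrite ler_wpM2l ?invr_ge0 //; apply: le_trans (ln_le_ln1D tau0) _.
  rewrite -lnM ?posrE ?ltr_pwDl // ler_ln ?posrE ?mulr_gt0 ?ltr_pwDl //.
  by rewrite mulrDl mul1r mulrDr mulr1; lra.
have h3 : n%:R^-1 * (ln (1 + C) + 1) < e / 2 by rewrite -ltr_pdivlMr // ltr_wpDl.
have i0 : 0 <= n%:R^-1 :> R by rewrite invr_ge0.
move: h1; rewrite /growth mulrDr; move: h3; rewrite mulrDr mulr1.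
move: i0 (n%:R^-1 * ln _) (n%:R^-1 * ln _) => i0 a b; lra.
Qed.

(** If every coordinate vector had an exponent below some m < lam, then |Df^n| would be at most C d
    exp(n m) for large n, since finitely many coordinate vectors control the matrix; the growth rate
    would be below lam. *)
Lemma lyapunov_attains_top_exponent x : 0 < top_exponent B f x ->
  exists2 v : 'rV[R]_d, v != 0 &
    lyapunov_exponent_at g f x v = (top_exponent B f x)%:E.
Proof.
set lam := top_exponent B f x => lam0.
suff [i hi] : exists i, (lam%:E <= lyapunov_exponent_at g f x (delta_mx 0%R i))%E.
  exists (delta_mx 0 i); first exact: delta_mx_neq0.
  apply/eqP; rewrite eq_le hi andbT; apply: lyapunov_le_top_exponent.
  exact: ltW.
apply: contrapT => /forallNP ni.
have ex_t i : exists t : R, t < lam /\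
    (lyapunov_exponent_at g f x (delta_mx 0%R i) < t%:E)%E.
  have := ni i => /negP; rewrite -ltNge; case: (lyapunov_exponent_at _ _ _ _) => [r| |] //.
    rewrite lte_fin => rl; exists ((r + lam) / 2); rewrite lte_fin; split; lra.
  by move=> _; exists (lam - 1); split; [lra|exact: ltNyr].
have [t ht] := choice ex_t.
(* The initial value lam / 2 keeps [m] positive, so that the 1 in [growth] is absorbed by exp(n m)
   >= 1. *)
pose m := \big[Num.max/lam / 2]_i t i.
have mlam : m < lam.
  by apply/bigmax_ltP; split=> [|i _]; [lra|exact: (ht i).1].
have m0 : 0 < m by apply: lt_le_trans (bigmax_ge_id _ _ _ _); lra.
have mt i : (lyapunov_exponent_at g f x (delta_mx 0%R i) < m%:E)%E.
  by apply: lt_le_trans (ht i).2 _; rewrite lee_fin; exact: le_bigmax.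
have [C C0 hC] := deriv_norm_le hausM compM B g x.
have near_all : \forall n \near \oo, forall i,
    ((n%:R^-1 * ln (tau i n x))%:E < m%:E)%E.
  apply: (@filter_forall _ _ (fun i n => ((n%:R^-1 * ln (tau i n x))%:E < m%:E)%E) \oo _).
  by move=> i; exact: limn_esup_lt (mt i).
have [N1 _ h1] := near_all.
pose L := ln (1 + C * d%:R).
have L0 : 0 <= L by rewrite ln_ge0 // lerDl mulr_ge0.
have e0 : 0 < (lam - m) / 2 by lra.
have e3 : 0 < (lam - m) / 2 / (L + 1) by rewrite divr_gt0 // ltr_wpDl.
have [N2 _ h2] := near_inv_lt e3.
suff : lam <= m + (lam - m) / 2 by lra.
apply: (top_exponent_le hausM compM Cf); exists (N1 + N2).+1 => // n /= nn.
have {}h1 i : n%:R^-1 * ln (tau i n x) < m.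
  rewrite -lte_fin; apply: h1; apply: leq_trans (leq_trans (leqnSn _) nn); exact: leq_addr.
have {}h2 : n%:R^-1 < (lam - m) / 2 / (L + 1).
  by apply: h2; apply: leq_trans (leq_trans (leqnSn _) nn); exact: leq_addl.
have n0 : 0 < n%:R :> R by rewrite ltr0n; apply: leq_trans nn.
have tau_le i : tau i n x <= expR (n%:R * m).
  have [t0|t0] := leP (tau i n x) 0; first by apply: le_trans t0 (expR_ge0 _).
  rewrite -[leLHS]lnK ?posrE // ler_expR; apply: ltW.
  by have := h1 i; rewrite ltr_pdivrMl.
have dn_le : deriv_norm B (iter n f) x <= C * d%:R * expR (n%:R * m).
  apply: le_trans (hC _ (C1_map_iter n Cf)) _; rewrite -mulrA ler_wpM2l //.
  apply: (@le_trans _ _ (\sum_(i < d) expR (n%:R * m))).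
    by apply: ler_sum => i _; exact: tau_le.
  by rewrite sumr_const card_ord -[leLHS]mulr_natl.
have dn0 : 0 <= deriv_norm B (iter n f) x by exact: deriv_norm_ge0.
have E1 : 1 <= expR (n%:R * m) by rewrite -[leLHS]expR0 ler_expR mulr_ge0 // ltW.
have CD0 : 0 <= C * d%:R by rewrite mulr_ge0.
have : ln (1 + deriv_norm B (iter n f) x) <= L + n%:R * m.
  rewrite -[n%:R * m]expRK /L -lnM ?posrE ?expR_gt0 ?ltr_pwDl //.
  rewrite ler_ln ?posrE ?mulr_gt0 ?expR_gt0 ?ltr_pwDl //.
  by rewrite mulrDl mul1r lerD.
move=> hl; rewrite /growth ler_pdivrMl //; apply: le_trans hl _.
have : n%:R^-1 * (L + 1) < (lam - m) / 2 by rewrite -ltr_pdivlMr // ltr_wpDl.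
rewrite ltr_pdivrMl // mulrDr; lra.
Qed.

End attained_exponent.

(** * The growth rate is almost everywhere constant and positive *)

Section constant_exponent.
Variables (R : realType) (d : nat) (M : ptopologicalType) (A : smooth_atlas R d M).
Hypotheses (hausM : hausdorff_space M) (compM : compact [set: M]).
Variables (B : box_cover A) (K : chart_cover A) (mu : probability (borel M) R).
Variable f : M -> M.
Hypotheses (Cf : C1_map A f) (inv : invariant_measure mu f).
Hypothesis na : non_atomic mu.
Hypothesis mix : exponentially_mixing K mu f.

Local Notation top := (top_exponent B f).

Lemma test_correlation_cvg : exists r, forall phi, test_fun A r phi ->
  (fun n : nat => Rintegral mu setT (fun x => phi x * phi (iter n f x))) @ \oo -->
    Rintegral mu setT phi ^+ 2.
Proof.
have [r [C [eta [C0 eta0 hmix]]]] := mix; exists r => phi [Cphi _].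
pose D := C * Cr_norm K r phi * Cr_norm K r phi.
have D0 : 0 <= D by rewrite !mulr_ge0 ?Cr_norm_ge0 // ltW.
apply/cvgrPdist_le => e e0.
have e3 : 0 < e * eta / (D + 1) by rewrite divr_gt0 ?mulr_gt0 // ltr_wpDl.
have [N _ hN] := near_inv_lt e3.
exists N.+1 => // n /= nn; rewrite distrC expr2.
apply: le_trans (hmix phi phi Cphi Cphi n) _.
have n0 : 0 < n%:R :> R by rewrite ltr0n; apply: leq_trans nn.
have {}hN : n%:R^-1 < e * eta / (D + 1) by apply: hN; exact: leq_trans nn.
have en0 : 0 < eta * n%:R by rewrite mulr_gt0.
have -> : C * expR (- eta * n%:R) * Cr_norm K r phi * Cr_norm K r phi = D * expR (- eta * n%:R).
  by rewrite /D; ring.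
rewrite mulNr expRN ler_pdivrMr ?expR_gt0 //.
apply: (@le_trans _ _ (e * (eta * n%:R))); last first.
  rewrite ler_wpM2l ?ltW //; apply: lt_le_trans (expR_ge1Dx _).
  by rewrite ltrDr.
move: hN; rewrite ltr_pdivlMr ?ltr_wpDl // ltr_pdivrMl // mulrA.
by rewrite [n%:R * _]mulrC mulrA; lra.
Qed.

Let level (t : R) : set (borel M) := [set x | t < top x].

Let mlevel t : measurable (level t).
Proof. by apply: measurable_gt; exact: top_exponent_measurable. Qed.

Let level01 t : mu (level t) = 0%E \/ mu (level t) = 1%E.
Proof.
have mf : measurable_fun setT (f : borel M -> borel M).
  by apply: continuous_borel_map; exact: Cf.1.
have [r hr] := test_correlation_cvg.
have e : fine (mu (level t)) = fine (mu (level t)) ^+ 2.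
  apply: (forward_invariant_01 mf inv (mlevel t)).
    by move=> x /= tx; apply: lt_le_trans tx _; exact: top_exponent_forward.
  move=> e e0; have [_ /(_ e e0)[phi Tphi le]] :=
    approximable_borel hausM compM B mu r (mlevel t).
  by exists phi; split; [exact: test_bmeas Tphi|exact: Tphi.2|exact: le|exact: hr].
have fin : mu (level t) \is a fin_num by exact: fin_num_measure.
rewrite -(fineK fin); move: e; set p := fine _ => /eqP.
rewrite expr2 -subr_eq0 -{1}[p]mulr1 -mulrBr mulf_eq0 subr_eq0.
by case/orP=> /eqP e; [left; rewrite e|right; rewrite -e].
Qed.

Let null_level t : mu (level t) = 0%E -> mu.-negligible (level t).
Proof. by move=> m0; exists (level t); split. Qed.

(** Otherwise all positive levels are null, so the bounded nonnegative functions [growth] tend to 0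
    almost everywhere and so do their means, against [mean_log_deriv_norm_not_cvg0]. *)
Lemma top_exponent_pos_level : exists2 t : R, 0 < t & mu (level t) = 1%E.
Proof.
apply: contrapT => nt.
have null t : 0 < t -> mu (level t) = 0%E.
  by move=> t0; have [//|m1] := level01 t; case: nt; exists t.
apply: (mean_log_deriv_norm_not_cvg0 hausM compM (B := B) (K := K) Cf inv na mix).
have [C hC] := growth_bounded hausM compM B Cf.
apply: (@mean_cvg0 _ _ _ mu (fun n => growth B f n) C).
- move=> n; apply: bmeasM; first exact: bmeas_cst.
  exact: log_deriv_norm_bmeas.
- by move=> n x; rewrite ger0_norm // growth_ge0.
have : mu.-negligible (\bigcup_k level k.+1%:R^-1).
  by apply: negligible_bigcup => k; apply/null_level/null; rewrite invr_gt0.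
apply: negligibleS => x /= ncv; apply: contrapT => nlev; apply: ncv.
have top0 : top x <= 0.
  rewrite leNgt; apply/negP => tx; apply: nlev.
  have [k _ hk] := near_inv_lt tx; exists k => //=.
  by apply: hk => /=; exact: leqnSn.
apply/cvgrPdist_le => e e0; have := le_lt_trans top0 e0.
move=> /(top_exponent_lt hausM compM Cf); apply: filterS => n lt.
by rewrite sub0r normrN ger0_norm ?growth_ge0 // ltW.
Qed.

(** The constant is the supremum of the levels of full mass: levels above it are null and levels
    below it are conull, and the countably many levels at distance 1/(k+1) suffice. *)
Lemma top_exponent_ae_constant : exists2 lam : R, 0 < lam &
  {ae mu, forall x, top x = lam}.
Proof.
have [t0 t00 m0] := top_exponent_pos_level.
have [C C0 hC] := top_exponent_bounded hausM compM B Cf.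
pose S := [set t | mu (level t) = 1%E].
have Sub : has_ubound S.
  exists C => t St; rewrite leNgt; apply/negP => Ct.
  have : level t = set0.
    by apply/seteqP; split=> x //= tx; have := lt_le_trans (lt_trans Ct tx) (hC x); rewrite ltxx.
  by move=> e; move: St; rewrite /S /= e measure0 => /eqP; rewrite eqe eq_sym oner_eq0.
have S0 : S !=set0 by exists t0.
pose lam := sup S.
have lam0 : 0 < lam by apply: lt_le_trans t00 _; exact: ub_le_sup.
exists lam => //.
have above t : lam < t -> mu.-negligible (level t).
  move=> lt; apply: null_level; have [//|m1] := level01 t.
  by have := ub_le_sup Sub m1; rewrite leNgt lt.
have below t : t < lam -> mu.-negligible (~` level t).
  move=> /(sup_gt S0)[s Ss ts]; exists (~` level s); split.
  - exact: measurableC.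
  - by rewrite probability_setC // Ss subee.
  - by apply: subsetC => x /= sx; exact: lt_trans sx.
have n1 : mu.-negligible (\bigcup_k level (lam + k.+1%:R^-1)).
  by apply: negligible_bigcup => k; apply: above; rewrite ltrDl invr_gt0.
have n2 : mu.-negligible (\bigcup_k ~` level (lam - k.+1%:R^-1)).
  by apply: negligible_bigcup => k; apply: below; rewrite ltrBlDr ltrDl invr_gt0.
apply: negligibleS (negligibleU n1 n2) => x /= ne.
have [lt|lt|//] := ltgtP (top x) lam.
  have e0 : 0 < lam - top x by rewrite subr_gt0.
  right; have [k _ hk] := near_inv_lt e0; exists k => //= h.
  have hk' : k.+1%:R^-1 < lam - top x by exact: hk (leqnSn k).
  by move: h hk'; rewrite /level /=; move: (k.+1%:R^-1) => u; lra.
have e0 : 0 < top x - lam by rewrite subr_gt0.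
left; have [k _ hk] := near_inv_lt e0; exists k => //=.
have hk' : k.+1%:R^-1 < top x - lam by exact: hk (leqnSn k).
by move: hk'; rewrite /level /=; move: (k.+1%:R^-1) => u; lra.
Qed.

End constant_exponent.

Theorem proposition1p3 (R : realType) (d : nat) (M : ptopologicalType)
    (A : smooth_atlas R d M) (K : chart_cover A) (g : riemannian_metric A)
    (alpha : R) (f : M -> M) (mu : probability (borel M) R)
    (hausM : hausdorff_space M) (compM : compact [set: M])
    (alpha_gt0 : 0 < alpha)
    (f_diffeo : C1plus_diffeo A alpha f)
    (mu_inv : invariant_measure mu f)
    (mu_non_atomic : non_atomic mu)
    (f_mixing : exponentially_mixing K mu f) :
  exists lambda : R, 0 < lambda /\ is_lyapunov_exponent g f mu lambda.
Proof.
have Cf : C1_map A f by have [? [_ _ Cf _]] := f_diffeo; exact: C1plus_C1_map Cf.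
have [B] := ex_box_cover A compM.
have [lam lam0 ae_lam] :=
  top_exponent_ae_constant hausM compM B Cf mu_inv mu_non_atomic f_mixing.
exists lam; split=> //; apply: negligibleS ae_lam => x /= nl topx; apply: nl.
have top0 : 0 < top_exponent B f x by rewrite topx.
have [v v0 hv] := lyapunov_attains_top_exponent hausM compM g Cf top0.
by exists v => //; rewrite hv topx.
Qed.
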